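(* Let $a\geq b\geq c>0$ be real numbers. The smallest non-zero eigenvalue of the Laplace--Beltrami operator on $\mathrm{SU}(2)$ endowed with the left-invariant metric $g_{(a,b,c)}$ is $$\lambda_1(\mathrm{SU}(2),g_{(a,b,c)})=\min\{a^{2}+b^{2}+c^{2},\;4(b^2+c^2)\}.$$ Moreover, the multiplicity of $\lambda_1(\mathrm{SU}(2),g_{(a,b,c)})$ as an eigenvalue of the Laplace--Beltrami operator of $(\mathrm{SU}(2),g_{(a,b,c)})$ is equal to four if $a^{2}+b^{2}+c^{2}<4(b^2+c^2)$, seven if $a^{2}+b^{2}+c^{2}=4(b^2+c^2)$, and three if $a^{2}+b^{2}+c^{2}>4(b^2+c^2)$.
   Context: In $\mathfrak{su}(2)$ set $X_1=\begin{pmatrix} i&0\\0&-i\end{pmatrix}$, $X_2=\begin{pmatrix}0&1\\-1&0\end{pmatrix}$, $X_3=\begin{pmatrix}0&i\\i&0\end{pmatrix}$. For positive reals $a,b,c$, $g_{(a,b,c)}$ denotes the left-invariant Riemannian metric on $\mathrm{SU}(2)$ whose inner product on $\mathfrak{su}(2)$ (the tangent space at the identity) has $\{aX_1,bX_2,cX_3\}$ as an orthonormal basis. The Laplace--Beltrami operator is taken with the sign convention making it non-negative; its eigenvalues on a compact connected Riemannian manifold $(M,g)$, counted with multiplicity, are $0=\lambda_0(M,g)<\lambda_1(M,g)\leq\lambda_2(M,g)\leq\cdots$. *)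

(* Defs.v *)
From mathcomp Require Import all_boot all_order all_algebra.
From mathcomp Require Import all_classical all_reals all_analysis ring lra.
From mathcomp Require Import complex.

Set Implicit Arguments.
Unset Strict Implicit.
Unset Printing Implicit Defensive.

Import Order.TTheory GRing.Theory Num.Theory numFieldNormedType.Exports.
Import complex.

Local Open Scope classical_set_scope.
Local Open Scope ring_scope.
Local Open Scope complex_scope.
Local Open Scope sesquilinear_scope.

Definition SU2 (R : realType) : Type :=
  {p : 'M[R[i]]_2 | (p \is unitarymx) && (\det p == 1)}.

Definition su2 (R : realType) : set 'M[R[i]]_2 :=
  [set X | X^t* = - X /\ \tr X = 0].

(* T_p SU(2), as a real subspace of the 2 x 2 complex matrices, is p su(2). *)
Definition tangent (R : realType) (p : SU2 R) : set 'M[R[i]]_2 :=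
  [set v | exists2 X, @su2 R X & v = val p *m X].

Definition vfield (R : realType) : Type := SU2 R -> 'M[R[i]]_2.

Definition mx22 (T : nzRingType) (x y z w : T) : 'M[T]_2 :=
  \matrix_(i < 2, j < 2) nth 0 (nth [::] [:: [:: x; y]; [:: z; w]] i) j.

(* The basis X_1, X_2, X_3 of su(2), indexed from 0. *)
Definition su2_basis (R : realType) (k : 'I_3) : 'M[R[i]]_2 :=
  nth 0 [:: mx22 'i 0 0 (- 'i); mx22 0 1 (- 1) 0; mx22 0 'i 'i 0] k.

(* Coordinates in that basis; see su2_coordP. *)
Definition su2_coord (R : realType) (X : 'M[R[i]]_2) (k : 'I_3) : R :=
  nth 0 [:: Im (X 0 0); Re (X 0 1); Im (X 0 1)] k.

(* Smooth functions.  A map on a finite-dimensional normed space is C^oo when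
   it is C^k for all k.  SU(2) is a closed submanifold of the space of 2 x 2
   complex matrices, identified with R^8 by separating real and imaginary
   parts, so its smooth functions are the restrictions of the ambient ones. *)
Fixpoint Ck (R : realType) (V : normedModType R) (k : nat) (F : V -> R) : Prop :=
  match k with
  | 0 => continuous F
  | k'.+1 => (forall x, differentiable F x) /\
             (forall v : V, Ck k' (fun x => 'D_v F x))
  end.

Definition ReIm (R : realType) (A : 'M[R[i]]_2) : 'M[R]_2 * 'M[R]_2 :=
  (map_mx (@Re R) A, map_mx (@Im R) A).

Definition smooth (R : realType) (f : SU2 R -> R) : Prop :=
  exists2 F : 'M[R]_2 * 'M[R]_2 -> R,
    (forall k, Ck k F) & forall p, f p = F (ReIm (val p)).

(* The differential df_p(v): the common value of (f o gamma)'(0) over the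
   curves gamma in SU(2) with gamma(0) = p and gamma'(0) = v.
   It is meaningful only for tangent v (and 0 if f has no differential). *)
Definition dif (R : realType) (f : SU2 R -> R) (p : SU2 R) (v : 'M[R[i]]_2) : R :=
  xget 0 [set l : R | forall gamma : R -> SU2 R,
    gamma 0 = p ->
    is_derive (0 : R) (1 : R) (fun t => ReIm (val (gamma t))) (ReIm v) ->
    is_derive (0 : R) (1 : R) (fun t => f (gamma t)) l].

Definition dif_mx (R : realType) (W : vfield R) (p : SU2 R) (v : 'M[R[i]]_2) :
    'M[R[i]]_2 :=
  \matrix_(i, j) (dif (fun q => Re (W q i j)) p v +i*
                  dif (fun q => Im (W q i j)) p v).

(* For vector fields on a submanifold of a vector space, [V, W] is the
   difference of the ambient directional derivatives. *)
Definition bracket (R : realType) (V W : vfield R) : vfield R :=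
  fun p => dif_mx W p (V p) - dif_mx V p (W p).

Definition scale3 (R : realType) (a b c : R) (k : 'I_3) : R :=
  nth 0 [:: a; b; c] k.

(* a X_1, b X_2, c X_3 *)
Definition orth_basis (R : realType) (a b c : R) (k : 'I_3) : 'M[R[i]]_2 :=
  (scale3 a b c k)%:C *: su2_basis R k.

(* The inner product on su(2) for which orth_basis a b c is orthonormal
   (su2_inner_orth_basis): the coordinates of X in that basis are
   su2_coord X k / scale3 a b c k. *)
Definition su2_inner (R : realType) (a b c : R) (X Y : 'M[R[i]]_2) : R :=
  \sum_(k < 3) (su2_coord X k / scale3 a b c k) *
               (su2_coord Y k / scale3 a b c k).

(* The left-invariant metric g_(a,b,c). *)
Definition metric (R : realType) (a b c : R) (p : SU2 R) (u v : 'M[R[i]]_2) : R :=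
  su2_inner a b c (invmx (val p) *m u) (invmx (val p) *m v).

Definition frame (R : realType) (a b c : R) (k : 'I_3) : vfield R :=
  fun p => val p *m orth_basis a b c k.

(* grad f is the field with g(grad f, v) = df(v) for all tangent v. *)
Definition grad (R : realType) (a b c : R) (f : SU2 R -> R) : vfield R :=
  fun p => xget 0 [set u | tangent p u /\
    forall v, tangent p v -> metric a b c p u v = dif f p v].

(* The Riemannian volume form, oriented by the orthonormal frame. *)
Definition vol (R : realType) (a b c : R) (p : SU2 R)
    (u : 'I_3 -> 'M[R[i]]_2) : R :=
  \det (\matrix_(i < 3, j < 3) metric a b c p (frame a b c i p) (u j)).

(* (L_V w)(A_1, A_2, A_3)
   = V(w(A_1, A_2, A_3)) - sum_k w(A_1, .., [V, A_k], .., A_3) *)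
Definition lie_derivative (R : realType)
    (w : SU2 R -> ('I_3 -> 'M[R[i]]_2) -> R) (V : vfield R)
    (A : 'I_3 -> vfield R) (p : SU2 R) : R :=
  dif (fun q => w q (fun k => A k q)) p (V p) -
  \sum_(k < 3) w p (fun l => if l == k then bracket V (A k) p else A l p).

(* div V is defined by L_V vol = (div V) vol; both sides are evaluated on the
   orthonormal frame, on which vol is 1 (vol_frame). *)
Definition div (R : realType) (a b c : R) (V : vfield R) (p : SU2 R) : R :=
  lie_derivative (vol a b c) V (frame a b c) p.

Definition laplace_beltrami (R : realType) (a b c : R) (f : SU2 R -> R)
    (p : SU2 R) : R :=
  - div a b c (grad a b c f) p.

Definition eigenspace (R : realType) (a b c mu : R) : set (SU2 R -> R) :=
  [set f | smooth f /\ forall p, laplace_beltrami a b c f p = mu * f p].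

Definition is_eigenvalue (R : realType) (a b c mu : R) : Prop :=
  exists2 f : SU2 R -> R, eigenspace a b c mu f & exists p, f p != 0.

(* The eigenspace is a real vector space with a basis of n elements. *)
Definition has_multiplicity (R : realType) (a b c mu : R) (n : nat) : Prop :=
  exists e : 'I_n -> SU2 R -> R,
    (forall x : 'I_n -> R,
       (forall p, \sum_(k < n) x k * e k p = 0) -> forall k, x k = 0) /\
    (forall f : SU2 R -> R, eigenspace a b c mu f <->
       exists x : 'I_n -> R, forall p, f p = \sum_(k < n) x k * e k p).

Definition is_lambda1 (R : realType) (a b c mu : R) : Prop :=
  [/\ is_eigenvalue a b c mu, mu != 0 &
      forall nu : R, is_eigenvalue a b c nu -> nu != 0 -> mu <= nu].

Lemma su2_basisP (R : realType) (k : 'I_3) : @su2 R (su2_basis R k).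
Proof.
split.
  apply/matrixP => i j.
  by case: k => [[|[|[|//]]] ?]; case: i => [[|[|//]] ?];
    case: j => [[|[|//]] ?]; rewrite /su2_basis !mxE /=; apply/eqP;
    rewrite eq_complex /= ?oppr0 ?opprK ?eqxx.
by case: k => [[|[|[|//]]] ?];
  rewrite /su2_basis /mxtrace !big_ord_recl big_ord0 !mxE /= ?addr0 ?subrr.
Qed.

Lemma su2_coordP (R : realType) (X : 'M[R[i]]_2) : su2 X ->
  X = \sum_(k < 3) (su2_coord X k)%:C *: su2_basis R k.
Proof.
case=> /matrixP XX trX.
have ordE0 (h : (0 < 2)%N) : Ordinal h = 0 by apply/val_inj.
have ordE1 (h : (1 < 2)%N) : Ordinal h = 1 by apply/val_inj.
have tr0 : X 0 0 + X 1 1 = 0.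
  by rewrite -trX /mxtrace !big_ord_recl big_ord0 addr0; congr (_ + X _ _);
     apply/val_inj.
have HH i j : (X j i)^*%R = - X i j by have := XX i j; rewrite !mxE.
move: (HH 0 0) (HH 0 1) => X00 X01.
apply/matrixP => i j.
rewrite !big_ord_recl big_ord0 /su2_basis /su2_coord /mx22 /= !mxE /= addr0.
move: tr0 X01 X00.
case: i => [[|[|//]] ?]; case: j => [[|[|//]] ?] /=; rewrite ?ordE0 ?ordE1.
all: case: (X 0 0) (X 0 1) (X 1 0) (X 1 1) => [x00 y00] [x01 y01] [x10 y10] [x11 y11].
all: move=> /eqP E1 /eqP E2 /eqP E3; move: E1 E2 E3; rewrite !eq_complex /=.
all: move=> /andP[/eqP h1 /eqP h2] /andP[/eqP h3 /eqP h4] /andP[/eqP h5 /eqP h6];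
  apply/eqP; rewrite eq_complex /=.
all: by apply/andP; split; apply/eqP; lra.
Qed.

Lemma su2_coordZ (R : realType) (x : R) (X : 'M[R[i]]_2) k :
  su2_coord (x%:C *: X) k = x * su2_coord X k.
Proof.
case: k => [[|[|[|//]]] ?]; rewrite /su2_coord /= !mxE.
- by case: (X 0 0) => ? ? /=; ring.
- by case: (X 0 1) => ? ? /=; ring.
- by case: (X 0 1) => ? ? /=; ring.
Qed.

Lemma su2_inner_orth_basis (R : realType) (a b c : R) (i j : 'I_3) :
  0 < a -> 0 < b -> 0 < c ->
  su2_inner a b c (orth_basis a b c i) (orth_basis a b c j) = (i == j)%:R.
Proof.
move=> /lt0r_neq0 a0 /lt0r_neq0 b0 /lt0r_neq0 c0.
rewrite /su2_inner !big_ord_recl big_ord0 /orth_basis !su2_coordZ.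
rewrite /su2_coord /su2_basis /scale3 /=.
by case: i => [[|[|[|//]]] ?]; case: j => [[|[|[|//]]] ?];
  rewrite /= !mxE /=; (try rewrite [_ == _]/=); field; rewrite ?a0 ?b0 ?c0.
Qed.

Lemma vol_frame (R : realType) (a b c : R) (p : SU2 R) :
  0 < a -> 0 < b -> 0 < c -> vol a b c p (fun k => frame a b c k p) = 1.
Proof.
move=> a0 b0 c0; rewrite /vol -(det1 R 3); congr (\det _).
apply/matrixP => i j; rewrite !mxE /metric /frame.
have pU : val p \in unitmx.
  by apply: unitarymx_unit; case: p => p /= /andP[].
by rewrite !mulKmx ?su2_inner_orth_basis.
Qed.

(* Main.v *)
From HB Require Import structures.
Require Import Defs.
From mathcomp Require Import all_boot all_order all_algebra.
From mathcomp Require Import all_classical all_reals all_analysis zify ring lra.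
From mathcomp Require Import complex.

Set Implicit Arguments.
Unset Strict Implicit.
Unset Printing Implicit Defensive.

Import Order.TTheory GRing.Theory Num.Theory numFieldNormedType.Exports.
Import complex Defs.

Local Open Scope classical_set_scope.
Local Open Scope ring_scope.
Local Open Scope complex_scope.
Local Open Scope sesquilinear_scope.

(** The Laplacian of the left-invariant metric is
      L = - (a^2 X_1^2 + b^2 X_2^2 + c^2 X_3^2),
   where X_k is read as the derivation f |-> df_p(p X_k): the traces of the
   brackets of su(2) vanish, so the divergence adds no first order term
   (laplace_smooth).  The matrix coefficients of the (n + 1)-dimensional
   representation of SU(2) span an L-stable space of functions, and by the
   Peter-Weyl theorem L is determined by its action on these spaces: it is 0 for
   n = 0, the scalar a^2 + b^2 + c^2 for n = 1 and has the eigenvalues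
   4 (b^2 + c^2) <= 4 (a^2 + c^2) <= 4 (a^2 + b^2) for n = 2, while for n >= 3
   all its eigenvalues exceed 4 (b^2 + c^2).  The multiplicities 4 and 3 are the
   numbers of coordinate functions and of weight 0 functions for n = 2.

   The proof replaces decompositions into representations by the moments of an
   eigenfunction f, its inner products with the monomials of degree n in the
   entries of the matrix p.  Three ingredients carry it.

   Integration.  Only a positive linear functional is needed which kills every
   X_k h and is strictly positive on nonnegative continuous functions that are
   not 0.  It is obtained as a limit, along an ultrafilter, of Riemann sums in
   Euler angles (mean).  Each X_k, weighted by the Haar density, is a divergence
   in the Euler angles, and Riemann sums of derivatives tend to 0 (mean_D1,
   mean_D2, mean_D3); strict positivity comes from counting nodes (mean_gt0).
   Hence L is symmetric (mean_lap).

   Moments.  Let H, E, F be the usual basis of sl(2), with X_1 = 'i H,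
   X_2 = E - F and X_3 = 'i (E + F), so that
      L = a^2 H^2 - (b^2 - c^2) (E^2 + F^2) + (b^2 + c^2) (E F + F E).
   Monomials are weight vectors of H and E and F map them to combinations of
   monomials, so symmetry turns L f = mu f into a linear recursion for the moments
   (mom_rec).  As det p = 1, moments of degree n whose monomials have the same
   degree in each row and the same weight agree once those of degree n - 2
   vanish (mom_det).  In the resulting system the diagonal coefficient minus the
   sum of the absolute values of the others is at least
   2 n b^2 + n^2 c^2, which is where a >= b >= c is used.  Looking at a moment
   of largest absolute value, all moments of degree n vanish when mu is smaller
   than that number (gershgorin_step), in particular when n >= 3 and
   mu <= 4 (b^2 + c^2).

   Density.  If all moments of f vanish then f is orthogonal to the powers of
   (1 + <p0, p>) / 2, which concentrate at p0, so f = 0 (peak_orthogonal).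

   Thus an eigenfunction for 0 <> mu <= 4 (b^2 + c^2) vanishes as soon as its
   moments of degree 1 and those of degree 2 and weight 0 do
   (eigenfunction_vanish).  The first ones vanish automatically unless mu is
   a^2 + b^2 + c^2, the second ones unless mu is 4 (b^2 + c^2), and they are
   inner products with explicit eigenfunctions; inverting a Gram matrix shows
   that these form a basis of the eigenspace (basis_multiplicity). *)

(** * SU(2) as the unit quaternions *)

(** The quaternion x0 + x1 X_1 + x2 X_2 + x3 X_3, as X_1, X_2, X_3 multiply like
   the units i, j, k; the unit quaternions are the elements of SU(2). *)
Definition quat (R : realType) (x0 x1 x2 x3 : R) : 'M[R[i]]_2 :=
  mx22 (x0 +i* x1) (x2 +i* x3) (- x2 +i* x3) (x0 -i* x1).

Definition qr (R : realType) (p : SU2 R) : R := Re (val p 0 0).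
Definition qi (R : realType) (p : SU2 R) : R := Im (val p 0 0).
Definition qj (R : realType) (p : SU2 R) : R := Re (val p 0 1).
Definition qk (R : realType) (p : SU2 R) : R := Im (val p 0 1).

Lemma mx22P (T : nzRingType) (A B : 'M[T]_2) :
  A 0 0 = B 0 0 -> A 0 1 = B 0 1 -> A 1 0 = B 1 0 -> A 1 1 = B 1 1 -> A = B.
Proof.
move=> h00 h01 h10 h11; apply/matrixP => i j.
have ordE0 (h : (0 < 2)%N) : Ordinal h = 0 by apply/val_inj.
have ordE1 (h : (1 < 2)%N) : Ordinal h = 1 by apply/val_inj.
by case: i => [[|[|//]] ?]; case: j => [[|[|//]] ?]; rewrite ?ordE0 ?ordE1.
Qed.

Lemma mulmx22 (T : nzRingType) (A B : 'M[T]_2) i j :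
  (A *m B) i j = A i 0 * B 0 j + A i 1 * B 1 j.
Proof.
rewrite mxE !big_ord_recl big_ord0 addr0; congr (_ * _ + _ * _);
  by congr (_ _ _); apply/val_inj.
Qed.

Lemma det22 (T : comNzRingType) (A : 'M[T]_2) :
  \det A = A 0 0 * A 1 1 - A 0 1 * A 1 0.
Proof.
rewrite (expand_det_row _ 0) !big_ord_recl big_ord0 addr0 /cofactor !det_mx11.
rewrite !mxE /= !expr0 mul1r expr1 mulN1r mulrN.
by congr (_ * A _ _ - A _ _ * A _ _); apply/val_inj.
Qed.

Lemma quat_SU2 (R : realType) (x0 x1 x2 x3 : R) :
  x0 ^+ 2 + x1 ^+ 2 + x2 ^+ 2 + x3 ^+ 2 = 1 ->
  (quat x0 x1 x2 x3 \is unitarymx) && (\det (quat x0 x1 x2 x3) == 1).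
Proof.
move=> h; apply/andP; split.
  apply/unitarymxP; apply: mx22P; rewrite mulmx22 !mxE /=;
  apply/eqP; rewrite eq_complex /=; apply/andP; split; apply/eqP;
  by rewrite ?eqxx /=; nra.
rewrite det22 !mxE /= eq_complex /=; apply/andP; split; apply/eqP; nra.
Qed.

Definition mkq (R : realType) (x0 x1 x2 x3 : R)
  (h : x0 ^+ 2 + x1 ^+ 2 + x2 ^+ 2 + x3 ^+ 2 = 1) : SU2 R :=
  exist _ (quat x0 x1 x2 x3) (quat_SU2 h).

(** By unitarity, the conjugate transpose of p is its inverse, which is its
   adjugate since det p = 1; so the second row is determined by the first. *)
Lemma val_quat (R : realType) (p : SU2 R) :
  val p = quat (qr p) (qi p) (qj p) (qk p).
Proof.
case: p => A /= hA; rewrite /qr /qi /qj /qk /=.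
have /andP[/unitarymxP U /eqP] := hA; rewrite det22 => D.
set B := mx22 (A 1 1) (- A 0 1) (- A 1 0) (A 0 0).
have BA : B *m A = 1%:M.
  by apply: mx22P; rewrite mulmx22 !mxE /= ?mulr1n ?mulr0n -?D; ring.
have : B = A^t* by rewrite -[LHS]mulmx1 -U mulmxA BA mul1mx.
move=> /matrixP E; move: (E 0 0) (E 0 1) (E 1 0) (E 1 1); rewrite !mxE /=.
move=> e1 _ e2 _; apply: mx22P; rewrite !mxE /=; first by case: (A 0 0).
- by case: (A 0 1).
- by rewrite -[A 1 0]opprK e2; case: (A 0 1) => ? ? /=; congr (_ +i* _); ring.
- by rewrite e1; case: (A 0 0).
Qed.

Lemma sphere (R : realType) (p : SU2 R) :
  qr p ^+ 2 + qi p ^+ 2 + qj p ^+ 2 + qk p ^+ 2 = 1.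
Proof.
have /andP[_] := valP p; rewrite val_quat det22 !mxE /= => /eqP[h _].
by rewrite -h; ring.
Qed.

Lemma SU2_eq (R : realType) (p q : SU2 R) :
  qr p = qr q -> qi p = qi q -> qj p = qj q -> qk p = qk q -> p = q.
Proof.
by move=> h0 h1 h2 h3; apply/val_inj; rewrite !val_quat h0 h1 h2 h3.
Qed.

Lemma quatM (R : realType) (x0 x1 x2 x3 y0 y1 y2 y3 : R) :
  quat x0 x1 x2 x3 *m quat y0 y1 y2 y3 =
  quat (x0 * y0 - x1 * y1 - x2 * y2 - x3 * y3)
       (x0 * y1 + x1 * y0 + x2 * y3 - x3 * y2)
       (x0 * y2 + x2 * y0 + x3 * y1 - x1 * y3)
       (x0 * y3 + x3 * y0 + x1 * y2 - x2 * y1).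
Proof.
by apply: mx22P; rewrite mulmx22 !mxE /=; apply/eqP; rewrite eq_complex /=;
  apply/andP; split; apply/eqP; ring.
Qed.

Lemma quatD (R : realType) (x0 x1 x2 x3 y0 y1 y2 y3 : R) :
  quat x0 x1 x2 x3 + quat y0 y1 y2 y3 =
  quat (x0 + y0) (x1 + y1) (x2 + y2) (x3 + y3).
Proof.
by apply: mx22P; rewrite !mxE /=; apply/eqP; rewrite eq_complex /=;
  apply/andP; split; apply/eqP; ring.
Qed.

Lemma quatZ (R : realType) (t x0 x1 x2 x3 : R) :
  t%:C *: quat x0 x1 x2 x3 = quat (t * x0) (t * x1) (t * x2) (t * x3).
Proof.
by apply: mx22P; rewrite !mxE /=; apply/eqP; rewrite eq_complex /=;
  apply/andP; split; apply/eqP; ring.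
Qed.

Lemma quatN (R : realType) (x0 x1 x2 x3 : R) :
  - quat x0 x1 x2 x3 = quat (- x0) (- x1) (- x2) (- x3).
Proof. by apply: mx22P; rewrite !mxE. Qed.

Lemma su2_basis_quat (R : realType) (k : 'I_3) :
  su2_basis R k = quat 0 (k == 0)%:R (k == 1)%:R (k == 2%:R)%:R.
Proof.
case: k => [[|[|[|//]]] ?]; apply: mx22P; rewrite !mxE /=;
  apply/eqP; rewrite eq_complex /=; apply/andP; split; apply/eqP;
  by rewrite ?oppr0.
Qed.

Lemma su2_quat (R : realType) (X : 'M[R[i]]_2) : su2 X ->
  X = quat 0 (su2_coord X 0) (su2_coord X 1) (su2_coord X 2%:R).
Proof.
move=> /su2_coordP {1}->; rewrite !big_ord_recl big_ord0 addr0.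
rewrite !su2_basis_quat !quatZ !quatD /=.
by congr quat; rewrite ?mulr0 ?mulr1 ?addr0 ?add0r //; congr su2_coord; apply/val_inj.
Qed.

(** The tangent vector p (t1 X_1 + t2 X_2 + t3 X_3) in quaternion coordinates. *)
Definition mulX (R : realType) (t1 t2 t3 : R) (p : SU2 R) :=
  quat (- qi p * t1 - qj p * t2 - qk p * t3)
       (qr p * t1 + qj p * t3 - qk p * t2)
       (qr p * t2 + qk p * t1 - qi p * t3)
       (qr p * t3 + qi p * t2 - qj p * t1).

Lemma mulXE (R : realType) (t1 t2 t3 : R) (p : SU2 R) :
  val p *m quat 0 t1 t2 t3 = mulX t1 t2 t3 p.
Proof. by rewrite val_quat quatM; congr quat; ring. Qed.
(** * Functions of class C^k *)

Section CkTheory.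
Variables (R : realType) (V : normedModType R).
Implicit Types F G : V -> R.

Lemma CkW k F : Ck k.+1 F -> Ck k F.
Proof.
elim: k F => [|k IH] F /=.
  by move=> [dF _] x; exact: differentiable_continuous.
by move=> [dF DF]; split=> // v; apply: IH; apply: DF.
Qed.

Lemma Ck_differentiable k F : Ck k.+1 F -> forall x, differentiable F x.
Proof. by case. Qed.

Lemma Ck_cst k (r : R) : Ck k (cst r : V -> R).
Proof.
elim: k r => [|k IH] r /=; first exact: cst_continuous.
split=> [x|v]; first exact: differentiable_cst.
rewrite (_ : (fun x => _) = cst 0); first exact: IH.
by apply/funext => x; rewrite derive_cst.
Qed.

Lemma CkD k F G : Ck k F -> Ck k G -> Ck k (fun x => F x + G x).
Proof.
elim: k F G => [|k IH] F G /=.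
  by move=> cF cG x; apply: (@continuousD _ _ _ F G x); [exact: cF|exact: cG].
move=> [dF DF] [dG DG]; split=> [x|v]; first exact: differentiableD.
rewrite (_ : (fun x => _) = (fun x => 'D_v F x + 'D_v G x)); first exact: IH.
by apply/funext => x; rewrite deriveD //; exact: diff_derivable.
Qed.

Lemma CkM k F G : Ck k F -> Ck k G -> Ck k (fun x => F x * G x).
Proof.
elim: k F G => [|k IH] F G.
  by move=> cF cG x; apply: (@continuousM _ _ F G x); [exact: cF|exact: cG].
move=> cF cG; have [dF DF] := cF; have [dG DG] := cG.
split=> [x|v]; first exact: differentiableM.
rewrite (_ : (fun x => _) = (fun x => F x * 'D_v G x + G x * 'D_v F x)).
  by apply: CkD; apply: IH; do ?[exact: CkW | exact: DF | exact: DG].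
by apply/funext => x; rewrite deriveM //; exact: diff_derivable.
Qed.

Lemma Ck_linear k F : linear F -> continuous F -> Ck k F.
Proof.
move=> lF cF; pose L : {linear V -> R} := HB.pack F (GRing.isLinear.Build _ _ _ _ _ lF).
case: k => [//|k]; split=> [x|v]; first exact: (@linear_differentiable _ _ _ L).
rewrite (_ : (fun x => _) = cst (F v)); first exact: Ck_cst.
apply/funext => x; rewrite deriveE; last exact: (@linear_differentiable _ _ _ L).
by rewrite (@diff_lin _ _ _ L).
Qed.

End CkTheory.

Lemma is_derive_scalel (R : realType) (V : normedModType R) (k : R -> R) (d t : R)
    (v : V) :
  is_derive t (1 : R) k d -> is_derive t (1 : R) (fun s => k s *: v) (d *: v).
Proof.
move=> [/derivable1_diffP dk <-].
have dd := differentiableZl v dk.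
apply: DeriveDef; first exact: diff_derivable.
by rewrite deriveE // diffZl // deriveE.
Qed.

Lemma is_derive_comp_diff (R : realType) (V : normedModType R) (c : R -> V) (w : V)
    (F : V -> R) (t : R) :
  is_derive t (1 : R) c w -> differentiable F (c t) ->
  is_derive t (1 : R) (fun s => F (c s)) ('d F (c t) w).
Proof.
move=> [/derivable1_diffP dc <-] dF.
have dd := differentiable_comp dc dF.
apply: DeriveDef; first exact: diff_derivable.
by rewrite deriveE // diff_comp // deriveE.
Qed.

(** * Smooth functions on SU(2) and their differentials *)

Definition MM (R : realType) := ('M[R]_2 * 'M[R]_2)%type.

Lemma ReIm_quat (R : realType) (x0 x1 x2 x3 : R) :
  ReIm (quat x0 x1 x2 x3) =
  x0 *: ReIm (quat 1 0 0 0) + x1 *: ReIm (quat 0 1 0 0) +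
  (x2 *: ReIm (quat 0 0 1 0) + x3 *: ReIm (quat 0 0 0 1)).
Proof.
by apply: injective_projections; apply: mx22P; rewrite /= !mxE /=; ring.
Qed.

Lemma is_derive_quat (R : realType) (c0 c1 c2 c3 : R -> R) (d0 d1 d2 d3 t : R) :
  is_derive t (1 : R) c0 d0 -> is_derive t (1 : R) c1 d1 ->
  is_derive t (1 : R) c2 d2 -> is_derive t (1 : R) c3 d3 ->
  is_derive t (1 : R) (fun s => ReIm (quat (c0 s) (c1 s) (c2 s) (c3 s)))
    (ReIm (quat d0 d1 d2 d3)).
Proof.
move=> h0 h1 h2 h3; rewrite ReIm_quat.
rewrite (_ : (fun s => _) =
  ((fun s => c0 s *: ReIm (quat 1 0 0 0)) + (fun s => c1 s *: ReIm (quat 0 1 0 0)) +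
  ((fun s => c2 s *: ReIm (quat 0 0 1 0)) + (fun s => c3 s *: ReIm (quat 0 0 0 1))))).
  exact: is_deriveD (is_deriveD (is_derive_scalel _ h0) (is_derive_scalel _ h1))
    (is_deriveD (is_derive_scalel _ h2) (is_derive_scalel _ h3)).
by apply/funext => s; rewrite ReIm_quat.
Qed.

Lemma is_derive_ext (R : realType) (V : normedModType R) (f g : R -> V) (t : R) (l l' : V) :
  is_derive t (1 : R) f l -> (forall s, f s = g s) -> l = l' ->
  is_derive t (1 : R) g l'.
Proof. by move=> h /funext <- <-. Qed.

Lemma is_derive_sin_lin (R : realType) (r u t : R) :
  is_derive t (1 : R) (fun s => sin (r * s + u)) (r * cos (r * t + u)).
Proof.
apply: (@is_derive_eq _ _ _ (sin \o (fun s => r * s + u))); rewrite mulrC; congr (_ * _).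
by rewrite [_%:A]mulr1 addr0.
Qed.

Lemma is_derive_cos_lin (R : realType) (r u t : R) :
  is_derive t (1 : R) (fun s => cos (r * s + u)) (- (r * sin (r * t + u))).
Proof.
apply: (@is_derive_eq _ _ _ (cos \o (fun s => r * s + u))).
by rewrite [_%:A]mulr1 addr0; ring.
Qed.

Lemma norm_quatM (R : realType) (x0 x1 x2 x3 y0 y1 y2 y3 : R) :
  x0 ^+ 2 + x1 ^+ 2 + x2 ^+ 2 + x3 ^+ 2 = 1 ->
  y0 ^+ 2 + y1 ^+ 2 + y2 ^+ 2 + y3 ^+ 2 = 1 ->
  (x0 * y0 - x1 * y1 - x2 * y2 - x3 * y3) ^+ 2 +
  (x0 * y1 + x1 * y0 + x2 * y3 - x3 * y2) ^+ 2 +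
  (x0 * y2 + x2 * y0 + x3 * y1 - x1 * y3) ^+ 2 +
  (x0 * y3 + x3 * y0 + x1 * y2 - x2 * y1) ^+ 2 = 1.
Proof.
move=> hx hy; transitivity ((x0 ^+ 2 + x1 ^+ 2 + x2 ^+ 2 + x3 ^+ 2) *
  (y0 ^+ 2 + y1 ^+ 2 + y2 ^+ 2 + y3 ^+ 2)); first by ring.
by rewrite hx hy mulr1.
Qed.

(** The curve is s |-> p exp(s X): as X^2 = - r^2 for X = t1 X_1 + t2 X_2 + t3 X_3,
   the exponential is cos (r s) + (sin (r s) / r) X.  When r = 0 the convention
   t / 0 = 0 makes the same formula the constant curve. *)
Lemma curve_exists (R : realType) (t1 t2 t3 : R) (p : SU2 R) :
  exists2 g : R -> SU2 R, g 0 = p &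
    is_derive (0 : R) (1 : R) (fun s => ReIm (val (g s))) (ReIm (mulX t1 t2 t3 p)).
Proof.
pose r := Num.sqrt (t1 ^+ 2 + t2 ^+ 2 + t3 ^+ 2).
have r2 : r ^+ 2 = t1 ^+ 2 + t2 ^+ 2 + t3 ^+ 2.
  by rewrite sqr_sqrtr // !addr_ge0 ?sqr_ge0.
have t0 : r = 0 -> [/\ t1 = 0, t2 = 0 & t3 = 0].
  by move=> r0; move: r2; rewrite r0 => h; split; nra.
pose c (s : R) := cos (r * s + 0).
pose d (t s : R) := t / r * sin (r * s + 0).
have dc : is_derive (0 : R) (1 : R) c 0.
  have := is_derive_cos_lin r 0 0.
  by rewrite mulr0 addr0 sin0 mulr0 oppr0.
have dd t : (r = 0 -> t = 0) -> is_derive (0 : R) (1 : R) (d t) t.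
  move=> rt; have ds := is_derive_sin_lin r 0 0.
  apply: (@is_derive_eq _ _ _ ((t / r) *: (fun s => sin (r * s + 0)))).
  rewrite mulr0 addr0 cos0 mulr1; case: (eqVneq r 0) => [r0|r0].
    by rewrite (rt r0) mul0r scale0r.
  by rewrite /GRing.scale /=; field.
have n1 s : c s ^+ 2 + d t1 s ^+ 2 + d t2 s ^+ 2 + d t3 s ^+ 2 = 1.
  transitivity (cos (r * s + 0) ^+ 2 +
    (t1 ^+ 2 + t2 ^+ 2 + t3 ^+ 2) * r^-1 ^+ 2 * sin (r * s + 0) ^+ 2).
    by rewrite /c /d; ring.
  rewrite -[RHS](cos2Dsin2 (r * s + 0)) -r2; congr (_ + _).
  case: (eqVneq r 0) => [->|r0]; last by field.
  by rewrite mul0r add0r sin0 expr0n /= mulr0.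
exists (fun s => mkq (norm_quatM (sphere p) (n1 s))).
  apply: SU2_eq; rewrite /qr /qi /qj /qk /= !mxE /=;
  by rewrite /c /d mulr0 addr0 cos0 sin0 !mulr0 mulr1 ?addr0 ?subr0 ?oppr0 ?add0r.
have d1 : is_derive (0 : R) (1 : R) (d t1) t1 by apply: dd => /t0[].
have d2 : is_derive (0 : R) (1 : R) (d t2) t2 by apply: dd => /t0[].
have d3 : is_derive (0 : R) (1 : R) (d t3) t3 by apply: dd => /t0[].
have E k0 k1 k2 k3 (f : R -> R) l :
   (forall s, f s = k0 * c s + k1 * d t1 s + k2 * d t2 s + k3 * d t3 s) ->
   l = k1 * t1 + k2 * t2 + k3 * t3 -> is_derive (0 : R) (1 : R) f l.
  move=> ff ->; apply: is_derive_ext (is_deriveD (is_deriveD (is_deriveD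
    (is_deriveZ k0 dc) (is_deriveZ k1 d1)) (is_deriveZ k2 d2)) (is_deriveZ k3 d3)) _ _.
    by move=> s; rewrite ff.
  by rewrite scaler0 add0r.
apply: is_derive_quat.
- by apply: (E (qr p) (- qi p) (- qj p) (- qk p)) => [s|]; ring.
- by apply: (E (qi p) (qr p) (- qk p) (qj p)) => [s|]; ring.
- by apply: (E (qj p) (qk p) (qr p) (- qi p)) => [s|]; ring.
- by apply: (E (qk p) (- qj p) (qi p) (qr p)) => [s|]; ring.
Qed.

Lemma dif_unique (R : realType) (f : SU2 R -> R) (t1 t2 t3 l : R) (p : SU2 R) :
  (forall g : R -> SU2 R, g 0 = p ->
    is_derive (0 : R) (1 : R) (fun t => ReIm (val (g t))) (ReIm (mulX t1 t2 t3 p)) ->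
    is_derive (0 : R) (1 : R) (fun t => f (g t)) l) ->
  dif f p (mulX t1 t2 t3 p) = l.
Proof.
move=> hl; apply: xget_unique => // y hy.
have [g g0 dg] := curve_exists t1 t2 t3 p.
by have [_ <-] := hl g g0 dg; have [_ <-] := hy g g0 dg.
Qed.

(** The differential, defined through all curves, is computed by the differential
   of any smooth extension to the ambient space. *)
Lemma dif_extension (R : realType) (f : SU2 R -> R) (F : MM R -> R) (t1 t2 t3 : R)
    (p : SU2 R) :
  (forall q, f q = F (ReIm (val q))) -> differentiable F (ReIm (val p)) ->
  dif f p (mulX t1 t2 t3 p) = 'd F (ReIm (val p)) (ReIm (mulX t1 t2 t3 p)).
Proof.
move=> fF dF; apply: dif_unique => g g0 dg; rewrite (funext (fun t => fF (g t))).
have dF' : differentiable F (ReIm (val (g 0))) by rewrite g0.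
by have := is_derive_comp_diff dg dF'; rewrite g0.
Qed.

Lemma smooth_ext (R : realType) (f g : SU2 R -> R) :
  (forall p, f p = g p) -> smooth g -> smooth f.
Proof. by move=> fg [F cF gF]; exists F => // p; rewrite fg. Qed.

Lemma smooth_cst (R : realType) (r : R) : smooth (fun _ : SU2 R => r).
Proof. by exists (cst r) => // k; exact: Ck_cst. Qed.

Lemma smoothD (R : realType) (f g : SU2 R -> R) :
  smooth f -> smooth g -> smooth (fun p => f p + g p).
Proof.
move=> [F cF fF] [G cG gG]; exists (fun x => F x + G x) => [k|p].
  exact: CkD.
by rewrite fF gG.
Qed.

Lemma smoothM (R : realType) (f g : SU2 R -> R) :
  smooth f -> smooth g -> smooth (fun p => f p * g p).
Proof.
move=> [F cF fF] [G cG gG]; exists (fun x => F x * G x) => [k|p].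
  exact: CkM.
by rewrite fF gG.
Qed.

Lemma smoothZ (R : realType) (r : R) (f : SU2 R -> R) :
  smooth f -> smooth (fun p => r * f p).
Proof. by move=> sf; apply: smoothM => //; exact: smooth_cst. Qed.

Lemma smoothN (R : realType) (f : SU2 R -> R) :
  smooth f -> smooth (fun p => - f p).
Proof.
by move=> sf; apply: smooth_ext (smoothZ (-1) sf) => p; rewrite mulN1r.
Qed.

Lemma smoothB (R : realType) (f g : SU2 R -> R) :
  smooth f -> smooth g -> smooth (fun p => f p - g p).
Proof. by move=> sf sg; apply: smoothD => //; exact: smoothN. Qed.

Lemma smooth_sum (R : realType) n (f : 'I_n -> SU2 R -> R) :
  (forall i, smooth (f i)) -> smooth (fun p => \sum_(i < n) f i p).
Proof.
elim: n f => [|n IH] f sf.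
  by apply: smooth_ext (smooth_cst 0) => p; rewrite big_ord0.
apply: smooth_ext (smoothD (IH _ (fun i => sf (widen_ord (leqnSn n) i))) (sf ord_max)).
by move=> p; rewrite big_ord_recr.
Qed.

Lemma smoothX (R : realType) n (f : SU2 R -> R) :
  smooth f -> smooth (fun p => f p ^+ n).
Proof.
move=> sf; elim: n => [|n IH]; first exact: smooth_cst.
by apply: smooth_ext (smoothM sf IH) => p; rewrite exprS.
Qed.

Lemma smooth_Re (R : realType) i j : smooth (fun p : SU2 R => Re (val p i j)).
Proof.
exists (fun x : MM R => x.1 i j) => [k|p]; last by rewrite /ReIm /= mxE.
apply: Ck_linear => [r x y|x]; first by rewrite !mxE.
apply: (@continuous_comp _ _ _ (@fst _ _) (fun A : 'M[R]_2 => A i j)).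
  exact: cvg_fst.
exact: coord_continuous.
Qed.

Lemma smooth_Im (R : realType) i j : smooth (fun p : SU2 R => Im (val p i j)).
Proof.
exists (fun x : MM R => x.2 i j) => [k|p]; last by rewrite /ReIm /= mxE.
apply: Ck_linear => [r x y|x]; first by rewrite !mxE.
apply: (@continuous_comp _ _ _ (@snd _ _) (fun A : 'M[R]_2 => A i j)).
  exact: cvg_snd.
exact: coord_continuous.
Qed.

Lemma smooth_qr (R : realType) : smooth (@qr R). Proof. exact: smooth_Re. Qed.
Lemma smooth_qi (R : realType) : smooth (@qi R). Proof. exact: smooth_Im. Qed.
Lemma smooth_qj (R : realType) : smooth (@qj R). Proof. exact: smooth_Re. Qed.
Lemma smooth_qk (R : realType) : smooth (@qk R). Proof. exact: smooth_Im. Qed.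

(** The derivatives along the left-invariant fields p |-> p X_k. *)
Definition D1 (R : realType) (f : SU2 R -> R) (p : SU2 R) : R := dif f p (mulX 1 0 0 p).
Definition D2 (R : realType) (f : SU2 R -> R) (p : SU2 R) : R := dif f p (mulX 0 1 0 p).
Definition D3 (R : realType) (f : SU2 R -> R) (p : SU2 R) : R := dif f p (mulX 0 0 1 p).

Lemma mulX_lin (R : realType) (t1 t2 t3 : R) (p : SU2 R) :
  ReIm (mulX t1 t2 t3 p) = t1 *: ReIm (mulX 1 0 0 p) + t2 *: ReIm (mulX 0 1 0 p) +
    t3 *: ReIm (mulX 0 0 1 p).
Proof.
by apply: injective_projections; apply: mx22P; rewrite /= !mxE /=; ring.
Qed.

Lemma dif_lin (R : realType) (f : SU2 R -> R) (t1 t2 t3 : R) (p : SU2 R) :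
  smooth f -> dif f p (mulX t1 t2 t3 p) = t1 * D1 f p + t2 * D2 f p + t3 * D3 f p.
Proof.
move=> [F cF fF]; have dF := Ck_differentiable (cF 1%N).
by rewrite /D1 /D2 /D3 !(dif_extension _ _ _ fF) // mulX_lin !linearD !linearZ.
Qed.

Lemma is_derive_curve (R : realType) (f : SU2 R -> R) (g : R -> SU2 R)
    (t1 t2 t3 s : R) : smooth f ->
  is_derive s (1 : R) (fun u => ReIm (val (g u))) (ReIm (mulX t1 t2 t3 (g s))) ->
  is_derive s (1 : R) (fun u => f (g u))
    (t1 * D1 f (g s) + t2 * D2 f (g s) + t3 * D3 f (g s)).
Proof.
move=> sf dg; rewrite -dif_lin //; case: sf => F cF fF.
have dF := Ck_differentiable (cF 1%N).
rewrite (dif_extension _ _ _ fF) // (funext (fun t => fF (g t))).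
exact: is_derive_comp_diff.
Qed.

(** In coordinates the derivative is a sum of partial derivatives of an extension,
   multiplied by functions that are linear in p. *)
Lemma smooth_dif (R : realType) (f : SU2 R -> R) (t1 t2 t3 : R) :
  smooth f -> smooth (fun p => dif f p (mulX t1 t2 t3 p)).
Proof.
move=> [F cF fF]; have dF := Ck_differentiable (cF 1%N).
pose e i : MM R := ReIm (quat (i == 0%N)%:R (i == 1%N)%:R (i == 2%N)%:R (i == 3%N)%:R).
pose G i (p : SU2 R) := 'D_(e i) F (ReIm (val p)).
have sG i : smooth (G i).
  by exists (fun x => 'D_(e i) F x) => // k; have [_] := cF k.+1; apply.
have sqr_ := @smooth_qr R; have sqi_ := @smooth_qi R.
have sqj_ := @smooth_qj R; have sqk_ := @smooth_qk R.
pose H (p : SU2 R) :=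
  ((- qi p * t1 - qj p * t2 - qk p * t3) * G 0%N p +
   (qr p * t1 + qj p * t3 - qk p * t2) * G 1%N p) +
  ((qr p * t2 + qk p * t1 - qi p * t3) * G 2%N p +
   (qr p * t3 + qi p * t2 - qj p * t1) * G 3%N p).
apply: (@smooth_ext _ _ H) => [p|].
  rewrite (dif_extension _ _ _ fF) //.
  have L x0 x1 x2 x3 : 'd F (ReIm (val p)) (ReIm (quat x0 x1 x2 x3)) =
      x0 * G 0%N p + x1 * G 1%N p + (x2 * G 2%N p + x3 * G 3%N p).
    by rewrite ReIm_quat !linearD !linearZ /G /e !deriveE.
  exact: L.
by rewrite /H; do ?[exact: smooth_cst | apply: smoothD | apply: smoothM | apply: smoothN].
Qed.

Lemma smooth_D1 (R : realType) (f : SU2 R -> R) : smooth f -> smooth (D1 f).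
Proof. exact: smooth_dif. Qed.
Lemma smooth_D2 (R : realType) (f : SU2 R -> R) : smooth f -> smooth (D2 f).
Proof. exact: smooth_dif. Qed.
Lemma smooth_D3 (R : realType) (f : SU2 R -> R) : smooth f -> smooth (D3 f).
Proof. exact: smooth_dif. Qed.

Lemma dif_cst (R : realType) (r t1 t2 t3 : R) (p : SU2 R) :
  dif (fun _ => r) p (mulX t1 t2 t3 p) = 0.
Proof. by apply: dif_unique => g _ _; exact: is_derive_cst. Qed.

Lemma difD (R : realType) (f g : SU2 R -> R) (t1 t2 t3 : R) (p : SU2 R) :
  smooth f -> smooth g ->
  dif (fun q => f q + g q) p (mulX t1 t2 t3 p) =
  dif f p (mulX t1 t2 t3 p) + dif g p (mulX t1 t2 t3 p).
Proof.
move=> sf sg; apply: dif_unique => c c0 dc; rewrite -c0 in dc *.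
by apply: is_deriveD; rewrite dif_lin //; exact: is_derive_curve.
Qed.

Lemma difM (R : realType) (f g : SU2 R -> R) (t1 t2 t3 : R) (p : SU2 R) :
  smooth f -> smooth g ->
  dif (fun q => f q * g q) p (mulX t1 t2 t3 p) =
  f p * dif g p (mulX t1 t2 t3 p) + g p * dif f p (mulX t1 t2 t3 p).
Proof.
move=> sf sg; apply: dif_unique => c c0 dc; rewrite -c0 in dc *.
by apply: is_deriveM; rewrite dif_lin //; exact: is_derive_curve.
Qed.
Lemma dif_Re (R : realType) i j (t1 t2 t3 : R) (p : SU2 R) :
  dif (fun q => Re (val q i j)) p (mulX t1 t2 t3 p) = Re (mulX t1 t2 t3 p i j).
Proof.
pose F (x : MM R) : R := x.1 i j.
have cF : continuous F.
  move=> x; apply: (@continuous_comp _ _ _ (@fst _ _) (fun A : 'M[R]_2 => A i j)).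
    exact: cvg_fst.
  exact: coord_continuous.
have lF : linear F by move=> r x y; rewrite /F !mxE.
pose L : {linear MM R -> R} := HB.pack F (GRing.isLinear.Build _ _ _ _ _ lF).
rewrite (@dif_extension _ _ F); last 2 first.
- by move=> q; rewrite /F /ReIm /= mxE.
- exact: (@linear_differentiable _ _ _ L).
by rewrite (@diff_lin _ _ _ L) //= /F /ReIm /= mxE.
Qed.

Lemma dif_Im (R : realType) i j (t1 t2 t3 : R) (p : SU2 R) :
  dif (fun q => Im (val q i j)) p (mulX t1 t2 t3 p) = Im (mulX t1 t2 t3 p i j).
Proof.
pose F (x : MM R) : R := x.2 i j.
have cF : continuous F.
  move=> x; apply: (@continuous_comp _ _ _ (@snd _ _) (fun A : 'M[R]_2 => A i j)).
    exact: cvg_snd.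
  exact: coord_continuous.
have lF : linear F by move=> r x y; rewrite /F !mxE.
pose L : {linear MM R -> R} := HB.pack F (GRing.isLinear.Build _ _ _ _ _ lF).
rewrite (@dif_extension _ _ F); last 2 first.
- by move=> q; rewrite /F /ReIm /= mxE.
- exact: (@linear_differentiable _ _ _ L).
by rewrite (@diff_lin _ _ _ L) //= /F /ReIm /= mxE.
Qed.

Section DifCoord.
Variables (R : realType) (t1 t2 t3 : R) (p : SU2 R).
Let v := mulX t1 t2 t3 p.

Lemma dif_qr : dif (@qr R) p v = - qi p * t1 - qj p * t2 - qk p * t3.
Proof. by rewrite [LHS]dif_Re !mxE. Qed.
Lemma dif_qi : dif (@qi R) p v = qr p * t1 + qj p * t3 - qk p * t2.
Proof. by rewrite [LHS]dif_Im !mxE. Qed.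
Lemma dif_qj : dif (@qj R) p v = qr p * t2 + qk p * t1 - qi p * t3.
Proof. by rewrite [LHS]dif_Re !mxE. Qed.
Lemma dif_qk : dif (@qk R) p v = qr p * t3 + qi p * t2 - qj p * t1.
Proof. by rewrite [LHS]dif_Im !mxE. Qed.

Lemma difN (f : SU2 R -> R) : smooth f -> dif (fun q => - f q) p v = - dif f p v.
Proof.
move=> sf; rewrite (_ : (fun q => _) = (fun q => -1 * f q)); last first.
  by apply/funext => q; rewrite mulN1r.
by rewrite difM ?dif_cst //; [ring|exact: smooth_cst].
Qed.

Lemma difB (f g : SU2 R -> R) : smooth f -> smooth g ->
  dif (fun q => f q - g q) p v = dif f p v - dif g p v.
Proof. by move=> sf sg; rewrite difD ?difN //; exact: smoothN. Qed.

End DifCoord.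

Ltac smooth_tac := do ?[assumption | exact: smooth_cst | exact: smooth_qr |
  exact: smooth_qi | exact: smooth_qj | exact: smooth_qk | apply: smooth_D1 |
  apply: smooth_D2 | apply: smooth_D3 | apply: smoothB | apply: smoothN |
  apply: smoothD | apply: smoothX | apply: smoothM ].

Lemma dif_mx_quat (R : realType) (W0 W1 W2 W3 : SU2 R -> R) (t1 t2 t3 : R) (p : SU2 R) :
  smooth W0 -> smooth W1 -> smooth W2 -> smooth W3 ->
  dif_mx (fun q => quat (W0 q) (W1 q) (W2 q) (W3 q)) p (mulX t1 t2 t3 p) =
  quat (dif W0 p (mulX t1 t2 t3 p)) (dif W1 p (mulX t1 t2 t3 p))
       (dif W2 p (mulX t1 t2 t3 p)) (dif W3 p (mulX t1 t2 t3 p)).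
Proof.
move=> s0 s1 s2 s3.
have E (f g : SU2 R -> R) : (forall q, f q = g q) -> dif f p (mulX t1 t2 t3 p) =
  dif g p (mulX t1 t2 t3 p) by move=> /funext ->.
apply: mx22P; rewrite /dif_mx !mxE /=; congr (_ +i* _);
  rewrite -?difN //; apply: E => q; by rewrite !mxE.
Qed.

(** The terms 2 (v x w) come from [X_1, X_2] = 2 X_3 and its cyclic analogues. *)
Lemma bracket_mulX (R : realType) (v1 v2 v3 w1 w2 w3 : SU2 R -> R) (p : SU2 R) :
  smooth v1 -> smooth v2 -> smooth v3 -> smooth w1 -> smooth w2 -> smooth w3 ->
  let V q := mulX (v1 q) (v2 q) (v3 q) q in
  let W q := mulX (w1 q) (w2 q) (w3 q) q in
  bracket V W p =
  mulX (dif w1 p (V p) - dif v1 p (W p) + 2 * (v2 p * w3 p - v3 p * w2 p))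
       (dif w2 p (V p) - dif v2 p (W p) + 2 * (v3 p * w1 p - v1 p * w3 p))
       (dif w3 p (V p) - dif v3 p (W p) + 2 * (v1 p * w2 p - v2 p * w1 p)) p.
Proof.
move=> sv1 sv2 sv3 sw1 sw2 sw3 V W.
have dmx (u1 u2 u3 : SU2 R -> R) (t1 t2 t3 : R) : smooth u1 -> smooth u2 -> smooth u3 ->
  dif_mx (fun q => mulX (u1 q) (u2 q) (u3 q) q) p (mulX t1 t2 t3 p) =
  mulX t1 t2 t3 p *m quat 0 (u1 p) (u2 p) (u3 p) +
  mulX (dif u1 p (mulX t1 t2 t3 p)) (dif u2 p (mulX t1 t2 t3 p))
       (dif u3 p (mulX t1 t2 t3 p)) p.
  move=> s1 s2 s3; rewrite /mulX dif_mx_quat; [|by smooth_tac..].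
  do ?[rewrite difB; [|by smooth_tac..] | rewrite difD; [|by smooth_tac..] |
       rewrite difM; [|by smooth_tac..] | rewrite difN; [|by smooth_tac..]].
  by rewrite !dif_qr !dif_qi !dif_qj !dif_qk quatM quatD; congr quat; rewrite /mulX; ring.
rewrite /bracket /V /W !dmx //.
move: (dif w1 _ _) (dif w2 _ _) (dif w3 _ _) (dif v1 _ _) (dif v2 _ _) (dif v3 _ _).
move=> d1 d2 d3 e1 e2 e3; rewrite /mulX !quatM !quatD !quatN !quatD.
by congr quat; ring.
Qed.

(** * The Laplace-Beltrami operator is a sum of squares *)

Section Laplacian.
Variables (R : realType) (a b c : R).
Hypotheses (a0 : 0 < a) (b0 : 0 < b) (c0 : 0 < c).

Lemma frame_mulX (k : 'I_3) (p : SU2 R) :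
  frame a b c k p = mulX (a * (k == 0)%:R) (b * (k == 1)%:R) (c * (k == 2%:R)%:R) p.
Proof.
rewrite -mulXE /frame /orth_basis su2_basis_quat quatZ; congr (_ *m quat _ _ _ _).
- by rewrite mulr0.
all: by case: k => [[|[|[|//]]] ?] /=; rewrite ?mulr0.
Qed.

Lemma metric_mulX (t1 t2 t3 u1 u2 u3 : R) (p : SU2 R) :
  metric a b c p (mulX t1 t2 t3 p) (mulX u1 u2 u3 p) =
  (t1 / a) * (u1 / a) + (t2 / b) * (u2 / b) + (t3 / c) * (u3 / c).
Proof.
have pU : val p \in unitmx.
  by apply: unitarymx_unit; case/andP: (valP p).
rewrite /metric -!mulXE !mulKmx // /su2_inner !big_ord_recl big_ord0 addr0 addrA.
by rewrite /su2_coord /scale3 /= !mxE.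
Qed.

Lemma su2_pure (t1 t2 t3 : R) : su2 (quat 0 t1 t2 t3).
Proof.
split; last first.
  rewrite /mxtrace !big_ord_recl big_ord0 !mxE /= addr0.
  by apply/eqP; rewrite eq_complex /= addr0 subrr eqxx.
by apply: mx22P; rewrite !mxE /=; apply/eqP; rewrite eq_complex /= ?opprK ?oppr0 !eqxx.
Qed.

Lemma tangent_mulX (t1 t2 t3 : R) (p : SU2 R) : tangent p (mulX t1 t2 t3 p).
Proof. by exists (quat 0 t1 t2 t3); [exact: su2_pure | rewrite mulXE]. Qed.

Lemma tangentP (p : SU2 R) v : tangent p v -> exists t1 t2 t3, v = mulX t1 t2 t3 p.
Proof.
move=> [X /su2_quat -> ->]; rewrite mulXE.
by exists (su2_coord X 0), (su2_coord X 1), (su2_coord X 2%:R).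
Qed.

Lemma grad_mulX (f : SU2 R -> R) (p : SU2 R) : smooth f ->
  grad a b c f p = mulX (a ^+ 2 * D1 f p) (b ^+ 2 * D2 f p) (c ^+ 2 * D3 f p) p.
Proof.
move=> sf; have [an0 bn0 cn0] := And3 (lt0r_neq0 a0) (lt0r_neq0 b0) (lt0r_neq0 c0).
apply: xget_unique.
  split; first exact: tangent_mulX.
  move=> _ /tangentP[t1 [t2 [t3 ->]]]; rewrite metric_mulX dif_lin //.
  by field; rewrite an0 bn0 cn0.
move=> _ [/tangentP[t1 [t2 [t3 ->]]] H].
move: (H _ (tangent_mulX 1 0 0 p)) (H _ (tangent_mulX 0 1 0 p)) (H _ (tangent_mulX 0 0 1 p)).
rewrite !metric_mulX -/(D1 f p) -/(D2 f p) -/(D3 f p) => <- <- <-.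
by congr (mulX _ _ _ p); field; rewrite ?an0 ?bn0 ?cn0.
Qed.

Lemma det33 (A : 'M[R]_3) :
  \det A = A 0 0 * (A 1 1 * A 2%:R 2%:R - A 1 2%:R * A 2%:R 1)
         - A 0 1 * (A 1 0 * A 2%:R 2%:R - A 1 2%:R * A 2%:R 0)
         + A 0 2%:R * (A 1 0 * A 2%:R 1 - A 1 1 * A 2%:R 0).
Proof.
rewrite (expand_det_row _ 0) !big_ord_recl big_ord0 addr0 /cofactor !det22 !mxE.
pose B i j := A (inord i) (inord j).
have AB i j : A i j = B (val i) (val j) by rewrite /B !inord_val.
rewrite !AB /= /bump /= !addn0 ?add0n !addn1; ring.
Qed.

Lemma vol_replace (r1 r2 r3 : R) (k : 'I_3) (p : SU2 R) :
  vol a b c p (fun l => if l == k then mulX r1 r2 r3 p else frame a b c l p) =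
  nth 0 [:: r1 / a; r2 / b; r3 / c] k.
Proof.
have [an0 bn0 cn0] := And3 (lt0r_neq0 a0) (lt0r_neq0 b0) (lt0r_neq0 c0).
rewrite /vol det33 !mxE !frame_mulX; case: k => [[|[|[|//]]] k3] /=;
  do ?[rewrite [_ == Ordinal k3]/=]; rewrite /= !metric_mulX; field;
  by rewrite ?an0 ?bn0 ?cn0.
Qed.

(** For V = grad f the k-th component of [V, A_k] is - A_k (V_k): the structure
   constants contribute the k-th component of a cross product with A_k, which
   is 0. *)
Lemma laplace_smooth (f : SU2 R -> R) (p : SU2 R) : smooth f ->
  laplace_beltrami a b c f p =
  - (a ^+ 2 * D1 (D1 f) p + b ^+ 2 * D2 (D2 f) p + c ^+ 2 * D3 (D3 f) p).
Proof.
move=> sf; have [an0 bn0 cn0] := And3 (lt0r_neq0 a0) (lt0r_neq0 b0) (lt0r_neq0 c0).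
have [sf1 sf2 sf3] := And3 (smooth_D1 sf) (smooth_D2 sf) (smooth_D3 sf).
rewrite /laplace_beltrami /div /lie_derivative.
have gradE : grad a b c f = fun q =>
    mulX (a ^+ 2 * D1 f q) (b ^+ 2 * D2 f q) (c ^+ 2 * D3 f q) q.
  by apply/funext => q; exact: grad_mulX.
rewrite [X in X - _](_ : _ = 0); last first.
  rewrite gradE (_ : (fun q => vol _ _ _ _ _) = (fun=> 1)); first exact: dif_cst.
  by apply/funext => q; exact: vol_frame.
have frameE k : frame a b c k = fun q : SU2 R =>
    mulX (a * (k == 0)%:R) (b * (k == 1)%:R) (c * (k == 2%:R)%:R) q.
  by apply/funext => q; exact: frame_mulX.
have bE k := bracket_mulX p (smoothZ (a ^+ 2) sf1) (smoothZ (b ^+ 2) sf2)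
  (smoothZ (c ^+ 2) sf3)
  (smooth_cst (a * (k == 0 :> 'I_3)%:R)) (smooth_cst (b * (k == 1)%:R))
  (smooth_cst (c * (k == 2%:R)%:R)).
have volE (k : 'I_3) : vol a b c p (fun l => if l == k
    then bracket (grad a b c f) (frame a b c k) p else frame a b c l p) =
    nth 0 [:: - (a ^+ 2 * D1 (D1 f) p); - (b ^+ 2 * D2 (D2 f) p);
              - (c ^+ 2 * D3 (D3 f) p)] k.
  rewrite {1}gradE {1}frameE bE vol_replace !dif_cst.
  do 3?[rewrite difM; [|by smooth_tac..]]; rewrite !dif_cst !dif_lin //.
  case: k => [[|[|[|//]]] k3] /=; field; by rewrite ?an0 ?bn0 ?cn0.
rewrite sub0r (eq_bigr _ (fun k _ => volE k)) !big_ord_recl big_ord0 /=; ring.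
Qed.

End Laplacian.
(** * A mean on bounded sequences *)

Definition bounded_seq (R : realType) (u : nat -> R) := exists B, forall n, `|u n| <= B.

(** Limits along an ultrafilter exist for every bounded sequence, and so define a
   linear functional without any proof of convergence. *)
Definition nat_ultra : set_system nat := sval (cid (ultraFilterLemma eventually_filter)).

Lemma nat_ultraP : UltraFilter nat_ultra /\ \oo `<=` nat_ultra.
Proof. exact: svalP (cid (ultraFilterLemma eventually_filter)). Qed.

#[global] Instance nat_ultra_ultra : UltraFilter nat_ultra.
Proof. by case: nat_ultraP. Qed.

Lemma nat_ultra_cvg (R : realType) (u : nat -> R) (l : R) :
  u @ \oo --> l -> u @ nat_ultra --> l.
Proof.
by move=> ul A /ul; have [_] := nat_ultraP; apply.
Qed.

Definition ulim (R : realType) (u : nat -> R) : R := lim (u @ nat_ultra).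

(** A cluster point of a bounded sequence is its limit, because for an ultrafilter
   each neighbourhood or its complement has its preimage in the filter. *)
Lemma ulim_cvg (R : realType) (u : nat -> R) : bounded_seq u -> u @ nat_ultra --> ulim u.
Proof.
move=> [B uB]; suff: cvg (u @ nat_ultra) by [].
have FF : ProperFilter (u @ nat_ultra) by exact: fmap_proper_filter.
have cB : (u @ nat_ultra) `[- B, B]%classic.
  rewrite /fmap /=; apply: (@filterS _ nat_ultra _ setT); last exact: filterT.
  by move=> n _ /=; rewrite in_itv /= -ler_norml.
have [p [_ clp]] := @segment_compact R (- B) B (u @ nat_ultra) FF cB.
apply/cvg_ex; exists p => A Ap.
have [//|UA] := in_ultra_setVsetC (u @^-1` A) nat_ultra_ultra.
have [x [/= nAx Ax]] := clp (~` A) A UA Ap.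
by [].
Qed.

Section Ulim.
Variable R : realType.
Implicit Types u v : nat -> R.

Lemma ulim_eq u l : u @ \oo --> l -> ulim u = l.
Proof. by move=> /nat_ultra_cvg ul; exact: cvg_lim. Qed.

Lemma ulimD u v : bounded_seq u -> bounded_seq v ->
  ulim (fun n => u n + v n) = ulim u + ulim v.
Proof.
by move=> /ulim_cvg bu /ulim_cvg bv; apply: cvg_lim => //; exact: cvgD.
Qed.

Lemma ulimZ r u : bounded_seq u -> ulim (fun n => r * u n) = r * ulim u.
Proof.
by move=> /ulim_cvg bu; apply: cvg_lim => //; apply: cvgM => //; exact: cvg_cst.
Qed.

Lemma ulim_ge u l : bounded_seq u -> (\forall n \near \oo, l <= u n) -> l <= ulim u.
Proof.
move=> /ulim_cvg bu lu; apply: (cvgr_to_ge bu).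
by have [_] := nat_ultraP; apply.
Qed.

End Ulim.

(** * Riemann sums of derivatives *)

Section Riemann.
Variable R : realType.

Lemma MVT_everywhere (f f' : R -> R) (x y : R) :
  (forall s, is_derive s (1 : R) f (f' s)) ->
  exists2 z, `|z - x| <= `|y - x| & f y - f x = f' z * (y - x).
Proof.
move=> df; have cf A : {within A, continuous f}.
  apply: continuous_subspaceT => s; apply: differentiable_continuous.
  by apply/derivable1_diffP; case: (df s).
have [xy|/ltW yx] := leP x y.
  have [z] := MVT_segment xy (fun s _ => df s) (cf _).
  rewrite in_itv /= => /andP[xz zy] E; exists z => //.
  by rewrite !ger0_norm ?subr_ge0 // lerD2r.
have [z] := MVT_segment yx (fun s _ => df s) (cf _).
rewrite in_itv /= => /andP[yz zx] E; exists z; last by rewrite -opprB E; ring.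
by rewrite !ler0_norm ?subr_le0 // lerN2 lerD2r.
Qed.

Lemma derive_bound_lipschitz (f f' : R -> R) (B x y : R) :
  (forall s, is_derive s (1 : R) f (f' s)) -> (forall s, `|f' s| <= B) ->
  `|f x - f y| <= B * `|x - y|.
Proof.
move=> df bf; have [z _ ->] := MVT_everywhere y x df.
by rewrite normrM ler_wpM2r.
Qed.

(** Up to an error of order d^2 each term times the step d is an increment of f,
   and the increments add up to f (s + T) - f s = 0. *)
Lemma riemann_sum_derive (f f' : R -> R) (B s T : R) (n : nat) :
  0 < T -> (forall s, is_derive s (1 : R) f (f' s)) ->
  (forall x y, `|f' x - f' y| <= B * `|x - y|) -> f (s + T) = f s ->
  `|\sum_(i < n.+1) f' (s + i%:R * (T / n.+1%:R))| <= B * T.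
Proof.
move=> T0 df lf fT; set d := T / n.+1%:R.
have d0 : 0 <= d by rewrite divr_ge0 // ltW.
have nd : n.+1%:R * d = T by rewrite /d mulrC divfK.
have step x : `|d * f' x - (f (x + d) - f x)| <= B * d * d.
  have [z hz E] := MVT_everywhere x (x + d) df.
  rewrite E (_ : x + d - x = d) in hz *; last by ring.
  rewrite mulrC -mulrBl normrM (ger0_norm d0) ler_wpM2r //.
  rewrite (le_trans (lf _ _)) // distrC ler_wpM2l //.
    by have := le_trans (normr_ge0 _) (lf 1 0); rewrite subr0 normr1 mulr1.
  by rewrite (le_trans hz) // ger0_norm.
have tel : \sum_(i < n.+1) (f (s + i%:R * d + d) - f (s + i%:R * d)) = 0.
  rewrite (eq_bigr (fun i : 'I_n.+1 => f (s + i.+1%:R * d) - f (s + i%:R * d))).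
    rewrite -(big_mkord xpredT (fun i => f (s + i.+1%:R * d) - f (s + i%:R * d))).
    rewrite (@telescope_sumr _ 0 n.+1 (fun i => f (s + i%:R * d))) // nd fT.
    by rewrite mul0r addr0 subrr.
  by move=> i _; congr (f _ - _); rewrite -natr1; ring.
have dp : 0 < d by rewrite divr_gt0.
rewrite -(ler_pM2l dp) -{1}(ger0_norm d0) -normrM.
have -> : d * \sum_(i < n.+1) f' (s + i%:R * d) =
   \sum_(i < n.+1) (d * f' (s + i%:R * d) - (f (s + i%:R * d + d) - f (s + i%:R * d))).
  by rewrite big_split /= sumrN tel subr0 mulr_sumr.
rewrite (le_trans (ler_norm_sum _ _ _)) //.
rewrite (le_trans (ler_sum _ (fun i _ => step _))) // sumr_const card_ord -mulr_natl.
by rewrite -nd le_eqVlt; apply/orP; left; apply/eqP; ring.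
Qed.


(** Stable under sums and products, this class contains all the derivatives whose
   Riemann sums are estimated below, with bounds uniform in the variables that
   are held fixed. *)
Definition bLip (G : R -> R -> R -> R) := exists B, forall x y z,
  `|G x y z| <= B /\ forall x' y' z',
  `|G x y z - G x' y' z'| <= B * (`|x - x'| + `|y - y'| + `|z - z'|).

Lemma bLip_cst r : bLip (fun _ _ _ => r).
Proof.
exists `|r| => x y z; split=> [//|x' y' z'].
by rewrite subrr normr0 mulr_ge0 // !addr_ge0.
Qed.

Lemma bLipD G H : bLip G -> bLip H -> bLip (fun x y z => G x y z + H x y z).
Proof.
move=> [B hB] [C hC]; exists (B + C) => x y z.
have [GB GL] := hB x y z; have [HB HL] := hC x y z; split=> [|x' y' z'].
  by rewrite (le_trans (ler_normD _ _)) // lerD.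
rewrite opprD addrACA mulrDl (le_trans (ler_normD _ _)) //.
by rewrite lerD ?GL ?HL.
Qed.

Lemma bLipM G H : bLip G -> bLip H -> bLip (fun x y z => G x y z * H x y z).
Proof.
move=> [B hB] [C hC]; exists (B * C + B * C) => x y z.
have B0 : 0 <= B by have [+ _] := hB x y z; apply: le_trans.
have C0 : 0 <= C by have [+ _] := hC x y z; apply: le_trans.
have [GB GL] := hB x y z; have [HC HL] := hC x y z; split=> [|x' y' z'].
  by rewrite normrM (le_trans (ler_pM _ _ GB HC)) // lerDl mulr_ge0.
have [GB' _] := hB x' y' z'.
rewrite (_ : _ - _ = (G x y z - G x' y' z') * H x y z +
   G x' y' z' * (H x y z - H x' y' z')); last by ring.
rewrite (le_trans (ler_normD _ _)) // !normrM mulrDl lerD //.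
  by rewrite mulrAC ler_pM.
by rewrite -mulrA ler_pM.
Qed.

Lemma bLipN G : bLip G -> bLip (fun x y z => - G x y z).
Proof.
move=> bG; have [B hB] := bLipM (bLip_cst (-1)) bG; exists B => x y z.
have [h1 h2] := hB x y z; rewrite !mulN1r in h1.
by split=> // x' y' z'; have := h2 x' y' z'; rewrite !mulN1r.
Qed.

Lemma cos_lipschitz (x y : R) : `|cos x - cos y| <= `|x - y|.
Proof.
rewrite -[leRHS]mul1r; apply: (@derive_bound_lipschitz cos (fun s => - sin s)) => s.
by rewrite normrN ler_norml sin_geN1 sin_le1.
Qed.

Lemma bLip_cos u v w t : bLip (fun x y z => cos (u * x + v * y + w * z + t)).
Proof.
exists (1 + `|u| + `|v| + `|w|) => x y z; split=> [|x' y' z'].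
  apply: (@le_trans _ _ 1); first by rewrite ler_norml cos_geN1 cos_le1.
  by rewrite -!addrA lerDl !addr_ge0.
rewrite (le_trans (cos_lipschitz _ _)) //.
rewrite (_ : _ - _ = u * (x - x') + v * (y - y') + w * (z - z')); last by ring.
apply: (@le_trans _ _ (`|u| * `|x - x'| + `|v| * `|y - y'| + `|w| * `|z - z'|)).
  by rewrite -!normrM (le_trans (ler_normD _ _)) // lerD // ler_normD.
have [p0 q0 r0] := And3 (normr_ge0 (x - x')) (normr_ge0 (y - y')) (normr_ge0 (z - z')).
have [u0 v0 w0] := And3 (normr_ge0 u) (normr_ge0 v) (normr_ge0 w).
move: (`|x - x'|) (`|y - y'|) (`|z - z'|) (`|u|) (`|v|) (`|w|) p0 q0 r0 u0 v0 w0.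
move=> p q r U V W p0 q0 r0 U0 V0 W0.
have := mulr_ge0 U0 q0; have := mulr_ge0 U0 r0; have := mulr_ge0 V0 p0.
have := mulr_ge0 V0 r0; have := mulr_ge0 W0 p0; have := mulr_ge0 W0 q0; nra.
Qed.

Lemma bLip_sin u v w t : bLip (fun x y z => sin (u * x + v * y + w * z + t)).
Proof.
have [B hB] := bLip_cos u v w (t - pi / 2); exists B => x y z.
have E x1 y1 z1 : u * x1 + v * y1 + w * z1 + (t - pi / 2) =
   u * x1 + v * y1 + w * z1 + t - pi / 2 by ring.
have [] := hB x y z; rewrite E cosBpihalf => h1 h2; split=> // x' y' z'.
by have := h2 x' y' z'; rewrite E cosBpihalf.
Qed.

(** The box of the sums is [-2 pi, 2 pi] x [0, pi / 2] x [-2 pi, 2 pi], on which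
   the Euler angles cover SU(2) several times; a point always has angles in the
   interior of the outer intervals.  The volume of the box is divided out. *)
Definition node n (s T : R) (i : nat) : R := s + i%:R * (T / n.+1%:R).
Definition period : R := pi *+ 4.
Definition start : R := - (pi *+ 2).

Definition rsum n (G : R -> R -> R -> R) : R :=
  (n.+1%:R ^+ 3)^-1 * \sum_(i < n.+1) \sum_(j < n.+1) \sum_(k < n.+1)
    G (node n start period i) (node n 0 (pi / 2) j) (node n start period k).

Lemma rsumD n G H : rsum n (fun x y z => G x y z + H x y z) = rsum n G + rsum n H.
Proof.
rewrite /rsum -mulrDr -big_split /=; congr (_ * _); apply: eq_bigr => i _.
by rewrite -big_split /=; apply: eq_bigr => j _; rewrite -big_split.
Qed.

Lemma rsumZ n r G : rsum n (fun x y z => r * G x y z) = r * rsum n G.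
Proof.
rewrite /rsum mulrCA; congr (_ * _); rewrite mulr_sumr; apply: eq_bigr => i _.
by rewrite mulr_sumr; apply: eq_bigr => j _; rewrite mulr_sumr.
Qed.

Lemma rsum_bound n G B : (forall x y z, `|G x y z| <= B) -> `|rsum n G| <= B.
Proof.
move=> hB; have S (F : 'I_n.+1 -> R) C : (forall i, `|F i| <= C) ->
    `|\sum_(i < n.+1) F i| <= n.+1%:R * C.
  move=> hF; rewrite (le_trans (ler_norm_sum _ _ _)) //.
  rewrite (le_trans (ler_sum _ (fun i _ => hF i))) //.
  by rewrite sumr_const card_ord mulr_natl.
rewrite /rsum normrM ger0_norm ?invr_ge0 ?exprn_ge0 // mulrC ler_pdivrMr ?exprn_gt0 //.
rewrite (_ : B * _ = n.+1%:R * (n.+1%:R * (n.+1%:R * B))); last by ring.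
by do 3![apply: (S) => ?].
Qed.

Lemma rsum_le n G H : (forall i j k, (i < n.+1)%N -> (j < n.+1)%N -> (k < n.+1)%N ->
   G (node n start period i) (node n 0 (pi / 2) j) (node n start period k) <=
   H (node n start period i) (node n 0 (pi / 2) j) (node n start period k)) ->
  rsum n G <= rsum n H.
Proof.
move=> GH; rewrite /rsum ler_pM2l ?invr_gt0 ?exprn_gt0 //.
by do 3![apply: ler_sum => ? _]; apply: GH.
Qed.

End Riemann.
Section RiemannDerivatives.
Variable R : realType.
Implicit Types G H : R -> R -> R -> R.

Lemma sum_norm_bound n (F : 'I_n.+1 -> R) C :
  (forall i, `|F i| <= C) -> `|\sum_(i < n.+1) F i| <= n.+1%:R * C.
Proof.
move=> hF; rewrite (le_trans (ler_norm_sum _ _ _)) //.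
rewrite (le_trans (ler_sum _ (fun i _ => hF i))) //.
by rewrite sumr_const card_ord mulr_natl.
Qed.

Lemma cvg0_harmonic (u : nat -> R) C : (forall n, `|u n| <= C / n.+1%:R) -> u @ \oo --> 0.
Proof.
move=> hu; have h0 : (fun n : nat => C / n.+1%:R) @ \oo --> 0.
  rewrite -[X in _ --> X](mulr0 C); apply: cvgM; first exact: cvg_cst.
  exact: cvg_harmonic.
have h0' : (fun n : nat => - (C / n.+1%:R)) @ \oo --> 0.
  by rewrite -[X in _ --> X]oppr0; apply: cvgN.
apply: (squeeze_cvgr _ h0' h0); apply: nearW => n.
by rewrite -ler_norml.
Qed.

Lemma rsum_cvg0 (G : R -> R -> R -> R) (C : R) :
  (forall n, `|\sum_(i < n.+1) \sum_(j < n.+1) \sum_(k < n.+1)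
    G (node n (start R) (period R) i) (node n 0 (pi / 2) j)
      (node n (start R) (period R) k)| <= n.+1%:R * (n.+1%:R * C)) ->
  (fun n => rsum n G) @ \oo --> 0.
Proof.
move=> h; apply: (@cvg0_harmonic _ C) => n.
rewrite /rsum normrM ger0_norm ?invr_ge0 ?exprn_ge0 // mulrC ler_pdivrMr ?exprn_gt0 //.
have := h n; have : n.+1%:R != 0 :> R by rewrite pnatr_eq0.
move: (n.+1%:R : R) => m m0; rewrite (_ : C / m * _ = m * (m * C)) //.
by field.
Qed.

Lemma period_gt0 : 0 < period R. Proof. by rewrite /period pmulrn_lgt0 // pi_gt0. Qed.

Lemma rsum_derive1 G H : bLip G ->
  (forall x y z, is_derive x (1 : R) (fun s => H s y z) (G x y z)) ->
  (forall y z, H (start R + period R) y z = H (start R) y z) ->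
  (fun n => rsum n G) @ \oo --> 0.
Proof.
move=> [B hB] dH per; apply: (@rsum_cvg0 _ (B * period R)) => n.
rewrite exchange_big /=; apply: sum_norm_bound => j.
rewrite exchange_big /=; apply: sum_norm_bound => k.
apply: (@riemann_sum_derive _ (fun s => H s (node n 0 (pi / 2) j)
   (node n (start R) (period R) k)) (fun x => G x _ _)) => //; first exact: period_gt0.
move=> x y; have [_ /(_ y _ _)] := hB x (node n 0 (pi / 2) j) (node n (start R) (period R) k).
by move=> h; rewrite (le_trans (h _ _)) // !subrr normr0 !addr0.
Qed.

Lemma rsum_derive2 G H : bLip G ->
  (forall x y z, is_derive y (1 : R) (fun s => H x s z) (G x y z)) ->
  (forall x z, H x (0 + pi / 2) z = H x 0 z) ->
  (fun n => rsum n G) @ \oo --> 0.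
Proof.
move=> [B hB] dH per; apply: (@rsum_cvg0 _ (B * (pi / 2))) => n.
apply: sum_norm_bound => i.
rewrite exchange_big /=; apply: sum_norm_bound => k.
apply: (@riemann_sum_derive _ (fun s => H (node n (start R) (period R) i) s
   (node n (start R) (period R) k)) (fun x => G _ x _)) => //.
  by rewrite divr_gt0 // pi_gt0.
move=> x y; have [_ /(_ _ y _)] := hB (node n (start R) (period R) i) x (node n (start R) (period R) k).
by move=> h; rewrite (le_trans (h _ _)) // !subrr normr0 addr0 add0r.
Qed.

Lemma rsum_derive3 G H : bLip G ->
  (forall x y z, is_derive z (1 : R) (fun s => H x y s) (G x y z)) ->
  (forall x y, H x y (start R + period R) = H x y (start R)) ->
  (fun n => rsum n G) @ \oo --> 0.
Proof.
move=> [B hB] dH per; apply: (@rsum_cvg0 _ (B * period R)) => n.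
apply: sum_norm_bound => i; apply: sum_norm_bound => j.
apply: (@riemann_sum_derive _ (fun s => H (node n (start R) (period R) i)
   (node n 0 (pi / 2) j) s) (fun x => G _ _ x)) => //; first exact: period_gt0.
move=> x y; have [_ /(_ _ _ y)] := hB (node n (start R) (period R) i) (node n 0 (pi / 2) j) x.
by move=> h; rewrite (le_trans (h _ _)) // !subrr normr0 !add0r.
Qed.

End RiemannDerivatives.

(** * Euler angles *)

Section Euler.
Variable R : realType.

Lemma euler_sphere (x y z : R) :
  (cos y * cos (x + z)) ^+ 2 + (cos y * sin (x + z)) ^+ 2 +
  (sin y * cos (x - z)) ^+ 2 + (sin y * sin (x - z)) ^+ 2 = 1.
Proof.
have h1 := cos2Dsin2 (x + z); have h2 := cos2Dsin2 (x - z).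
rewrite !exprMn -mulrDr h1 -addrA -mulrDr h2 !mulr1; exact: cos2Dsin2.
Qed.

(** The product exp(x X_1) exp(y X_2) exp(z X_1). *)
Definition euler (x y z : R) : SU2 R := mkq (euler_sphere x y z).

Lemma euler_X (x y z : R) :
  [/\ qr (euler x y z) = cos y * cos (x + z), qi (euler x y z) = cos y * sin (x + z),
      qj (euler x y z) = sin y * cos (x - z) & qk (euler x y z) = sin y * sin (x - z)].
Proof. by rewrite /qr /qi /qj /qk /= !mxE. Qed.

Lemma euler_periodic1 (y z : R) : euler (start R + period R) y z = euler (start R) y z.
Proof.
have E (t : R) : start R + period R + t = start R + t + pi *+ 2 + pi *+ 2.
  by rewrite /start /period; ring.
apply: SU2_eq; rewrite /qr /qi /qj /qk /= !mxE /=;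
  by rewrite E ?cosD2pi ?sinD2pi.
Qed.

Lemma euler_periodic3 (x y : R) : euler x y (start R + period R) = euler x y (start R).
Proof.
have E1 : x + (start R + period R) = x + start R + pi *+ 2 + pi *+ 2.
  by rewrite /start /period; ring.
have E2 : x - start R = x - (start R + period R) + pi *+ 2 + pi *+ 2.
  by rewrite /start /period; ring.
apply: SU2_eq; rewrite /qr /qi /qj /qk /= !mxE /=;
  by rewrite ?E1 ?E2 ?cosD2pi ?sinD2pi.
Qed.

Lemma is_derive_kcos (k u v t d : R) (f : R -> R) :
  (forall s, f s = k * cos (u * s + v)) -> d = - (k * (u * sin (u * t + v))) ->
  is_derive t (1 : R) f d.
Proof.
move=> ff ->; apply: (is_derive_ext (is_deriveZ k (is_derive_cos_lin u v t))).
  by move=> s; rewrite ff.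
by rewrite /GRing.scale /= mulrN.
Qed.

Lemma is_derive_ksin (k u v t d : R) (f : R -> R) :
  (forall s, f s = k * sin (u * s + v)) -> d = k * (u * cos (u * t + v)) ->
  is_derive t (1 : R) f d.
Proof.
move=> ff ->; apply: (is_derive_ext (is_deriveZ k (is_derive_sin_lin u v t))) => //.
Qed.

Lemma euler_derive3 (x y z : R) :
  is_derive z (1 : R) (fun s => ReIm (val (euler x y s)))
    (ReIm (mulX 1 0 0 (euler x y z))).
Proof.
have [e0 e1 e2 e3] := euler_X x y z; rewrite /mulX e0 e1 e2 e3.
have E (s : R) : x + s = 1 * s + x by ring.
have F (s : R) : x - s = -1 * s + x by ring.
apply: is_derive_quat.
- by apply: (@is_derive_kcos (cos y) 1 x) => [s|]; rewrite E //; ring.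
- by apply: (@is_derive_ksin (cos y) 1 x) => [s|]; rewrite E //; ring.
- by apply: (@is_derive_kcos (sin y) (-1) x) => [s|]; rewrite F //; ring.
- by apply: (@is_derive_ksin (sin y) (-1) x) => [s|]; rewrite F //; ring.
Qed.

Lemma euler_derive2 (x y z : R) :
  is_derive y (1 : R) (fun s => ReIm (val (euler x s z)))
    (ReIm (mulX 0 (cos (2 * z)) (- sin (2 * z)) (euler x y z))).
Proof.
have [e0 e1 e2 e3] := euler_X x y z; rewrite /mulX e0 e1 e2 e3.
have cA : cos (x + z) = cos (x - z) * cos (2 * z) - sin (x - z) * sin (2 * z).
  by rewrite -cosD; congr cos; ring.
have sA : sin (x + z) = sin (x - z) * cos (2 * z) + cos (x - z) * sin (2 * z).
  by rewrite -sinD; congr sin; ring.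
have cB : cos (x - z) = cos (x + z) * cos (2 * z) + sin (x + z) * sin (2 * z).
  by rewrite -cosB; congr cos; ring.
have sB : sin (x - z) = sin (x + z) * cos (2 * z) - cos (x + z) * sin (2 * z).
  by rewrite -sinB; congr sin; ring.
apply: is_derive_quat.
- apply: (@is_derive_kcos (cos (x + z)) 1 0) => [s|].
    by rewrite !mul1r addr0 mulrC.
  by rewrite !mul1r addr0 cA; ring.
- apply: (@is_derive_kcos (sin (x + z)) 1 0) => [s|].
    by rewrite !mul1r addr0 mulrC.
  by rewrite !mul1r addr0 sA; ring.
- apply: (@is_derive_ksin (cos (x - z)) 1 0) => [s|].
    by rewrite !mul1r addr0 mulrC.
  by rewrite !mul1r addr0 cB; ring.
- apply: (@is_derive_ksin (sin (x - z)) 1 0) => [s|].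
    by rewrite !mul1r addr0 mulrC.
  by rewrite !mul1r addr0 sB; ring.
Qed.

(** Here the velocity is X_1 p = p (p^-1 X_1 p), which is why both other angles
   enter. *)
Lemma euler_derive1 (x y z : R) :
  is_derive x (1 : R) (fun s => ReIm (val (euler s y z)))
    (ReIm (mulX (cos (2 * y)) (sin (2 * y) * sin (2 * z)) (sin (2 * y) * cos (2 * z))
      (euler x y z))).
Proof.
have [e0 e1 e2 e3] := euler_X x y z; rewrite /mulX e0 e1 e2 e3.
have cA : cos (x + z) = cos (x - z) * cos (2 * z) - sin (x - z) * sin (2 * z).
  by rewrite -cosD; congr cos; ring.
have sA : sin (x + z) = sin (x - z) * cos (2 * z) + cos (x - z) * sin (2 * z).
  by rewrite -sinD; congr sin; ring.
have cB : cos (x - z) = cos (x + z) * cos (2 * z) + sin (x + z) * sin (2 * z).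
  by rewrite -cosB; congr cos; ring.
have sB : sin (x - z) = sin (x + z) * cos (2 * z) - cos (x + z) * sin (2 * z).
  by rewrite -sinB; congr sin; ring.
have C : cos y = cos (2 * y) * cos y + sin (2 * y) * sin y.
  by rewrite -cosB; congr cos; ring.
have S : sin y = sin (2 * y) * cos y - cos (2 * y) * sin y.
  by rewrite -sinB; congr sin; ring.
have E (s : R) : s + z = 1 * s + z by ring.
have F (s : R) : s - z = 1 * s - z by ring.
apply: is_derive_quat.
- apply: (@is_derive_kcos (cos y) 1 z) => [s|]; first by rewrite E.
  by rewrite -E [in RHS]C sA; ring.
- apply: (@is_derive_ksin (cos y) 1 z) => [s|]; first by rewrite E.
  by rewrite -E [in RHS]C cA; ring.
- apply: (@is_derive_kcos (sin y) 1 (- z)) => [s|]; first by rewrite F.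
  by rewrite -F [in RHS]S sB; ring.
- apply: (@is_derive_ksin (sin y) 1 (- z)) => [s|]; first by rewrite F.
  by rewrite -F [in RHS]S cB; ring.
Qed.

(** Unit quaternions have coordinates in [-1, 1], and the extension of f is bounded
   on the compact set of matrices with such coordinates. *)
Lemma smooth_bounded (f : SU2 R -> R) : smooth f -> exists B, forall p, `|f p| <= B.
Proof.
move=> [F cF fF].
pose q (v : 'rV[R]_4) : MM R := v 0 0 *: ReIm (quat 1 0 0 0) + v 0 1 *: ReIm (quat 0 1 0 0) +
  (v 0 2%:R *: ReIm (quat 0 0 1 0) + v 0 3%:R *: ReIm (quat 0 0 0 1)).
have cq : continuous q.
  have c1 i w : continuous (fun v : 'rV[R]_4 => v 0 i *: w : MM R).
    move=> v; apply: (@continuous_comp _ _ _ (fun v : 'rV[R]_4 => v 0 i) (fun r => r *: w)).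
      exact: coord_continuous.
    exact: scalel_continuous.
  have cD (f1 f2 : 'rV[R]_4 -> MM R) : continuous f1 -> continuous f2 ->
      continuous (fun v => f1 v + f2 v).
    by move=> c1' c2' v; exact: (@continuousD _ _ _ f1 f2 v (c1' v) (c2' v)).
  exact: cD (cD _ _ (c1 _ _) (c1 _ _)) (cD _ _ (c1 _ _) (c1 _ _)).
pose K := [set v : 'rV[R]_4 | forall i, `[-1 : R, 1]%classic (v ord0 i)].
have cK : compact K.
  exact: (@rV_compact R 4 (fun=> `[-1 : R, 1]%classic) (fun=> @segment_compact _ _ _)).
have cFq : {within K, continuous (fun v => `|F (q v)|)}.
  apply: continuous_subspaceT => v.
  apply: (@continuous_comp _ _ _ (fun v => F (q v)) (fun r => `|r|)).
    apply: (@continuous_comp _ _ _ q F); first exact: cq.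
    exact: (cF 0%N).
  exact: norm_continuous.
have K0 : K !=set0.
  by exists 0 => i; rewrite /= mxE in_itv /= lerN10 ler01.
have [v vK hv] := EVT_max_rV K0 cK cFq.
exists `|F (q v)| => p; have S := sphere p.
have -> : f p = F (q (\row_i nth 0 [:: qr p; qi p; qj p; qk p] i)).
  by rewrite fF val_quat ReIm_quat /q !mxE.
apply: hv; rewrite inE => i; rewrite /= mxE in_itv /=.
case: i => [[|[|[|[|//]]]] ?] /=; apply/andP; split; nra.
Qed.

Lemma bLip_euler (f : SU2 R -> R) : smooth f -> bLip (fun x y z => f (euler x y z)).
Proof.
move=> sf; have [B hB] := smooth_bounded sf.
have [B1 hB1] := smooth_bounded (smooth_D1 sf).
have [B2 hB2] := smooth_bounded (smooth_D2 sf).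
have [B3 hB3] := smooth_bounded (smooth_D3 sf).
have B0 : 0 <= B by apply: le_trans (hB (euler 0 0 0)).
have B10 : 0 <= B1 by apply: le_trans (hB1 (euler 0 0 0)).
have B20 : 0 <= B2 by apply: le_trans (hB2 (euler 0 0 0)).
have B30 : 0 <= B3 by apply: le_trans (hB3 (euler 0 0 0)).
pose C := B1 + B2 + B3.
have tC (t1 t2 t3 : R) p : `|t1| <= 1 -> `|t2| <= 1 -> `|t3| <= 1 ->
    `|t1 * D1 f p + t2 * D2 f p + t3 * D3 f p| <= C.
  move=> h1 h2 h3; rewrite !(le_trans (ler_normD _ _)) // lerD //.
    rewrite !(le_trans (ler_normD _ _)) // lerD // normrM -[leRHS]mul1r ler_pM //.
  by rewrite normrM -[leRHS]mul1r ler_pM.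
have cos1 (s : R) : `|cos s| <= 1 by rewrite ler_norml cos_geN1 cos_le1.
have sin1 (s : R) : `|sin s| <= 1 by rewrite ler_norml sin_geN1 sin_le1.
exists (B + C) => x y z; split=> [|x' y' z'].
  by rewrite (le_trans (hB _)) // lerDl !addr_ge0.
rewrite (@le_trans _ _ (C * (`|x - x'| + `|y - y'| + `|z - z'|))) //; last first.
  by rewrite ler_wpM2r ?lerDr // !addr_ge0.
rewrite (_ : _ - _ = (f (euler x y z) - f (euler x' y z)) +
  (f (euler x' y z) - f (euler x' y' z)) +
  (f (euler x' y' z) - f (euler x' y' z'))); last by ring.
rewrite (le_trans (ler_normD _ _)) // mulrDr lerD //.
  rewrite (le_trans (ler_normD _ _)) // mulrDr lerD //.
    apply: (derive_bound_lipschitz (f := fun s => f (euler s y z))) => s.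
      by apply: is_derive_curve => //; exact: euler_derive1.
    by apply: tC => //; rewrite normrM -[leRHS]mul1r ler_pM.
  apply: (derive_bound_lipschitz (f := fun s => f (euler x' s z))) => s.
    by apply: is_derive_curve => //; exact: euler_derive2.
  by apply: tC => //; rewrite ?normrN ?normr0.
apply: (derive_bound_lipschitz (f := fun s => f (euler x' y' s))) => s.
  by apply: is_derive_curve => //; exact: euler_derive3.
by apply: tC => //; rewrite ?normr1 ?normr0.
Qed.

End Euler.
(** * An invariant mean on SU(2) *)

Section Mean.
Variable R : realType.
Implicit Types f g h : SU2 R -> R.

Definition bounded_fct g := exists B, forall p, `|g p| <= B.

(** The Haar measure is sin (2 y) dx dy dz up to a constant. *)
Definition haar_sum g n := rsum n (fun x y z => sin (2 * y) * g (euler x y z)).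

Definition mean g := ulim (haar_sum g).

Lemma sin_norm (x : R) : `|sin x| <= 1.
Proof. by rewrite ler_norml sin_geN1 sin_le1. Qed.

Lemma haar_sum_bounded g : bounded_fct g -> bounded_seq (haar_sum g).
Proof.
move=> [B hB]; exists B => n; apply: rsum_bound => x y z.
by rewrite normrM -[leRHS]mul1r ler_pM // sin_norm.
Qed.

Lemma bounded_fctD f g : bounded_fct f -> bounded_fct g ->
  bounded_fct (fun p => f p + g p).
Proof.
move=> [B hB] [C hC]; exists (B + C) => p.
by rewrite (le_trans (ler_normD _ _)) // lerD.
Qed.

Lemma bounded_fctM f g : bounded_fct f -> bounded_fct g ->
  bounded_fct (fun p => f p * g p).
Proof. by move=> [B hB] [C hC]; exists (B * C) => p; rewrite normrM ler_pM. Qed.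

Lemma meanD f g : bounded_fct f -> bounded_fct g ->
  mean (fun p => f p + g p) = mean f + mean g.
Proof.
move=> bf bg; rewrite /mean -ulimD; [|exact: haar_sum_bounded..].
congr ulim; apply/funext => n; rewrite /haar_sum -rsumD; congr rsum.
by do 3![apply/funext => ?]; rewrite mulrDr.
Qed.

Lemma meanZ r f : bounded_fct f -> mean (fun p => r * f p) = r * mean f.
Proof.
move=> bf; rewrite /mean -ulimZ; last exact: haar_sum_bounded.
congr ulim; apply/funext => n; rewrite /haar_sum -rsumZ; congr rsum.
by do 3![apply/funext => ?]; rewrite mulrCA.
Qed.

Lemma bLip_cos2y : bLip (fun x y z : R => cos (2 * y)).
Proof.
have := bLip_cos 0 2 0 (0 : R); congr bLip; do 3![apply/funext => ?].
by congr cos; ring.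
Qed.

Lemma bLip_sin2y : bLip (fun x y z : R => sin (2 * y)).
Proof.
have := bLip_sin 0 2 0 (0 : R); congr bLip; do 3![apply/funext => ?].
by congr sin; ring.
Qed.

Lemma bLip_cos2z t : bLip (fun x y z : R => cos (2 * z + t)).
Proof.
have := bLip_cos 0 0 2 (t : R); congr bLip; do 3![apply/funext => ?].
by congr cos; ring.
Qed.

Lemma bLip_sin2z t : bLip (fun x y z : R => sin (2 * z + t)).
Proof.
have := bLip_sin 0 0 2 (t : R); congr bLip; do 3![apply/funext => ?].
by congr sin; ring.
Qed.

Lemma sin2start_per t : sin (2 * (start R + period R) + t) = sin (2 * start R + t).
Proof.
rewrite (_ : 2 * (start R + period R) + t =
  2 * start R + t + pi *+ 2 + pi *+ 2 + pi *+ 2 + pi *+ 2); last first.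
  by rewrite /period; ring.
by rewrite !sinD2pi.
Qed.

Lemma bLip_cos2z0 : bLip (fun x y z : R => cos (2 * z)).
Proof. by have := bLip_cos2z 0; congr bLip; do 3![apply/funext => ?]; rewrite addr0. Qed.

Lemma bLip_sin2z0 : bLip (fun x y z : R => sin (2 * z)).
Proof. by have := bLip_sin2z 0; congr bLip; do 3![apply/funext => ?]; rewrite addr0. Qed.

Ltac bLip_tac := do ?[exact: bLip_cos2y | exact: bLip_cos2z0 | exact: bLip_sin2z0 | exact: bLip_sin2y | exact: bLip_cos2z |
  exact: bLip_sin2z | exact: bLip_cst | apply: bLip_euler; smooth_tac |
  apply: bLipD | apply: bLipN | apply: bLipM].

Lemma haar_sum_D1 h : smooth h -> haar_sum (D1 h) @ \oo --> 0.
Proof.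
move=> sh; have d3 x y z : is_derive z (1 : R) (fun s => sin (2 * y) * h (euler x y s))
    (sin (2 * y) * D1 h (euler x y z)).
  apply: (is_derive_ext (is_deriveZ (sin (2 * y))
    (is_derive_curve sh (euler_derive3 x y z)))) => //.
  by rewrite !mul0r !addr0 mul1r.
refine (rsum_derive3 _ d3 _); first by bLip_tac.
by move=> x y; rewrite euler_periodic3.
Qed.

(** Inverting the formulas for the velocities of the Euler angles, the field
   cos t X_2 + sin t X_3 weighted by sin (2 y) is the divergence
   d/dy (sin (2 y) C h) + d/dx (S h) - d/dz (cos (2 y) S h) with
   C = cos (2 z + t) and S = sin (2 z + t).  Boundary terms cancel by periodicity
   in x and z, and since sin (2 y) vanishes at both ends of [0, pi / 2]. *)
Lemma haar_sum_D23 t h : smooth h ->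
  haar_sum (fun p => cos t * D2 h p + sin t * D3 h p) @ \oo --> 0.
Proof.
move=> sh.
pose C z := cos (2 * z + t); pose S z := sin (2 * z + t).
have dC z : is_derive z (1 : R) C (- (2 * S z)) by exact: is_derive_cos_lin.
have dS z : is_derive z (1 : R) S (2 * C z) by exact: is_derive_sin_lin.
have dsin y : is_derive y (1 : R) (fun s => sin (2 * s)) (2 * cos (2 * y)).
  by apply: (is_derive_ext (is_derive_sin_lin 2 0 y)) => [s|]; rewrite addr0.
pose H := fun x y z => h (euler x y z).
have H1 x y z := is_derive_curve sh (euler_derive1 x y z).
have H2 x y z := is_derive_curve sh (euler_derive2 x y z).
have H3 x y z := is_derive_curve sh (euler_derive3 x y z).
pose G1 x y z := S z * (cos (2 * y) * D1 h (euler x y z) +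
  sin (2 * y) * sin (2 * z) * D2 h (euler x y z) +
  sin (2 * y) * cos (2 * z) * D3 h (euler x y z)).
pose G2 x y z := C z * (sin (2 * y) * (cos (2 * z) * D2 h (euler x y z) +
  - sin (2 * z) * D3 h (euler x y z)) + H x y z * (2 * cos (2 * y))).
pose G3 x y z := cos (2 * y) * (S z * D1 h (euler x y z) + H x y z * (2 * C z)).
have cv1 : (fun n => rsum n G1) @ \oo --> 0.
  have d1 x y z : is_derive x (1 : R) (fun s => S z * H s y z) (G1 x y z).
    exact: (is_deriveZ (S z) (H1 x y z)).
  refine (rsum_derive1 _ d1 _); first by rewrite /G1 /S; bLip_tac.
  by move=> y z; rewrite /H euler_periodic1.
have cv2 : (fun n => rsum n G2) @ \oo --> 0.
  have d2 x y z : is_derive y (1 : R) (fun s => C z * (sin (2 * s) * H x s z)) (G2 x y z).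
    apply: (is_derive_ext (is_deriveZ (C z) (is_deriveM (dsin y) (H2 x y z)))) => //.
    by rewrite /G2 mul0r add0r.
  refine (rsum_derive2 _ d2 _); first by rewrite /G2 /C /H; bLip_tac.
  move=> x z; rewrite add0r mulr0 sin0 (_ : 2 * (pi / 2) = pi) ?sinpi ?mul0r //.
  by field.
have cv3 : (fun n => rsum n G3) @ \oo --> 0.
  have d3 x y z : is_derive z (1 : R) (fun s => cos (2 * y) * (S s * H x y s)) (G3 x y z).
    apply: (is_derive_ext (is_deriveZ (cos (2 * y)) (is_deriveM (dS z) (H3 x y z)))) => //.
    by rewrite /G3 !mul0r !addr0 mul1r.
  refine (rsum_derive3 _ d3 _); first by rewrite /G3 /C /S /H; bLip_tac.
  by move=> x y; rewrite /H euler_periodic3 /S sin2start_per.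
have -> : haar_sum (fun p => cos t * D2 h p + sin t * D3 h p) =
    fun n => rsum n G2 + rsum n G1 + -1 * rsum n G3.
  apply/funext => n; rewrite -rsumD -rsumZ -rsumD /haar_sum; congr rsum.
  apply/funext => x; apply/funext => y; apply/funext => z.
  have ct : cos t = C z * cos (2 * z) + S z * sin (2 * z).
    by rewrite /C /S -cosB; congr cos; ring.
  have st : sin t = S z * cos (2 * z) - C z * sin (2 * z).
    by rewrite /C /S -sinB; congr sin; ring.
  by rewrite ct st /G1 /G2 /G3; ring.
rewrite -[X in _ --> X](_ : 0 + 0 + -1 * 0 = 0); last by rewrite mulr0 !addr0.
by apply: cvgD; [exact: cvgD|apply: cvgM; [exact: cvg_cst|]].
Qed.

Lemma mean_D1 h : smooth h -> mean (D1 h) = 0.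
Proof. by move=> sh; apply: ulim_eq; exact: haar_sum_D1. Qed.

Lemma mean_D2 h : smooth h -> mean (D2 h) = 0.
Proof.
move=> sh; apply: ulim_eq; have := haar_sum_D23 0 sh.
by rewrite cos0 sin0 (_ : (fun p => _) = D2 h) //; apply/funext => p; ring.
Qed.

Lemma mean_D3 h : smooth h -> mean (D3 h) = 0.
Proof.
move=> sh; apply: ulim_eq; have := haar_sum_D23 (pi / 2) sh.
by rewrite cos_pihalf sin_pihalf (_ : (fun p => _) = D3 h) //; apply/funext => p; ring.
Qed.

(** ** Strict positivity *)

(** A subinterval of length d contains at least d N / T - 1 of the N nodes, numbered m to
   m + K - 1 below, where m is the first index beyond l. *)
Lemma node_count (s T l d : R) : 0 < T -> s <= l -> 0 < d -> l + d < s + T ->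
  exists2 c, 0 < c & \forall n \near \oo,
    c * n.+1%:R <= \sum_(i < n.+1) ((l <= node n s T i <= l + d)%R%:R : R).
Proof.
move=> T0 sl d0 ldT; exists (d / (2 * T)); first by rewrite divr_gt0 // mulr_gt0.
exists (Num.truncn (2 * T / d)).+1 => // n /= hn.
pose N : R := n.+1%:R; pose h := T / N.
have N0 : 0 < N by rewrite ltr0n.
have h0 : 0 < h by rewrite divr_gt0.
have TN : T = N * h by rewrite /h; field; rewrite gt_eqF.
pose m := (Num.truncn ((l - s) / h)).+1; pose K := Num.truncn (d / h).
have m1 : l - s <= m%:R * h.
  by rewrite -ler_pdivrMr // ltW // truncnS_gt.
have m2 : (m%:R - 1) * h <= l - s.
  rewrite -ler_pdivlMr // -natr1 addrK truncn_le // divr_ge0 ?subr_ge0 //; exact: ltW.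
have K1 : K%:R * h <= d.
  by rewrite -ler_pdivlMr // truncn_le // divr_ge0 // ltW.
have K2 : d / h <= K%:R + 1 by rewrite ltW // natr1 truncnS_gt.
have mK : (m + K <= n.+1)%N.
  rewrite -ltnS -(ltr_nat R) -(ltr_pM2r h0) natrD -natr1 -/N mulrDl mulrDl mul1r -TN.
  by move: m2; rewrite mulrBl mul1r; lra.
have dK : d / (2 * T) * N <= K%:R.
  have hT : 2 * T / d <= N.
    apply: ltW; apply: lt_le_trans (truncnS_gt _) _; rewrite ler_nat; exact: leqW.
  have E : d / h = 2 * (d / (2 * T) * N).
    by rewrite /h; field; rewrite !gt_eqF.
  have : 1 <= d / (2 * T) * N.
    rewrite mulrAC ler_pdivlMr ?mulr_gt0 // mul1r.
    by rewrite -ler_pdivrMl // mulrC.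
  by move: K2; rewrite E; lra.
apply: le_trans dK _.
rewrite -(big_mkord xpredT (fun i => (l <= node n s T i <= l + d)%R%:R : R)).
rewrite (big_cat_nat (n := m)) //=; last exact: leq_trans (leq_addr _ _) mK.
rewrite (big_cat_nat (m := m) (n := (m + K)%N)) ?leq_addr //=.
rewrite addrCA -[leLHS]addr0 lerD //; last by rewrite addr_ge0 // sumr_ge0.
rewrite (_ : K%:R = \sum_(m <= i < m + K) 1); last first.
  by rewrite sumr_const_nat addKn.
rewrite !big_nat; apply: ler_sum => i /andP[mi imK].
rewrite (_ : (_ <= _ <= _) = true) // /node -/N -/h; apply/andP; split.
  have : m%:R * h <= i%:R * h by rewrite ler_pM2r // ler_nat.
  by move: m1; lra.
have : i%:R * h <= (m%:R + K%:R - 1) * h.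
  by rewrite ler_pM2r // lerBrDr natr1 -natrD ler_nat.
by move: m2 K1; rewrite !mulrBl mulrDl mul1r; lra.
Qed.


End Mean.
Section StrictPositivity.
Variable R : realType.

(** The sign of v decides between acos and its opposite. *)
Lemma polar (u v r : R) : 0 <= r -> u ^+ 2 + v ^+ 2 = r ^+ 2 ->
  exists2 A, - pi <= A <= pi & u = r * cos A /\ v = r * sin A.
Proof.
move=> r0 uv; have [r00|rn0] := eqVneq r 0.
  exists 0; first by rewrite oppr_le0 pi_ge0.
  by move: uv; rewrite r00 => uv; rewrite !mul0r; split; nra.
have rp : 0 < r by rewrite lt_neqAle eq_sym rn0.
have h : (u / r) ^+ 2 + (v / r) ^+ 2 = 1.
  by rewrite !expr_div_n -mulrDl uv divff // expf_neq0.
have u1 : -1 <= u / r <= 1 by apply/andP; split; nra.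
have S : sin (acos (u / r)) = `|v / r|.
  by rewrite sin_acos // -sqrtr_sqr; congr Num.sqrt; rewrite -h; ring.
have C : cos (acos (u / r)) = u / r by apply: acosK; rewrite in_itv.
have [A0 Api] := (acos_ge0 u1, acos_lepi u1); have p0 := @pi_ge0 R.
have [v0|v0] := leP 0 (v / r).
  exists (acos (u / r)); first by rewrite Api andbT; lra.
  by rewrite S C ger0_norm //; split; field.
exists (- acos (u / r)); first by apply/andP; split; lra.
by rewrite cosN sinN S C ltr0_norm //; split; field.
Qed.

Lemma euler_surj (p : SU2 R) : exists x y z,
  [/\ - pi <= x <= pi, 0 <= y <= pi / 2, - pi <= z <= pi & euler x y z = p].
Proof.
have S := sphere p.
pose r := Num.sqrt (qr p ^+ 2 + qi p ^+ 2).
pose t := Num.sqrt (qj p ^+ 2 + qk p ^+ 2).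
have r2 : qr p ^+ 2 + qi p ^+ 2 = r ^+ 2 by rewrite sqr_sqrtr // addr_ge0 ?sqr_ge0.
have t2 : qj p ^+ 2 + qk p ^+ 2 = t ^+ 2 by rewrite sqr_sqrtr // addr_ge0 ?sqr_ge0.
have r0 : 0 <= r by exact: sqrtr_ge0.
have t0 : 0 <= t by exact: sqrtr_ge0.
have rt : r ^+ 2 + t ^+ 2 = 1 by rewrite -r2 -t2 addrA.
have [A /andP[A1 A2] [a0 a1]] := polar r0 r2.
have [B /andP[B1 B2] [b2 b3]] := polar t0 t2.
have r1 : -1 <= r <= 1 by apply/andP; split; nra.
have C : cos (acos r) = r by apply: acosK; rewrite in_itv.
have T : sin (acos r) = t.
  by rewrite sin_acos // (_ : 1 - r ^+ 2 = t ^+ 2) ?sqrtr_sqr ?ger0_norm // -rt; ring.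
exists ((A + B) / 2), (acos r), ((A - B) / 2); split.
- by apply/andP; split; lra.
- rewrite acos_ge0 //= leNgt; apply/negP => h.
  have p0 := @pi_ge0 R.
  have : cos (acos r) < cos (pi / 2).
    by rewrite ltr_cos // in_itv /= ?acos_ge0 ?acos_lepi //; apply/andP; split; lra.
  by rewrite C cos_pihalf ltNge r0.
- by apply/andP; split; lra.
have [e0 e1 e2 e3] := euler_X ((A + B) / 2) (acos r) ((A - B) / 2).
have Ae : (A + B) / 2 + (A - B) / 2 = A by field.
have Be : (A + B) / 2 - (A - B) / 2 = B by field.
by apply: SU2_eq; rewrite ?e0 ?e1 ?e2 ?e3 ?Ae ?Be ?C ?T.
Qed.

Lemma sin_lower (w u : R) : 0 < w -> w <= u <= pi - w -> sin w <= sin u.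
Proof.
move=> w0 /andP[wu uw]; rewrite -!cosBpihalf leNgt; apply/negP.
rewrite -(cos_norm (u - _)) -(cosN (w - _)) opprB.
have p0 := @pi_gt0 R.
have n0 := normr_ge0 (u - pi / 2).
have un : `|u - pi / 2| <= pi / 2 - w by rewrite ler_norml; apply/andP; split; lra.
rewrite ltr_cos ?in_itv /=; [by rewrite ltNge un| |].
  by apply/andP; split; lra.
by apply/andP; split; lra.
Qed.

Lemma sin2_ge0 (y : R) : 0 <= y <= pi / 2 -> 0 <= sin (2 * y).
Proof. by move=> /andP[y0 y1]; apply: sin_ge0_pi; apply/andP; split; lra. Qed.

Definition near_pt (p0 : SU2 R) (r : R) (p : SU2 R) :=
  [/\ `|qr p - qr p0| < r, `|qi p - qi p0| < r, `|qj p - qj p0| < r & `|qk p - qk p0| < r].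

Lemma euler_near (x0 y0 z0 r : R) : 0 < r -> exists2 d, 0 < d & forall x y z,
  `|x - x0| <= d -> `|y - y0| <= d -> `|z - z0| <= d ->
  near_pt (euler x0 y0 z0) r (euler x y z).
Proof.
move=> r0.
have L f : smooth f -> exists2 d, 0 < d & forall x y z,
    `|x - x0| <= d -> `|y - y0| <= d -> `|z - z0| <= d ->
    `|f (euler x y z) - f (euler x0 y0 z0)| < r.
  move=> sf; have [B hB] := bLip_euler sf.
  have B0 : 0 <= B by have [+ _] := hB 0 0 0; apply: le_trans.
  have B1 : 0 < 3 * B + 1 by lra.
  exists (r / (3 * B + 1)); first by rewrite divr_gt0.
  move=> x y z hx hy hz; have [_ h] := hB x y z; apply: le_lt_trans (h _ _ _) _.
  apply: (@le_lt_trans _ _ (B * (3 * (r / (3 * B + 1))))).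
    by rewrite ler_wpM2l //; lra.
  rewrite (_ : B * _ = (3 * B * r) / (3 * B + 1)); last by field; rewrite gt_eqF.
  by rewrite ltr_pdivrMr //; nra.
have [d0 d00 h0] := L _ (@smooth_qr R); have [d1 d10 h1] := L _ (@smooth_qi R).
have [d2 d20 h2] := L _ (@smooth_qj R); have [d3 d30 h3] := L _ (@smooth_qk R).
exists (Num.min (Num.min d0 d1) (Num.min d2 d3)); first by rewrite !lt_min d00 d10 d20.
by move=> x y z; rewrite !le_min => /andP[/andP[? ?] /andP[? ?]] /andP[/andP[? ?] /andP[? ?]]
  /andP[/andP[? ?] /andP[? ?]]; split; [exact: h0|exact: h1|exact: h2|exact: h3].
Qed.

Lemma node_quarter n j : (j < n.+1)%N -> 0 <= @node R n 0 (pi / 2) j <= pi / 2.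
Proof.
move=> jn; have p0 : 0 <= pi / 2 :> R by rewrite divr_ge0 ?pi_ge0.
rewrite /node add0r mulr_ge0 ?divr_ge0 ?pi_ge0 //=.
rewrite mulrCA -[leRHS]mulr1 ler_wpM2l //.
by rewrite ler_pdivrMr // mul1r ler_nat ltnW.
Qed.

(** A subinterval of [0, pi / 2] within d of y0 and away from both ends, where
   the weight sin (2 y) would vanish. *)
Lemma subinterval (y0 d : R) : 0 <= y0 <= pi / 2 -> 0 < d <= 1 / 4 ->
  exists l, [/\ d / 4 <= l, l + d / 4 <= pi / 2 - d / 4, y0 - d <= l &
    l + d / 4 <= y0 + d].
Proof.
move=> /andP[y1 y2] /andP[d1 d2]; have p2 := @pi_ge2 R.
have [h|h] := leP y0 (1 / 2); first by exists (y0 + d / 4); split; lra.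
by exists (y0 - d / 2); split; lra.
Qed.

Lemma sin2_lower (l d y : R) : 0 < d -> d / 4 <= l -> l + d / 4 <= pi / 2 - d / 4 ->
  l <= y <= l + d / 4 -> sin (d / 2) <= sin (2 * y).
Proof.
move=> d0 l1 l2 /andP[h1 h2]; apply: sin_lower; first by lra.
by apply/andP; split; lra.
Qed.

Lemma near_interval (x x0 l e d : R) : x0 - d <= l -> l + e <= x0 + d ->
  l <= x <= l + e -> `|x - x0| <= d.
Proof. by move=> l1 l2 /andP[h1 h2]; rewrite ler_norml; apply/andP; split; lra. Qed.

Lemma in_period (x d : R) : - pi <= x <= pi -> 0 < d <= 1 / 4 ->
  start R <= x /\ x + d < start R + period R.
Proof.
move=> /andP[x1 x2] /andP[d0 d1]; have := @pi_ge2 R.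
by rewrite /start /period => p2; split; lra.
Qed.

(** Some box of Euler angles is mapped into the neighbourhood of p0; it contains a
   fixed proportion of the nodes, and the density is bounded below on it. *)
Lemma mean_gt0 (g : SU2 R -> R) (p0 : SU2 R) (r e : R) : bounded_fct g ->
  (forall p, 0 <= g p) -> 0 < r -> 0 < e -> (forall p, near_pt p0 r p -> e <= g p) ->
  0 < mean g.
Proof.
move=> bg g0 r0 e0 hg.
have [x0 [y0 [z0 [hx0 hy0 hz0 E]]]] := euler_surj p0.
have [d0 d00 hd0] := euler_near x0 y0 z0 r0; rewrite E in hd0.
pose d := Num.min d0 (1 / 4).
have dd0 : d <= d0 by rewrite ge_min lexx.
have d4 : 0 < d <= 1 / 4.
  by rewrite ge_min lexx orbT andbT lt_min d00 divr_gt0.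
have dp : 0 < d by case/andP: d4.
have [l [l1 l2 l3 l4]] := subinterval hy0 d4.
have hd x y z : x0 <= x <= x0 + d -> l <= y <= l + d / 4 -> z0 <= z <= z0 + d ->
    e <= g (euler x y z).
  move=> h1 h2 h3; apply: hg; apply: hd0; apply: le_trans dd0.
  - by apply: near_interval h1; rewrite // lerBlDr lerDl ltW.
  - exact: near_interval h2.
  - by apply: near_interval h3; rewrite // lerBlDr lerDl ltW.
have s0 : 0 < sin (d / 2).
  apply: sin_gt0_pi; rewrite divr_gt0 //=.
  have /andP[_ h] := d4; have := @pi_ge2 R; clear -h; lra.
have hs y := @sin2_lower l d y dp l1 l2.
have [c1 c10 n1] : exists2 c, 0 < c & \forall n \near \oo, c * n.+1%:R <=
    \sum_(i < n.+1) ((x0 <= node n (start R) (period R) i <= x0 + d)%R%:R : R).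
  by have [? ?] := in_period hx0 d4; exact: node_count (period_gt0 R) _ _ _.
have [c2 c20 n2] : exists2 c, 0 < c & \forall n \near \oo, c * n.+1%:R <=
    \sum_(i < n.+1) ((l <= node n 0 (pi / 2) i <= l + d / 4)%R%:R : R).
  have d40 : 0 < d / 4 by rewrite divr_gt0.
  apply: node_count => //; first by rewrite divr_gt0 ?pi_gt0.
    exact: le_trans (ltW d40) l1.
  by rewrite add0r (le_lt_trans l2) // ltrBlDr ltrDl.
have [c3 c30 n3] : exists2 c, 0 < c & \forall n \near \oo, c * n.+1%:R <=
    \sum_(i < n.+1) ((z0 <= node n (start R) (period R) i <= z0 + d)%R%:R : R).
  by have [? ?] := in_period hz0 d4; exact: node_count (period_gt0 R) _ _ _.
apply: (@lt_le_trans _ _ (sin (d / 2) * e * (c1 * c2 * c3))).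
  by rewrite !mulr_gt0.
apply: ulim_ge; first exact: haar_sum_bounded.
near=> n.
have N0 : 0 < n.+1%:R :> R by rewrite ltr0n.
have m1 := near n1 n; have m2 := near n2 n; have m3 := near n3 n.
apply: (@le_trans _ _ (rsum n (fun x y z => sin (d / 2) * e *
    ((x0 <= x <= x0 + d)%R%:R * (l <= y <= l + d / 4)%R%:R * (z0 <= z <= z0 + d)%R%:R)))).
  rewrite rsumZ ler_pM2l ?mulr_gt0 // /rsum.
  set a1 := \sum_(i < _) _ in m1; set a2 := \sum_(i < _) _ in m2.
  set a3 := \sum_(i < _) _ in m3.
  rewrite (_ : \sum_(i < _) _ = a1 * a2 * a3); last first.
    rewrite /a1 /a2 /a3 -mulrA mulr_suml; apply: eq_bigr => i _.
    rewrite mulr_suml mulr_sumr; apply: eq_bigr => j _.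
    by rewrite !mulr_sumr; apply: eq_bigr => k _; rewrite mulrA.
  rewrite ler_pdivlMl ?exprn_gt0 //.
  rewrite [leLHS](_ : _ = (c1 * n.+1%:R) * (c2 * n.+1%:R) * (c3 * n.+1%:R)); last by ring.
  have [k1 k2 k3] := And3 (ltW c10) (ltW c20) (ltW c30).
  have nn : 0 <= n.+1%:R :> R by exact: ltW.
  by rewrite !ler_pM ?mulr_ge0 //; [exact: m1|exact: m2|exact: m3].
apply: rsum_le => i j k iN jN kN.
set x := node _ _ _ i; set y := node _ _ _ j; set z := node _ _ _ k.
have sy : 0 <= sin (2 * y) by apply: sin2_ge0; exact: node_quarter.
case: (boolP (x0 <= x <= x0 + d)) => [hx|_]; last first.
  by rewrite !mul0r mulr0 mulr_ge0.
case: (boolP (l <= y <= l + d / 4)) => [hy|_]; last first.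
  by rewrite mulr0 mul0r mulr0 mulr_ge0.
case: (boolP (z0 <= z <= z0 + d)) => [hz|_]; last first.
  by rewrite !mulr0 mulr_ge0.
by rewrite !mulr1 ler_pM ?hs ?hd // ltW.
Unshelve. all: by end_near.
Qed.

End StrictPositivity.
(** * Orthogonality with respect to the mean *)

Section Orthogonality.
Variable R : realType.
Implicit Types f g h : SU2 R -> R.

Lemma smooth_bdd f : smooth f -> bounded_fct f.
Proof. exact: smooth_bounded. Qed.

Lemma mean_ge0 g : bounded_fct g -> (forall p, 0 <= g p) -> 0 <= mean g.
Proof.
move=> bg g0; apply: ulim_ge; first exact: haar_sum_bounded.
apply: nearW => n; apply: (@le_trans _ _ (rsum n (fun _ _ _ => 0 * 0 : R))).
  by rewrite rsumZ mul0r.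
by apply: rsum_le => i j k iN jN kN; rewrite mul0r mulr_ge0 // sin2_ge0 // node_quarter.
Qed.

Lemma bounded_fctZ r f : bounded_fct f -> bounded_fct (fun p => r * f p).
Proof. by move=> bf; apply: bounded_fctM => //; exists `|r|. Qed.

Lemma meanN f : bounded_fct f -> mean (fun p => - f p) = - mean f.
Proof.
move=> bf; rewrite -mulN1r -meanZ //; congr mean; apply/funext => p.
by rewrite mulN1r.
Qed.

Lemma bounded_fctN f : bounded_fct f -> bounded_fct (fun p => - f p).
Proof. by move=> [B hB]; exists B => p; rewrite normrN. Qed.

Lemma meanB f g : bounded_fct f -> bounded_fct g ->
  mean (fun p => f p - g p) = mean f - mean g.
Proof. by move=> bf bg; rewrite meanD ?meanN //; exact: bounded_fctN. Qed.

Lemma mean_le f g : bounded_fct f -> bounded_fct g -> (forall p, f p <= g p) ->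
  mean f <= mean g.
Proof.
move=> bf bg fg; rewrite -subr_ge0 -meanB //; apply: mean_ge0.
  by apply: bounded_fctD => //; exact: bounded_fctN.
by move=> p; rewrite subr_ge0.
Qed.

Lemma mean_sum n (f : 'I_n -> SU2 R -> R) : (forall i, smooth (f i)) ->
  mean (fun p => \sum_(i < n) f i p) = \sum_(i < n) mean (f i).
Proof.
elim: n f => [|n IH] f sf.
  rewrite big_ord0 -[RHS](mul0r (mean (fun=> 0))) -meanZ; last first.
    by exists 0 => _; rewrite normr0.
  by congr mean; apply/funext => p; rewrite big_ord0 mul0r.
rewrite big_ord_recr /= -IH // -meanD.
- by congr mean; apply/funext => p; rewrite big_ord_recr.
- by apply: smooth_bdd; exact: smooth_sum.
- exact: smooth_bdd.
Qed.

Lemma smooth_near f p0 e : smooth f -> 0 < e ->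
  exists2 r, 0 < r & forall p, near_pt p0 r p -> `|f p - f p0| < e.
Proof.
move=> [F cF fF] e0.
have /cvgrPdist_lt/(_ _ e0) := cF 0%N (ReIm (val p0)).
move=> /nbhs_ballP[d /= d0 hd].
pose K : R := `|ReIm (quat 1 0 0 0 : 'M[R[i]]_2)| + `|ReIm (quat 0 1 0 0 : 'M[R[i]]_2)| +
  (`|ReIm (quat 0 0 1 0 : 'M[R[i]]_2)| + `|ReIm (quat 0 0 0 1 : 'M[R[i]]_2)|).
have K0 : 0 <= K by rewrite !addr_ge0.
exists (d / (K + 1)); first by rewrite divr_gt0 // ltr_wpDl.
move=> p [h0 h1 h2 h3]; rewrite !fF distrC; apply: hd.
rewrite -ball_normE /=.
have -> : ReIm (val p0) - ReIm (val p) = ReIm (quat (qr p0 - qr p) (qi p0 - qi p)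
    (qj p0 - qj p) (qk p0 - qk p)).
  rewrite !val_quat; apply: injective_projections; apply: mx22P; rewrite /= !mxE /=; ring.
rewrite ReIm_quat.
apply: (@le_lt_trans _ _ (d / (K + 1) * K)); last first.
  rewrite mulrAC ltr_pdivrMr ?ltr_wpDl // ltr_pM2l //; lra.
have L (x y : R) (v : MM R) : `|x - y| < d / (K + 1) -> `|(y - x) *: v| <= d / (K + 1) * `|v|.
  by move=> h; rewrite normrZ ler_wpM2r // distrC ltW.
rewrite /K !mulrDr (le_trans (ler_normD _ _)) // lerD //.
  by rewrite (le_trans (ler_normD _ _)) // lerD // L.
by rewrite (le_trans (ler_normD _ _)) // lerD // L.
Qed.

Lemma mean_square_eq0 f : smooth f -> mean (fun p => f p * f p) = 0 ->
  forall p, f p = 0.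
Proof.
move=> sf mf p; apply: contrapT => /eqP fp.
have e0 : 0 < `|f p| / 2 by rewrite divr_gt0 // normr_gt0.
have [r r0 hr] := smooth_near p sf e0.
suff : 0 < mean (fun p => f p * f p) by rewrite mf ltxx.
apply: (@mean_gt0 _ _ p r ((`|f p| / 2) ^+ 2)) => //.
- by apply: smooth_bdd; smooth_tac.
- by move=> q; rewrite -expr2 sqr_ge0.
- by rewrite exprn_gt0.
move=> q /hr hq; rewrite -expr2 -(real_normK (num_real (f q))) ler_pXn2r ?nnegrE ?(ltW e0) //.
have := lerB_dist (f p) (f q); rewrite -normrN opprB in hq; lra.
Qed.

(** This is 1 - |p - p0|^2 / 4: it equals 1 at p0 and is smaller elsewhere, so its
   powers concentrate at p0. *)
Definition peak (p0 p : SU2 R) : R :=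
  (1 + (qr p0 * qr p + qi p0 * qi p + qj p0 * qj p + qk p0 * qk p)) / 2.

Lemma peakE p0 p : peak p0 p = 1 - ((qr p - qr p0) ^+ 2 + (qi p - qi p0) ^+ 2 +
   (qj p - qj p0) ^+ 2 + (qk p - qk p0) ^+ 2) / 4.
Proof.
rewrite (_ : _ + (qk p - qk p0) ^+ 2 = (qr p ^+ 2 + qi p ^+ 2 + qj p ^+ 2 + qk p ^+ 2) +
  (qr p0 ^+ 2 + qi p0 ^+ 2 + qj p0 ^+ 2 + qk p0 ^+ 2) -
  2 * (qr p0 * qr p + qi p0 * qi p + qj p0 * qj p + qk p0 * qk p)); last by ring.
by rewrite !sphere /peak; field.
Qed.

Lemma peak_ge0 p0 p : 0 <= peak p0 p.
Proof.
have S := sphere p; have S0 := sphere p0.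
rewrite /peak divr_ge0 //.
have : 0 <= (qr p + qr p0) ^+ 2 + (qi p + qi p0) ^+ 2 + (qj p + qj p0) ^+ 2 + (qk p + qk p0) ^+ 2.
  by rewrite !addr_ge0 ?sqr_ge0.
by move: S S0; lra.
Qed.

Lemma peak_far p0 p r : 0 < r -> ~ near_pt p0 r p -> peak p0 p <= 1 - r ^+ 2 / 4.
Proof.
move=> r0 nh; rewrite peakE lerD2l lerN2 ler_pM2r ?invr_gt0 //.
have sq (x : R) : ~~ (`|x| < r) -> r ^+ 2 <= x ^+ 2.
  by rewrite -leNgt -(real_normK (num_real x)) => h; rewrite ler_pXn2r ?nnegrE // ltW.
have nn (x : R) : 0 <= x ^+ 2 by exact: sqr_ge0.
rewrite leNgt; apply/negP => h; apply: nh.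
have n0 := nn (qr p - qr p0); have n1 := nn (qi p - qi p0).
have n2 := nn (qj p - qj p0); have n3 := nn (qk p - qk p0).
by split; apply: contraT => /sq; lra.
Qed.

Lemma peak_near p0 p r : near_pt p0 (r / 4) p -> 1 - r ^+ 2 / 16 <= peak p0 p.
Proof.
move=> [h0 h1 h2 h3]; rewrite peakE lerD2l lerN2.
have sq (x : R) : `|x| < r / 4 -> x ^+ 2 <= r ^+ 2 / 16.
  move=> h; rewrite -(real_normK (num_real x)) (_ : r ^+ 2 / 16 = (r / 4) ^+ 2); last by field.
  by rewrite ler_pXn2r ?nnegrE // ?(ltW h) // (le_trans _ (ltW h)).
have := sq _ h0; have := sq _ h1; have := sq _ h2; have := sq _ h3; lra.
Qed.

Lemma smooth_peak p0 : smooth (peak p0).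
Proof.
apply: (@smooth_ext _ _ (fun p => 2^-1 * (1 + (qr p0 * qr p + qi p0 * qi p +
  qj p0 * qj p + qk p0 * qk p)))); first by move=> p; rewrite mulrC.
by smooth_tac.
Qed.

(** If h p0 > 0, then h >= h p0 / 2 near p0.  On a smaller neighbourhood the peak
   function is at least q2, whereas it is at most q1 < q2 where h may be negative;
   so the contribution of order q2 ^+ n to the mean would win. *)
Lemma peak_orthogonal_le0 h p0 : smooth h ->
  (forall n, mean (fun p => h p * peak p0 p ^+ n) = 0) -> h p0 <= 0.
Proof.
move=> sh hm; rewrite leNgt; apply/negP => hp.
have e0 : 0 < h p0 / 2 by rewrite divr_gt0.
have [r' r'0 hr'] := smooth_near p0 sh e0.
pose r := Num.min r' 1.
have r0 : 0 < r by rewrite lt_min r'0 ltr01.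
have r1 : r <= 1 by rewrite ge_min lexx orbT.
have hr p : near_pt p0 r p -> h p0 / 2 <= h p.
  have rr : r <= r' by rewrite ge_min lexx.
  move=> [h0 h1 h2 h3]; have : near_pt p0 r' p by split; apply: lt_le_trans rr.
  by move=> /hr'; rewrite ltr_norml => /andP[]; lra.
pose q1 := 1 - r ^+ 2 / 4; pose q2 := 1 - r ^+ 2 / 16.
have r2 : 0 < r ^+ 2 by rewrite exprn_gt0.
have r21 : r ^+ 2 <= 1 by rewrite expr_le1 // ltW.
have q10 : 0 < q1 by rewrite /q1; lra.
have q12 : q1 < q2 by rewrite /q1 /q2; lra.
have q20 : 0 < q2 by exact: lt_trans q12.
pose w p : R := `[< near_pt p0 (r / 4) p >]%:R.
have bw : bounded_fct w.
  by exists 1 => p; rewrite /w; case: asbool; rewrite ?normr1 ?normr0.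
have mw : 0 < mean w.
  apply: (@mean_gt0 _ _ p0 (r / 4) 1) => //; first by rewrite divr_gt0.
  by move=> p hp1; rewrite /w asboolT.
have [B hB] := smooth_bdd sh.
have B0 : 0 <= B by apply: le_trans (hB p0).
have b1 : bounded_fct (fun _ : SU2 R => 1 : R) by exists 1 => _; rewrite normr1.
have m1 : 0 <= mean (fun _ : SU2 R => 1 : R) by apply: mean_ge0.
have key n : h p0 / 2 * mean w <= B * mean (fun _ : SU2 R => 1 : R) * (q1 / q2) ^+ n.
  have : mean (fun p => (h p0 / 2 * q2 ^+ n) * w p - (B * q1 ^+ n) * 1) <= 0.
    rewrite -(hm n); apply: mean_le.
    - apply: bounded_fctD; first exact: bounded_fctZ.
      by apply: bounded_fctN; exact: bounded_fctZ.
    - apply: smooth_bdd; apply: smoothM => //; apply: smoothX; exact: smooth_peak.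
    move=> p; have pk0 := peak_ge0 p0 p; rewrite mulr1.
    have Bq : 0 <= B * q1 ^+ n by rewrite mulr_ge0 // exprn_ge0 // ltW.
    have [hnear|hfar] := pselect (near_pt p0 r p).
      have hp2 := hr _ hnear; have h0 : 0 <= h p by apply: le_trans hp2; exact: ltW.
      rewrite /w; case: asboolP => [/peak_near hp1|_]; last first.
        rewrite mulr0 sub0r; apply: (@le_trans _ _ 0); first by rewrite oppr_le0.
        by rewrite mulr_ge0 // exprn_ge0.
      rewrite mulr1; apply: (@le_trans _ _ (h p0 / 2 * q2 ^+ n)); first by rewrite lerBlDr lerDl.
      apply: ler_pM => //; [exact: ltW|by rewrite exprn_ge0 // ltW|].
      by apply: lerXn2r; rewrite ?nnegrE //; exact: ltW.
    have -> : w p = 0.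
      rewrite /w asboolF // => -[h0 h1 h2 h3]; apply: hfar.
      have rr : r / 4 <= r by lra.
      by split; apply: lt_le_trans rr.
    rewrite mulr0 sub0r lerNl -mulNr.
    apply: (@le_trans _ _ (B * peak p0 p ^+ n)).
      rewrite ler_wpM2r ?exprn_ge0 //; have := hB p; rewrite ler_norml => /andP[]; lra.
    by rewrite ler_wpM2l //; apply: lerXn2r; rewrite ?nnegrE ?(ltW q10) //; exact: peak_far.
  rewrite meanB; [|exact: bounded_fctZ..]; rewrite !meanZ // subr_le0 => K.
  rewrite expr_div_n mulrA ler_pdivlMr ?exprn_gt0 //.
  by rewrite mulrAC [leRHS]mulrAC.
have cq : (fun n => B * mean (fun _ : SU2 R => 1 : R) * (q1 / q2) ^+ n) @ \oo --> 0.
  rewrite -[X in _ --> X](mulr0 (B * mean (fun _ : SU2 R => 1 : R))).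
  apply: cvgM; first exact: cvg_cst.
  apply: cvg_expr; rewrite ger0_norm ?ltr_pdivrMr ?mul1r //.
  by rewrite divr_ge0 // ltW.
have : h p0 / 2 * mean w <= 0 by apply: (cvgr_to_ge cq); exact: nearW.
rewrite leNgt => /negP; apply.
by rewrite mulr_gt0.
Qed.

Lemma peak_orthogonal h : smooth h ->
  (forall p0 n, mean (fun p => h p * peak p0 p ^+ n) = 0) -> forall p, h p = 0.
Proof.
move=> sh hm p; apply/eqP; rewrite eq_le (peak_orthogonal_le0 sh (hm p)) /= -oppr_le0.
apply: (@peak_orthogonal_le0 (fun q => - h q) p); first exact: smoothN.
move=> n; rewrite -[RHS]oppr0 -(hm p n) -meanN.
  by congr mean; apply/funext => q; rewrite mulNr.
apply: smooth_bdd; apply: smoothM => //; apply: smoothX; exact: smooth_peak.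
Qed.

End Orthogonality.
(** * Eigenspaces *)

Section Derivations.
Variable R : realType.
Implicit Types f g : SU2 R -> R.

Lemma D1_add f g : smooth f -> smooth g -> D1 (fun p => f p + g p) = (fun p => D1 f p + D1 g p).
Proof. by move=> sf sg; apply/funext => p; rewrite /D1 difD. Qed.
Lemma D2_add f g : smooth f -> smooth g -> D2 (fun p => f p + g p) = (fun p => D2 f p + D2 g p).
Proof. by move=> sf sg; apply/funext => p; rewrite /D2 difD. Qed.
Lemma D3_add f g : smooth f -> smooth g -> D3 (fun p => f p + g p) = (fun p => D3 f p + D3 g p).
Proof. by move=> sf sg; apply/funext => p; rewrite /D3 difD. Qed.

Lemma D1_mul f g : smooth f -> smooth g ->
  D1 (fun p => f p * g p) = (fun p => f p * D1 g p + g p * D1 f p).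
Proof. by move=> sf sg; apply/funext => p; rewrite /D1 difM. Qed.
Lemma D2_mul f g : smooth f -> smooth g ->
  D2 (fun p => f p * g p) = (fun p => f p * D2 g p + g p * D2 f p).
Proof. by move=> sf sg; apply/funext => p; rewrite /D2 difM. Qed.
Lemma D3_mul f g : smooth f -> smooth g ->
  D3 (fun p => f p * g p) = (fun p => f p * D3 g p + g p * D3 f p).
Proof. by move=> sf sg; apply/funext => p; rewrite /D3 difM. Qed.

Lemma D1_scale r f : smooth f -> D1 (fun p => r * f p) = (fun p => r * D1 f p).
Proof.
move=> sf; rewrite D1_mul //; last exact: smooth_cst.
by apply/funext => p; rewrite /D1 dif_cst mulr0 addr0.
Qed.
Lemma D2_scale r f : smooth f -> D2 (fun p => r * f p) = (fun p => r * D2 f p).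
Proof.
move=> sf; rewrite D2_mul //; last exact: smooth_cst.
by apply/funext => p; rewrite /D2 dif_cst mulr0 addr0.
Qed.
Lemma D3_scale r f : smooth f -> D3 (fun p => r * f p) = (fun p => r * D3 f p).
Proof.
move=> sf; rewrite D3_mul //; last exact: smooth_cst.
by apply/funext => p; rewrite /D3 dif_cst mulr0 addr0.
Qed.

(** Both sides are the opposite of the mean of D f times D g. *)
Lemma mean_parts (D : (SU2 R -> R) -> SU2 R -> R) f g :
  (forall h, smooth h -> mean (D h) = 0) -> (forall h, smooth h -> smooth (D h)) ->
  (forall h k, smooth h -> smooth k ->
    D (fun p => h p * k p) = (fun p => h p * D k p + k p * D h p)) ->
  smooth f -> smooth g ->
  mean (fun p => f p * D (D g) p) = mean (fun p => D (D f) p * g p).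
Proof.
move=> mD sD DM sf sg.
have E h k : smooth h -> smooth k -> mean (fun p => h p * D k p) + mean (fun p => k p * D h p) = 0.
  move=> sh sk; rewrite -(mD _ (smoothM sh sk)) DM // meanD //.
    by apply: smooth_bdd; apply: smoothM => //; exact: sD.
  by apply: smooth_bdd; apply: smoothM => //; exact: sD.
have := E f (D g) sf (sD _ sg); have := E g (D f) sg (sD _ sf).
have C1 : mean (fun p => D g p * D f p) = mean (fun p => D f p * D g p).
  by congr mean; apply/funext => p; rewrite mulrC.
have C2 : mean (fun p => g p * D (D f) p) = mean (fun p => D (D f) p * g p).
  by congr mean; apply/funext => p; rewrite mulrC.
by rewrite C1 C2; lra.
Qed.

End Derivations.

Section Eigenspaces.
Variables (R : realType) (a b c : R).
Hypotheses (a0 : 0 < a) (b0 : 0 < b) (c0 : 0 < c).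
Implicit Types f g h : SU2 R -> R.

Definition lap f p := - (a ^+ 2 * D1 (D1 f) p + b ^+ 2 * D2 (D2 f) p + c ^+ 2 * D3 (D3 f) p).

Lemma eigenspaceP mu f :
  eigenspace a b c mu f <-> smooth f /\ forall p, lap f p = mu * f p.
Proof.
by split=> -[sf ef]; split=> // p; have := ef p; rewrite laplace_smooth.
Qed.

Lemma lap_add f g p : smooth f -> smooth g ->
  lap (fun q => f q + g q) p = lap f p + lap g p.
Proof.
move=> sf sg; rewrite /lap !D1_add ?D2_add ?D3_add; smooth_tac => //.
by ring.
Qed.

Lemma lap_scale r f p : smooth f -> lap (fun q => r * f q) p = r * lap f p.
Proof.
move=> sf; rewrite /lap !D1_scale ?D2_scale ?D3_scale; smooth_tac => //.
by ring.
Qed.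

Lemma mean_lap f g : smooth f -> smooth g ->
  mean (fun p => f p * lap g p) = mean (fun p => lap f p * g p).
Proof.
move=> sf sg.
have B1 (s : R) h k : smooth h -> smooth k -> bounded_fct (fun p => s * (h p * k p)).
  by move=> sh sk; apply: smooth_bdd; apply: smoothZ; apply: smoothM.
have E (h k1 k2 k3 : SU2 R -> R) : smooth h -> smooth k1 -> smooth k2 -> smooth k3 ->
  mean (fun p => h p * - (a ^+ 2 * k1 p + b ^+ 2 * k2 p + c ^+ 2 * k3 p)) =
  - (a ^+ 2 * mean (fun p => h p * k1 p) + b ^+ 2 * mean (fun p => h p * k2 p) +
     c ^+ 2 * mean (fun p => h p * k3 p)).
  move=> sh s1 s2 s3; rewrite -!meanZ; [|by apply: smooth_bdd; smooth_tac..].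
  rewrite -!meanD; do ?[by apply: B1 | apply: bounded_fctD].
  rewrite -meanN; last by do ?[by apply: B1 | apply: bounded_fctD].
  by congr mean; apply/funext => p; ring.
rewrite /lap E; [|by smooth_tac..].
rewrite (_ : (fun p => - _ * g p) = fun p => g p * - (a ^+ 2 * D1 (D1 f) p +
  b ^+ 2 * D2 (D2 f) p + c ^+ 2 * D3 (D3 f) p)); last by apply/funext => p; rewrite mulrC.
rewrite E; [|by smooth_tac..].
have C h k : mean (fun p => h p * k p) = mean (fun p => k p * h p).
  by congr mean; apply/funext => p; rewrite mulrC.
rewrite (C g) (C g (D2 _)) (C g (D3 _)).
rewrite (@mean_parts _ (@D1 R)) //; first rewrite (@mean_parts _ (@D2 R)) //.
- rewrite (@mean_parts _ (@D3 R)) //; [exact: mean_D3|exact: smooth_D3|exact: D3_mul].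
- exact: mean_D2.
- exact: smooth_D2.
- exact: D2_mul.
- exact: mean_D1.
- exact: smooth_D1.
- exact: D1_mul.
Qed.

Lemma lap_sum n (x : 'I_n -> R) (e : 'I_n -> SU2 R -> R) p : (forall k, smooth (e k)) ->
  lap (fun q => \sum_(k < n) x k * e k q) p = \sum_(k < n) x k * lap (e k) p.
Proof.
move=> se; elim: n x e se => [|n IH] x e se.
  rewrite big_ord0 (_ : (fun q => _) = (fun q => 0 * (0 : R))); last first.
    by apply/funext => q; rewrite big_ord0 mul0r.
  by rewrite lap_scale ?mul0r //; exact: smooth_cst.
rewrite big_ord_recr /= -IH // -(lap_scale _ _ (se _)) -lap_add.
- by congr (lap _ p); apply/funext => q; rewrite big_ord_recr.
- by apply: smooth_sum => i; apply: smoothZ.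
- exact: smoothZ.
Qed.

Lemma eigenspace_sum mu n (x : 'I_n -> R) (e : 'I_n -> SU2 R -> R) :
  (forall k, eigenspace a b c mu (e k)) ->
  eigenspace a b c mu (fun p => \sum_(k < n) x k * e k p).
Proof.
move=> ee; have se k : smooth (e k) by case: (ee k).
apply/eigenspaceP; split; first by apply: smooth_sum => i; exact: smoothZ.
move=> p; rewrite lap_sum // mulr_sumr; apply: eq_bigr => k _.
by have /eigenspaceP[_ ->] := ee k; rewrite mulrCA.
Qed.

Lemma eigenspaceB mu f g : eigenspace a b c mu f -> eigenspace a b c mu g ->
  eigenspace a b c mu (fun p => f p - g p).
Proof.
move=> /eigenspaceP[sf ef] /eigenspaceP[sg eg]; apply/eigenspaceP; split; first exact: smoothB.
move=> p; rewrite (_ : (fun p => f p - g p) = fun p => f p + -1 * g p); last first.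
  by apply/funext => q; rewrite mulN1r.
by rewrite lap_add ?lap_scale ?ef ?eg //; [ring|exact: smoothZ].
Qed.

(** Linearly independent eigenfunctions form a basis as soon as only 0 is
   orthogonal to all of them: their Gram matrix is invertible, so that every
   eigenfunction can be projected on their span. *)
Lemma basis_multiplicity mu n (e : 'I_n -> SU2 R -> R) :
  (forall k, eigenspace a b c mu (e k)) ->
  (forall x : 'I_n -> R, (forall p, \sum_(k < n) x k * e k p = 0) -> forall k, x k = 0) ->
  (forall f, eigenspace a b c mu f -> (forall k, mean (fun p => f p * e k p) = 0) ->
    forall p, f p = 0) ->
  has_multiplicity a b c mu n.
Proof.
move=> ee free ortho; exists e; split=> // f; split; last first.
  move=> [x fx]; rewrite (_ : f = fun p => \sum_(k < n) x k * e k p).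
    exact: eigenspace_sum.
  exact/funext.
move=> ef; have se k : smooth (e k) by case: (ee k).
have sf : smooth f by case: ef.
pose G := \matrix_(i < n, j < n) mean (fun p => e i p * e j p).
have lin (x : 'I_n -> R) j : mean (fun p => (\sum_(k < n) x k * e k p) * e j p) =
    \sum_(k < n) x k * G k j.
  rewrite (_ : (fun p => _) = fun p => \sum_(k < n) x k * (e k p * e j p)); last first.
    by apply/funext => p; rewrite mulr_suml; apply: eq_bigr => k _; rewrite mulrA.
  rewrite mean_sum; last by move=> k; apply: smoothZ; apply: smoothM.
  apply: eq_bigr => k _; rewrite mxE meanZ //.
  by apply: smooth_bdd; apply: smoothM.
have Gu : G \in unitmx.
  rewrite -row_free_unit; apply: inj_row_free => v vG.
  pose s p := \sum_(k < n) v 0 k * e k p.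
  have ss : smooth s by apply: smooth_sum => k; exact: smoothZ.
  have s0 : mean (fun p => s p * s p) = 0.
    rewrite (_ : (fun p => _) = fun p => \sum_(j < n) v 0 j * (s p * e j p)); last first.
      by apply/funext => p; rewrite [X in _ * X]/s mulr_sumr; apply: eq_bigr => j _; ring.
    rewrite mean_sum; last by move=> k; apply: smoothZ; apply: smoothM.
    rewrite big1 // => j _; rewrite meanZ; last by apply: smooth_bdd; apply: smoothM.
    by rewrite lin; move/matrixP: vG => /(_ 0 j); rewrite !mxE => ->; rewrite mulr0.
  have h := free (fun k => v 0 k) (mean_square_eq0 ss s0).
  by apply/rowP => k; rewrite mxE h.
pose m := \row_j mean (fun p => f p * e j p).
pose x := m *m invmx G.
have xG j : \sum_(k < n) x 0 k * G k j = mean (fun p => f p * e j p).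
  have : (x *m G) 0 j = m 0 j by rewrite /x mulmxKV.
  by rewrite !mxE.
exists (fun k => x 0 k) => p; apply/eqP; rewrite -subr_eq0; apply/eqP.
apply: (ortho (fun p => f p - \sum_(k < n) x 0 k * e k p)).
  by apply: eigenspaceB => //; exact: eigenspace_sum.
move=> j; have sx : smooth (fun p => \sum_(k < n) x 0 k * e k p).
  by apply: smooth_sum => k; exact: smoothZ.
rewrite (_ : (fun p => _) = fun p => f p * e j p - (\sum_(k < n) x 0 k * e k p) * e j p).
  by rewrite meanB ?lin ?xG ?subrr //; apply: smooth_bdd; apply: smoothM.
by apply/funext => q; rewrite mulrBl.
Qed.

End Eigenspaces.
(** * Vanishing of the moments *)

Section Recursion.
Variable T : comNzRingType.

(** For a matrix with rows (u1, u2) and (v1, v2), the derivation E maps u2 to u1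
   and v2 to v1 and kills the other two entries, and F does the opposite.  These
   are their effects on the monomials u1^i1 u2^i2 v1^j1 v2^j2, and equally on any
   linear functional m of the monomials. *)
Definition opE (m : nat -> nat -> nat -> nat -> T) (i1 i2 j1 j2 : nat) : T :=
  i2%:R * m i1.+1 i2.-1 j1 j2 + j2%:R * m i1 i2 j1.+1 j2.-1.
Definition opF (m : nat -> nat -> nat -> nat -> T) (i1 i2 j1 j2 : nat) : T :=
  i1%:R * m i1.-1 i2.+1 j1 j2 + j1%:R * m i1 i2 j1.-1 j2.+1.

(** The operator A H^2 - (B - C) (E^2 + F^2) + (B + C) (E F + F E). *)
Definition oplap (A B C : T) (m : nat -> nat -> nat -> nat -> T) (i1 i2 j1 j2 : nat) : T :=
  A * ((i1 + j1)%:R - (i2 + j2)%:R) ^+ 2 * m i1 i2 j1 j2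
  - (B - C) * (opE (opE m) i1 i2 j1 j2 + opF (opF m) i1 i2 j1 j2)
  + (B + C) * (opF (opE m) i1 i2 j1 j2 + opE (opF m) i1 i2 j1 j2).

Lemma oplap_degree0 A B C m : oplap A B C m 0 0 0 0 = 0.
Proof. by rewrite /oplap /opE /opF /=; ring. Qed.

Lemma degree1_cases i1 i2 j1 j2 : (i1 + i2 + j1 + j2 = 1)%N ->
  [\/ [/\ i1 = 1, i2 = 0, j1 = 0 & j2 = 0], [/\ i1 = 0, i2 = 1, j1 = 0 & j2 = 0],
    [/\ i1 = 0, i2 = 0, j1 = 1 & j2 = 0] | [/\ i1 = 0, i2 = 0, j1 = 0 & j2 = 1]]%N.
Proof.
case: i1 => [|[|?]]; case: i2 => [|[|?]]; case: j1 => [|[|?]]; case: j2 => [|[|?]] //= _;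
  by [constructor 1|constructor 2|constructor 3|constructor 4].
Qed.

Lemma oplap_degree1 A B C m i1 i2 j1 j2 : (i1 + i2 + j1 + j2 = 1)%N ->
  oplap A B C m i1 i2 j1 j2 = (A + B + C) * m i1 i2 j1 j2.
Proof.
by move=> /degree1_cases[] [-> -> -> ->]; rewrite /oplap /opE /opF /=; ring.
Qed.

End Recursion.

Section Gershgorin.
Variables (R : realType) (a b c mu : R) (m : nat -> nat -> nat -> nat -> R).
Hypotheses (ba : b <= a) (cb : c <= b) (c0 : 0 < c).
Hypothesis rec : forall i1 i2 j1 j2,
  oplap (a ^+ 2) (b ^+ 2) (c ^+ 2) m i1 i2 j1 j2 = mu * m i1 i2 j1 j2.
Hypothesis det : forall i1 i2 j1 j2,
  m i1.+1 i2 j1 j2.+1 - m i1 i2.+1 j1.+1 j2 = m i1 i2 j1 j2.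

(** By det, exchanging the entries used in the two rows does not change a moment of
   degree n when the moments of degree n - 2 vanish; hence E F + F E acts by the
   scalar k + j + 2 k j that it has on u1^k u2^j. *)
Lemma mixed_term n : (forall i1 i2 j1 j2, (i1 + i2 + j1 + j2).+2 = n -> m i1 i2 j1 j2 = 0) ->
  forall i1 i2 j1 j2, (i1 + i2 + j1 + j2 = n)%N ->
  opF (opE m) i1 i2 j1 j2 + opE (opF m) i1 i2 j1 j2 =
  ((i1 + j1)%:R + (i2 + j2)%:R + 2 * (i1 + j1)%:R * (i2 + j2)%:R) * m i1 i2 j1 j2.
Proof.
move=> low i1 i2 j1 j2 ijn.
have st k1 k2 l1 l2 : (k1 + k2 + l1 + l2).+2 = n -> m k1.+1 k2 l1 l2.+1 = m k1 k2.+1 l1.+1 l2.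
  by move=> h; apply/eqP; rewrite -subr_eq0 det low.
have h1 : i1%:R * (j2%:R * m i1.-1 i2.+1 j1.+1 j2.-1) = i1%:R * (j2%:R * m i1 i2 j1 j2).
  case: i1 ijn => [|i1] ijn; first by rewrite !mul0r.
  case: j2 ijn => [|j2] ijn; first by rewrite !mul0r.
  by rewrite /= st // -ijn; lia.
have h2 : i2%:R * (j1%:R * m i1.+1 i2.-1 j1.-1 j2.+1) = i2%:R * (j1%:R * m i1 i2 j1 j2).
  case: i2 ijn {h1} => [|i2] ijn; first by rewrite !mul0r.
  case: j1 ijn => [|j1] ijn; first by rewrite !mul0r.
  by rewrite /= -st // -ijn; lia.
have h3 : i1%:R * m i1.-1.+1 i2 j1 j2 = i1%:R * m i1 i2 j1 j2 by case: (i1) => [|?]; rewrite ?mul0r.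
have h4 : i2%:R * m i1 i2.-1.+1 j1 j2 = i2%:R * m i1 i2 j1 j2 by case: (i2) => [|?]; rewrite ?mul0r.
have h5 : j1%:R * m i1 i2 j1.-1.+1 j2 = j1%:R * m i1 i2 j1 j2 by case: (j1) => [|?]; rewrite ?mul0r.
have h6 : j2%:R * m i1 i2 j1 j2.-1.+1 = j2%:R * m i1 i2 j1 j2 by case: (j2) => [|?]; rewrite ?mul0r.
rewrite /opF /opE /= -!natr1 !natrD.
transitivity ((i2%:R + 1) * (i1%:R * m i1.-1.+1 i2 j1 j2) +
  i1%:R * (j2%:R * m i1.-1 i2.+1 j1.+1 j2.-1) +
  i2%:R * (j1%:R * m i1.+1 i2.-1 j1.-1 j2.+1) + (j2%:R + 1) * (j1%:R * m i1 i2 j1.-1.+1 j2) +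
  ((i1%:R + 1) * (i2%:R * m i1 i2.-1.+1 j1 j2) +
  i2%:R * (j1%:R * m i1.+1 i2.-1 j1.-1 j2.+1) +
  i1%:R * (j2%:R * m i1.-1 i2.+1 j1.+1 j2.-1) + (j1%:R + 1) * (j2%:R * m i1 i2 j1 j2.-1.+1))).
  by ring.
by rewrite h1 h2 h3 h4 h5 h6; ring.
Qed.

Lemma norm_opEE n M : (forall i1 i2 j1 j2, (i1 + i2 + j1 + j2 = n)%N -> `|m i1 i2 j1 j2| <= M) ->
  forall i1 i2 j1 j2, (i1 + i2 + j1 + j2 = n)%N ->
  `|opE (opE m) i1 i2 j1 j2| <= ((i2 + j2)%:R ^+ 2 - (i2 + j2)%:R) * M /\
  `|opF (opF m) i1 i2 j1 j2| <= ((i1 + j1)%:R ^+ 2 - (i1 + j1)%:R) * M.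
Proof.
move=> hM i1 i2 j1 j2 ijn.
have pr (k : nat) : k%:R * k.-1%:R = k%:R ^+ 2 - k%:R :> R.
  by case: k => [|k]; rewrite ?mul0r ?expr0n ?subr0 //= -natr1; ring.
have nb (k l : nat) x : (k != 0%N -> l != 0%N -> `|x| <= M) -> `|k%:R * (l%:R * x)| <= k%:R * l%:R * M.
  case: k => [|k] h; first by rewrite !mul0r normr0.
  case: l h => [|l] h; first by rewrite mul0r !mulr0 mul0r normr0.
  by rewrite mulrA normrM ger0_norm // ler_wpM2l // h.
have tri (x1 x2 x3 x4 y1 y2 y3 y4 : R) : `|x1| <= y1 -> `|x2| <= y2 -> `|x3| <= y3 ->
    `|x4| <= y4 -> `|x1 + x2 + (x3 + x4)| <= y1 + y2 + (y3 + y4).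
  move=> h1 h2 h3 h4; rewrite (le_trans (ler_normD _ _)) // lerD //.
    by rewrite (le_trans (ler_normD _ _)) // lerD.
  by rewrite (le_trans (ler_normD _ _)) // lerD.
split.
  rewrite (_ : _ * M = i2%:R * i2.-1%:R * M + i2%:R * j2%:R * M +
     (j2%:R * i2%:R * M + j2%:R * j2.-1%:R * M)); last by rewrite !pr natrD; ring.
  rewrite /opE !mulrDr; apply: tri; apply: nb => k0 l0; apply: hM; lia.
rewrite (_ : _ * M = i1%:R * i1.-1%:R * M + i1%:R * j1%:R * M +
     (j1%:R * i1%:R * M + j1%:R * j1.-1%:R * M)); last by rewrite !pr natrD; ring.
rewrite /opF !mulrDr; apply: tri; apply: nb => k0 l0; apply: hM; lia.
Qed.

(** At a moment of largest absolute value among those of degree n, with weight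
   k - j where k = i1 + j1 and j = i2 + j2, the diagonal coefficient minus the sum
   of the absolute values of the others is at least
     a^2 (k - j)^2 + (b^2 + c^2) (n + 2 j k)
       - (b^2 - c^2) (j (j - 1) + k (k - 1))
     = 2 n b^2 + n^2 c^2 + (a^2 - b^2) (k - j)^2.
   If this exceeds mu, the largest moment is 0. *)
Lemma gershgorin_step n :
  (forall i1 i2 j1 j2, (i1 + i2 + j1 + j2).+2 = n -> m i1 i2 j1 j2 = 0) ->
  (forall i1 i2 j1 j2, (i1 + i2 + j1 + j2 = n)%N -> m i1 i2 j1 j2 = 0 \/
    mu < 2 * n%:R * b ^+ 2 + n%:R ^+ 2 * c ^+ 2 +
      (a ^+ 2 - b ^+ 2) * ((i1 + j1)%:R - (i2 + j2)%:R) ^+ 2) ->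
  forall i1 i2 j1 j2, (i1 + i2 + j1 + j2 = n)%N -> m i1 i2 j1 j2 = 0.
Proof.
move=> low bnd.
pose I := ('I_n.+1 * 'I_n.+1 * ('I_n.+1 * 'I_n.+1))%type.
pose W (t : I) : R := let: ((i1, i2), (j1, j2)) := t in
  if (i1 + i2 + j1 + j2 == n)%N then `|m i1 i2 j1 j2| else 0.
have [t tmax] : exists t, forall t', W t' <= W t.
  pose t0 : I := ((ord0, ord0), (ord0, ord0)).
  case: (@arg_maxP _ R I t0 predT W isT) => t _ ht.
  by exists t => t'; exact: ht.
have hM i1 i2 j1 j2 : (i1 + i2 + j1 + j2 = n)%N -> `|m i1 i2 j1 j2| <= W t.
  move=> h.
  have l1 : (i1 < n.+1)%N by lia.
  have l2 : (i2 < n.+1)%N by lia.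
  have l3 : (j1 < n.+1)%N by lia.
  have l4 : (j2 < n.+1)%N by lia.
  by have := tmax ((Ordinal l1, Ordinal l2), (Ordinal l3, Ordinal l4)); rewrite /W /= h eqxx.
suff Wt : W t = 0 by move=> i1 i2 j1 j2 /hM; rewrite Wt normr_le0 => /eqP.
move: hM; rewrite /W; case: t {tmax} => [[i1 i2] [j1 j2]]; case: eqP => // ijn hM.
apply/eqP; rewrite normr_eq0; apply/eqP.
have [//|bd] := bnd _ _ _ _ ijn.
have [hE hF] := norm_opEE hM ijn.
have := rec i1 i2 j1 j2; rewrite /oplap (mixed_term low ijn).
have nn : n%:R = (i1 + j1)%:R + (i2 + j2)%:R :> R.
  by rewrite -natrD; congr (_%:R); lia.
move: bd hE hF; rewrite nn.
move: (opE _ _ _ _ _) (opF _ _ _ _ _) (m i1 i2 j1 j2).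
move: ((i1 + j1)%N%:R : R) ((i2 + j2)%N%:R : R) => k j x y M bd hx hy E.
have bc : 0 <= b ^+ 2 - c ^+ 2.
  by rewrite subr_ge0 ler_pXn2r // nnegrE; [exact: ltW|exact: le_trans (ltW c0) cb].
pose D := a ^+ 2 * (k - j) ^+ 2 + (b ^+ 2 + c ^+ 2) * (k + j + 2 * k * j) - mu.
have DM : D * M = (b ^+ 2 - c ^+ 2) * (x + y) by rewrite /D mulrBl -E; ring.
have Dpos : (b ^+ 2 - c ^+ 2) * (j ^+ 2 - j + (k ^+ 2 - k)) < D.
  by rewrite /D -subr_gt0; apply: lt_le_trans (_ : 0 < _ - mu) _; [rewrite subr_gt0; exact: bd|
   rewrite le_eqVlt; apply/orP; left; apply/eqP; ring].
apply/eqP; rewrite -normr_le0 leNgt; apply/negP => M0.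
have xy : `|x + y| <= (j ^+ 2 - j + (k ^+ 2 - k)) * `|M|.
  by rewrite mulrDl (le_trans (ler_normD _ _)) // lerD.
have : D * `|M| <= (b ^+ 2 - c ^+ 2) * (j ^+ 2 - j + (k ^+ 2 - k)) * `|M|.
  rewrite -mulrA (le_trans (ler_norm _)) // normrM normr_id -normrM DM normrM ger0_norm //.
  by rewrite ler_wpM2l.
by rewrite ler_pM2r // leNgt Dpos.
Qed.

(** For n >= 3 the bound 2 n b^2 + n^2 c^2 of the previous lemma is at least
   6 b^2 + 9 c^2, which exceeds mu. *)
Lemma moments_vanish : mu <= 4 * (b ^+ 2 + c ^+ 2) ->
  (forall i1 i2 j1 j2, (i1 + i2 + j1 + j2 <= 2)%N -> m i1 i2 j1 j2 = 0) ->
  forall i1 i2 j1 j2, m i1 i2 j1 j2 = 0.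
Proof.
move=> hmu low i1 i2 j1 j2.
have [n] := ubnP (i1 + i2 + j1 + j2)%N.
elim: n i1 i2 j1 j2 => [//|n IH] i1 i2 j1 j2; rewrite ltnS leq_eqVlt => /orP[/eqP|]; last exact: IH.
have [n2 h|n3] := leqP n 2; first by apply: low; rewrite h.
apply: gershgorin_step => [k1 k2 l1 l2 h|k1 k2 l1 l2 h]; first by apply: IH; lia.
right; apply: le_lt_trans hmu _.
have b2 : c ^+ 2 <= b ^+ 2 by rewrite ler_pXn2r // nnegrE ltW // (lt_le_trans c0).
have a2 : b ^+ 2 <= a ^+ 2.
  by rewrite ler_pXn2r // nnegrE ltW // ?(lt_le_trans c0) // (le_trans cb).
have c2 : 0 < c ^+ 2 by rewrite exprn_gt0.
apply: (@lt_le_trans _ _ (2 * n%:R * b ^+ 2 + n%:R ^+ 2 * c ^+ 2)); last first.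
  by rewrite lerDl mulr_ge0 ?sqr_ge0 // subr_ge0.
have N3 : 3%:R <= n%:R :> R by rewrite ler_nat.
move: (n%:R : R) N3 => N N3; have : 9 <= N ^+ 2 by nra.
nra.
Qed.

End Gershgorin.
(** * The Laplacian on monomials *)

Section ComplexFunctions.
Variable R : realType.
Notation C := R[i].
Implicit Types u v : SU2 R -> C.

Definition csmooth u := smooth (fun p => Re (u p)) /\ smooth (fun p => Im (u p)).

Lemma ReM (x y : C) : Re (x * y) = Re x * Re y - Im x * Im y.
Proof. by case: x; case: y. Qed.
Lemma ImM (x y : C) : Im (x * y) = Re x * Im y + Im x * Re y.
Proof. by case: x; case: y => *. Qed.
Lemma ReD (x y : C) : Re (x + y) = Re x + Re y.
Proof. by case: x; case: y. Qed.
Lemma ImD (x y : C) : Im (x + y) = Im x + Im y.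
Proof. by case: x; case: y. Qed.

Lemma csmooth_ext u v : (forall p, u p = v p) -> csmooth v -> csmooth u.
Proof. by move=> /funext ->. Qed.

Lemma csmooth_cst (z : C) : csmooth (fun _ => z).
Proof. by split; exact: smooth_cst. Qed.

Lemma csmoothD u v : csmooth u -> csmooth v -> csmooth (fun p => u p + v p).
Proof.
move=> [u1 u2] [v1 v2]; split.
  by apply: smooth_ext (smoothD u1 v1) => p; rewrite ReD.
by apply: smooth_ext (smoothD u2 v2) => p; rewrite ImD.
Qed.

Lemma csmoothM u v : csmooth u -> csmooth v -> csmooth (fun p => u p * v p).
Proof.
move=> [u1 u2] [v1 v2]; split.
  by apply: smooth_ext (smoothB (smoothM u1 v1) (smoothM u2 v2)) => p; rewrite ReM.
by apply: smooth_ext (smoothD (smoothM u1 v2) (smoothM u2 v1)) => p; rewrite ImM.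
Qed.

Lemma csmoothX u n : csmooth u -> csmooth (fun p => u p ^+ n).
Proof.
move=> su; elim: n => [|n IH]; first exact: csmooth_cst.
by apply: csmooth_ext (csmoothM su IH) => p; rewrite exprS.
Qed.

(** Real left-invariant derivations act on the real and imaginary parts; complex
   combinations of them are again derivations. *)
Definition cdif (t1 t2 t3 : R) u p : C :=
  dif (fun q => Re (u q)) p (mulX t1 t2 t3 p) +i* dif (fun q => Im (u q)) p (mulX t1 t2 t3 p).

Definition cder (k1 k2 k3 : C) u p : C :=
  k1 * cdif 1 0 0 u p + k2 * cdif 0 1 0 u p + k3 * cdif 0 0 1 u p.

Lemma csmooth_cdif t1 t2 t3 u : csmooth u -> csmooth (cdif t1 t2 t3 u).
Proof. by move=> [u1 u2]; split; exact: smooth_dif. Qed.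

Lemma cdifD t1 t2 t3 u v p : csmooth u -> csmooth v ->
  cdif t1 t2 t3 (fun q => u q + v q) p = cdif t1 t2 t3 u p + cdif t1 t2 t3 v p.
Proof.
move=> [u1 u2] [v1 v2]; rewrite /cdif.
rewrite (_ : (fun q => Re (u q + v q)) = fun q => Re (u q) + Re (v q)); last first.
  by apply/funext => q; rewrite ReD.
rewrite (_ : (fun q => Im (u q + v q)) = fun q => Im (u q) + Im (v q)); last first.
  by apply/funext => q; rewrite ImD.
by rewrite !difD.
Qed.

Lemma cdifM t1 t2 t3 u v p : csmooth u -> csmooth v ->
  cdif t1 t2 t3 (fun q => u q * v q) p = u p * cdif t1 t2 t3 v p + v p * cdif t1 t2 t3 u p.
Proof.
move=> [u1 u2] [v1 v2]; rewrite /cdif.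
rewrite (_ : (fun q => Re (u q * v q)) =
  fun q => Re (u q) * Re (v q) - Im (u q) * Im (v q)); last first.
  by apply/funext => q; rewrite ReM.
rewrite (_ : (fun q => Im (u q * v q)) =
  fun q => Re (u q) * Im (v q) + Im (u q) * Re (v q)); last first.
  by apply/funext => q; rewrite ImM.
rewrite difB ?difD; try by apply: smoothM.
rewrite !difM //; move: (dif _ _ _) (dif _ _ _) (dif _ _ _) (dif _ _ _) => d1 d2 d3 d4.
by case: (u p) (v p) => [x y] [z w]; apply/eqP; rewrite eq_complex /=; apply/andP;
  split; apply/eqP; ring.
Qed.

Lemma cder_add k1 k2 k3 u v : csmooth u -> csmooth v ->
  cder k1 k2 k3 (fun q => u q + v q) = (fun p => cder k1 k2 k3 u p + cder k1 k2 k3 v p).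
Proof. by move=> su sv; apply/funext => p; rewrite /cder !cdifD //; ring. Qed.

Lemma cder_mul k1 k2 k3 u v : csmooth u -> csmooth v ->
  cder k1 k2 k3 (fun q => u q * v q) =
  (fun p => u p * cder k1 k2 k3 v p + v p * cder k1 k2 k3 u p).
Proof. by move=> su sv; apply/funext => p; rewrite /cder !cdifM //; ring. Qed.

Lemma cder_cst k1 k2 k3 z : cder k1 k2 k3 (fun _ => z) = fun _ => 0.
Proof.
by apply/funext => p; rewrite /cder /cdif !dif_cst (_ : 0 +i* 0 = 0 :> C) // !mulr0 !addr0.
Qed.

Lemma cder_scale k1 k2 k3 z u : csmooth u ->
  cder k1 k2 k3 (fun q => z * u q) = (fun p => z * cder k1 k2 k3 u p).
Proof.
move=> su; rewrite cder_mul //; last exact: csmooth_cst.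
by apply/funext => p; rewrite cder_cst mulr0 addr0.
Qed.

Lemma cder_exp k1 k2 k3 u n : csmooth u ->
  cder k1 k2 k3 (fun q => u q ^+ n) = (fun p => n%:R * u p ^+ n.-1 * cder k1 k2 k3 u p).
Proof.
move=> su; elim: n => [|n IH].
  by rewrite cder_cst; apply/funext => p; rewrite !mul0r.
rewrite (_ : (fun q => u q ^+ n.+1) = fun q => u q * u q ^+ n); last first.
  by apply/funext => q; rewrite exprS.
rewrite cder_mul //; last exact: csmoothX.
apply/funext => p; rewrite IH /= -natr1; case: n {IH} => [|n]; first by rewrite expr0; ring.
by rewrite /= exprS; ring.
Qed.

(** These satisfy X_1 = 'i H, X_2 = E - F and X_3 = 'i (E + F) as derivations. *)
Definition cH := cder (- 'i) 0 0.
Definition cE := cder 0 (1 / 2) (- 'i / 2).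
Definition cF := cder 0 (- (1 / 2)) (- 'i / 2).

(** The rows of p are (U1 p, U2 p) and (V1 p, V2 p). *)
Definition U1 (p : SU2 R) : C := qr p +i* qi p.
Definition U2 (p : SU2 R) : C := qj p +i* qk p.
Definition V1 (p : SU2 R) : C := (- qj p) +i* qk p.
Definition V2 (p : SU2 R) : C := qr p -i* qi p.

Lemma csmooth_U1 : csmooth U1. Proof. by split; [exact: smooth_qr|exact: smooth_qi]. Qed.
Lemma csmooth_U2 : csmooth U2. Proof. by split; [exact: smooth_qj|exact: smooth_qk]. Qed.
Lemma csmooth_V1 : csmooth V1.
Proof. by split; [apply: smoothN; exact: smooth_qj|exact: smooth_qk]. Qed.
Lemma csmooth_V2 : csmooth V2.
Proof. by split; [exact: smooth_qr|apply: smoothN; exact: smooth_qi]. Qed.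

Lemma cdif_U1 t1 t2 t3 p : cdif t1 t2 t3 U1 p =
  (- qi p * t1 - qj p * t2 - qk p * t3) +i* (qr p * t1 + qj p * t3 - qk p * t2).
Proof. by rewrite /cdif -dif_qr -dif_qi. Qed.
Lemma cdif_U2 t1 t2 t3 p : cdif t1 t2 t3 U2 p =
  (qr p * t2 + qk p * t1 - qi p * t3) +i* (qr p * t3 + qi p * t2 - qj p * t1).
Proof. by rewrite /cdif -dif_qj -dif_qk. Qed.
Lemma cdif_V1 t1 t2 t3 p : cdif t1 t2 t3 V1 p =
  (- (qr p * t2 + qk p * t1 - qi p * t3)) +i* (qr p * t3 + qi p * t2 - qj p * t1).
Proof. by rewrite /cdif -dif_qj -dif_qk -difN //; exact: smooth_qj. Qed.
Lemma cdif_V2 t1 t2 t3 p : cdif t1 t2 t3 V2 p =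
  (- qi p * t1 - qj p * t2 - qk p * t3) -i* (qr p * t1 + qj p * t3 - qk p * t2).
Proof. by rewrite /cdif -dif_qr -dif_qi -difN //; exact: smooth_qi. Qed.

Lemma half_complex : 1 / 2 = (2^-1 : R)%:C :> C.
Proof.
apply: (@mulIf _ (2 : C)); first by rewrite pnatr_eq0.
rewrite divfK ?pnatr_eq0 // (_ : (2 : C) = (2 : R)%:C); last first.
  by apply/eqP; rewrite eq_complex /= addr0 !eqxx.
by apply/eqP; rewrite eq_complex /=; apply/andP; split; apply/eqP; field.
Qed.

Ltac cder_tac := apply/funext => p; rewrite /cH /cE /cF /cder
  ?cdif_U1 ?cdif_U2 ?cdif_V1 ?cdif_V2; try rewrite -[2^-1 : C]mul1r half_complex; rewrite /U1 /U2 /V1 /V2;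
  apply/eqP; rewrite eq_complex /=; apply/andP; split; apply/eqP; field.

Lemma cE_U1 : cE U1 = fun=> 0. Proof. by cder_tac. Qed.
Lemma cE_U2 : cE U2 = U1. Proof. by cder_tac. Qed.
Lemma cE_V1 : cE V1 = fun=> 0. Proof. by cder_tac. Qed.
Lemma cE_V2 : cE V2 = V1. Proof. by cder_tac. Qed.
Lemma cF_U1 : cF U1 = U2. Proof. by cder_tac. Qed.
Lemma cF_U2 : cF U2 = fun=> 0. Proof. by cder_tac. Qed.
Lemma cF_V1 : cF V1 = V2. Proof. by cder_tac. Qed.
Lemma cF_V2 : cF V2 = fun=> 0. Proof. by cder_tac. Qed.

Lemma cH_U1 : cH U1 = U1. Proof. by cder_tac. Qed.
Lemma cH_U2 : cH U2 = fun p => - U2 p. Proof. by cder_tac. Qed.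
Lemma cH_V1 : cH V1 = V1. Proof. by cder_tac. Qed.
Lemma cH_V2 : cH V2 = fun p => - V2 p. Proof. by cder_tac. Qed.

Definition mono (i1 i2 j1 j2 : nat) (p : SU2 R) : C :=
  U1 p ^+ i1 * U2 p ^+ i2 * (V1 p ^+ j1 * V2 p ^+ j2).

Lemma csmooth_mono i1 i2 j1 j2 : csmooth (mono i1 i2 j1 j2).
Proof.
by do ?apply: csmoothM; apply: csmoothX;
  [exact: csmooth_U1|exact: csmooth_U2|exact: csmooth_V1|exact: csmooth_V2].
Qed.

Lemma cder_mono k1 k2 k3 i1 i2 j1 j2 : cder k1 k2 k3 (mono i1 i2 j1 j2) = fun p =>
  U1 p ^+ i1 * U2 p ^+ i2 * (V1 p ^+ j1 * (j2%:R * V2 p ^+ j2.-1 * cder k1 k2 k3 V2 p) +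
    V2 p ^+ j2 * (j1%:R * V1 p ^+ j1.-1 * cder k1 k2 k3 V1 p)) +
  V1 p ^+ j1 * V2 p ^+ j2 * (U1 p ^+ i1 * (i2%:R * U2 p ^+ i2.-1 * cder k1 k2 k3 U2 p) +
    U2 p ^+ i2 * (i1%:R * U1 p ^+ i1.-1 * cder k1 k2 k3 U1 p)).
Proof.
have s1 := csmoothX i1 csmooth_U1; have s2 := csmoothX i2 csmooth_U2.
have s3 := csmoothX j1 csmooth_V1; have s4 := csmoothX j2 csmooth_V2.
rewrite /mono cder_mul; [|exact: csmoothM..].
by rewrite !cder_mul // (cder_exp _ _ _ _ csmooth_U1) (cder_exp _ _ _ _ csmooth_U2)
  (cder_exp _ _ _ _ csmooth_V1) (cder_exp _ _ _ _ csmooth_V2).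
Qed.

Lemma natM_expr_pred (x : C) n : n%:R * x ^+ n.-1 * x = n%:R * x ^+ n.
Proof. by case: n => [|n]; rewrite ?mul0r //= exprS; ring. Qed.

Lemma cH_mono i1 i2 j1 j2 : cH (mono i1 i2 j1 j2) =
  fun p => ((i1 + j1)%:R - (i2 + j2)%:R) * mono i1 i2 j1 j2 p.
Proof.
rewrite /cH cder_mono -/cH cH_U1 cH_U2 cH_V1 cH_V2; apply/funext => p; rewrite /mono.
by rewrite !mulrN !natM_expr_pred !natrD; ring.
Qed.

Lemma cE_mono i1 i2 j1 j2 : cE (mono i1 i2 j1 j2) =
  fun p => opE (fun i1 i2 j1 j2 => mono i1 i2 j1 j2 p) i1 i2 j1 j2.
Proof.
rewrite /cE cder_mono -/cE cE_U1 cE_U2 cE_V1 cE_V2; apply/funext => p.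
by rewrite /opE /mono !exprS; ring.
Qed.

Lemma cF_mono i1 i2 j1 j2 : cF (mono i1 i2 j1 j2) =
  fun p => opF (fun i1 i2 j1 j2 => mono i1 i2 j1 j2 p) i1 i2 j1 j2.
Proof.
rewrite /cF cder_mono -/cF cF_U1 cF_U2 cF_V1 cF_V2; apply/funext => p.
by rewrite /opF /mono !exprS; ring.
Qed.

Lemma cder_opE k1 k2 k3 (U : nat -> nat -> nat -> nat -> SU2 R -> C) i1 i2 j1 j2 :
  (forall i1 i2 j1 j2, csmooth (U i1 i2 j1 j2)) ->
  cder k1 k2 k3 (fun p => opE (fun i1 i2 j1 j2 => U i1 i2 j1 j2 p) i1 i2 j1 j2) =
  fun p => opE (fun i1 i2 j1 j2 => cder k1 k2 k3 (U i1 i2 j1 j2) p) i1 i2 j1 j2.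
Proof.
move=> sU; rewrite /opE cder_add; [|by apply: csmoothM => //; exact: csmooth_cst..].
by rewrite !cder_scale.
Qed.

Lemma cder_opF k1 k2 k3 (U : nat -> nat -> nat -> nat -> SU2 R -> C) i1 i2 j1 j2 :
  (forall i1 i2 j1 j2, csmooth (U i1 i2 j1 j2)) ->
  cder k1 k2 k3 (fun p => opF (fun i1 i2 j1 j2 => U i1 i2 j1 j2 p) i1 i2 j1 j2) =
  fun p => opF (fun i1 i2 j1 j2 => cder k1 k2 k3 (U i1 i2 j1 j2) p) i1 i2 j1 j2.
Proof.
move=> sU; rewrite /opF cder_add; [|by apply: csmoothM => //; exact: csmooth_cst..].
by rewrite !cder_scale.
Qed.

Section CLap.
Variables a b c : R.

Definition clap u p : C :=
  lap a b c (fun q => Re (u q)) p +i* lap a b c (fun q => Im (u q)) p.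

Lemma clapE u p : csmooth u -> clap u p =
  (a ^+ 2)%:C * cH (cH u) p
  - ((b ^+ 2)%:C - (c ^+ 2)%:C) * (cE (cE u) p + cF (cF u) p)
  + ((b ^+ 2)%:C + (c ^+ 2)%:C) * (cF (cE u) p + cE (cF u) p).
Proof.
move=> su.
have s1 := csmooth_cdif 1 0 0 su; have s2 := csmooth_cdif 0 1 0 su.
have s3 := csmooth_cdif 0 0 1 su.
have L : clap u p = - ((a ^+ 2)%:C * cdif 1 0 0 (cdif 1 0 0 u) p +
   (b ^+ 2)%:C * cdif 0 1 0 (cdif 0 1 0 u) p + (c ^+ 2)%:C * cdif 0 0 1 (cdif 0 0 1 u) p).
  rewrite /clap /lap /cdif /D1 /D2 /D3; apply/eqP; rewrite eq_complex /=.
  by apply/andP; split; apply/eqP; ring.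
have Z t1 t2 t3 z v : csmooth v -> cdif t1 t2 t3 (fun q => z * v q) p = z * cdif t1 t2 t3 v p.
  move=> sv; rewrite cdifM //; last exact: csmooth_cst.
  by rewrite [cdif _ _ _ (fun=> z) _]/cdif !dif_cst (_ : 0 +i* 0 = 0 :> C) // mulr0 addr0.
have sZ z v : csmooth v -> csmooth (fun q => z * v q).
  by move=> sv; apply: csmoothM => //; exact: csmooth_cst.
have ii : 'i * 'i = -1 :> C by rewrite -expr2 sqr_i.
rewrite L /cH /cE /cF /cder !cdifD //; do ?[apply: csmoothD]; do ?[exact: sZ].
rewrite !Z //.
by field: ii.
Qed.

Lemma clap_mono i1 i2 j1 j2 p : clap (mono i1 i2 j1 j2) p =
  oplap (a ^+ 2)%:C (b ^+ 2)%:C (c ^+ 2)%:C (fun i1 i2 j1 j2 => mono i1 i2 j1 j2 p) i1 i2 j1 j2.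
Proof.
have sm := csmooth_mono.
rewrite clapE // !cH_mono !cE_mono !cF_mono /cH /cE /cF.
rewrite cder_scale // -/cH cH_mono !cder_opE // !cder_opF // -/cE -/cF.
have EE : (fun i1 i2 j1 j2 => cE (mono i1 i2 j1 j2) p) =
    opE (fun i1 i2 j1 j2 => mono i1 i2 j1 j2 p).
  by do 4![apply/funext => ?]; rewrite cE_mono.
have FF : (fun i1 i2 j1 j2 => cF (mono i1 i2 j1 j2) p) =
    opF (fun i1 i2 j1 j2 => mono i1 i2 j1 j2 p).
  by do 4![apply/funext => ?]; rewrite cF_mono.
by rewrite EE FF /oplap; congr (_ - _ + _); ring.
Qed.

End CLap.

(** ** Moments of an eigenfunction *)

Section Moments.
Variables (a b c mu : R) (f : SU2 R -> R).
Hypotheses (a0 : 0 < a) (b0 : 0 < b) (c0 : 0 < c).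
Hypothesis ef : eigenspace a b c mu f.

Definition part (s : bool) (x : C) : R := if s then Re x else Im x.

Definition moment s u := mean (fun p => f p * part s (u p)).

Let sf : smooth f. Proof. by case: ef. Qed.

Lemma smooth_part s u : csmooth u -> smooth (fun p => part s (u p)).
Proof. by case: s => -[]. Qed.

Lemma bounded_moment s u : csmooth u -> bounded_fct (fun p => f p * part s (u p)).
Proof. by move=> su; apply: smooth_bdd; apply: smoothM => //; exact: smooth_part. Qed.

Lemma momentD s u v : csmooth u -> csmooth v ->
  moment s (fun p => u p + v p) = moment s u + moment s v.
Proof.
move=> su sv; rewrite /moment -meanD; [|exact: bounded_moment..].
congr mean; apply/funext => p; case: s; rewrite /part ?ReD ?ImD mulrDr //.
Qed.

Lemma momentZ s r u : csmooth u -> moment s (fun p => r%:C * u p) = r * moment s u.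
Proof.
move=> su; rewrite /moment -meanZ; last exact: bounded_moment.
by congr mean; apply/funext => p; case: s; rewrite /part ?ReM ?ImM /=; ring.
Qed.

Lemma momentMn s n u : csmooth u -> moment s (fun p => n%:R * u p) = n%:R * moment s u.
Proof. by move=> su; rewrite -momentZ // rmorph_nat. Qed.

Lemma csmoothZ z u : csmooth u -> csmooth (fun p => z * u p).
Proof. by move=> su; apply: csmoothM => //; exact: csmooth_cst. Qed.

Lemma moment_opE s (U : nat -> nat -> nat -> nat -> SU2 R -> C) i1 i2 j1 j2 :
  (forall i1 i2 j1 j2, csmooth (U i1 i2 j1 j2)) ->
  moment s (fun p => opE (fun i1 i2 j1 j2 => U i1 i2 j1 j2 p) i1 i2 j1 j2) =
  opE (fun i1 i2 j1 j2 => moment s (U i1 i2 j1 j2)) i1 i2 j1 j2.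
Proof. by move=> sU; rewrite /opE momentD ?momentMn //; exact: csmoothZ. Qed.

Lemma moment_opF s (U : nat -> nat -> nat -> nat -> SU2 R -> C) i1 i2 j1 j2 :
  (forall i1 i2 j1 j2, csmooth (U i1 i2 j1 j2)) ->
  moment s (fun p => opF (fun i1 i2 j1 j2 => U i1 i2 j1 j2 p) i1 i2 j1 j2) =
  opF (fun i1 i2 j1 j2 => moment s (U i1 i2 j1 j2)) i1 i2 j1 j2.
Proof. by move=> sU; rewrite /opF momentD ?momentMn //; exact: csmoothZ. Qed.

Lemma csmooth_opE (U : nat -> nat -> nat -> nat -> SU2 R -> C) i1 i2 j1 j2 :
  (forall i1 i2 j1 j2, csmooth (U i1 i2 j1 j2)) ->
  csmooth (fun p => opE (fun i1 i2 j1 j2 => U i1 i2 j1 j2 p) i1 i2 j1 j2).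
Proof. by move=> sU; apply: csmoothD; exact: csmoothZ. Qed.

Lemma csmooth_opF (U : nat -> nat -> nat -> nat -> SU2 R -> C) i1 i2 j1 j2 :
  (forall i1 i2 j1 j2, csmooth (U i1 i2 j1 j2)) ->
  csmooth (fun p => opF (fun i1 i2 j1 j2 => U i1 i2 j1 j2 p) i1 i2 j1 j2).
Proof. by move=> sU; apply: csmoothD; exact: csmoothZ. Qed.

Definition mom s i1 i2 j1 j2 := moment s (mono i1 i2 j1 j2).

Lemma moment_clap s u : csmooth u -> moment s (clap a b c u) = mu * moment s u.
Proof.
move=> su; have /(eigenspaceP a0 b0 c0)[_ lf] := ef.
have E : (fun p => part s (clap a b c u p)) = lap a b c (fun p => part s (u p)).
  by apply/funext => p; case: (s).
transitivity (mean (fun p => f p * lap a b c (fun p => part s (u p)) p)).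
  by rewrite -E.
rewrite mean_lap //; last exact: smooth_part.
rewrite -meanZ; last exact: bounded_moment.
by congr mean; apply/funext => p; rewrite lf mulrA.
Qed.

(** The recursion has real coefficients, hence it holds separately for the moments
   against the real and the imaginary parts of the monomials. *)
Lemma mom_rec s i1 i2 j1 j2 :
  oplap (a ^+ 2) (b ^+ 2) (c ^+ 2) (mom s) i1 i2 j1 j2 = mu * mom s i1 i2 j1 j2.
Proof.
have sm := csmooth_mono.
have sE i1 i2 j1 j2 := csmooth_opE i1 i2 j1 j2 sm.
have sF i1 i2 j1 j2 := csmooth_opF i1 i2 j1 j2 sm.
rewrite /mom -moment_clap //.
rewrite (_ : clap _ _ _ _ = fun p =>
  (a ^+ 2 * ((i1 + j1)%:R - (i2 + j2)%:R) ^+ 2)%:C * mono i1 i2 j1 j2 p +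
  ((- (b ^+ 2 - c ^+ 2))%:C * (opE (opE (fun i1 i2 j1 j2 => mono i1 i2 j1 j2 p)) i1 i2 j1 j2 +
     opF (opF (fun i1 i2 j1 j2 => mono i1 i2 j1 j2 p)) i1 i2 j1 j2) +
   (b ^+ 2 + c ^+ 2)%:C * (opF (opE (fun i1 i2 j1 j2 => mono i1 i2 j1 j2 p)) i1 i2 j1 j2 +
     opE (opF (fun i1 i2 j1 j2 => mono i1 i2 j1 j2 p)) i1 i2 j1 j2))); last first.
  apply/funext => p; rewrite clap_mono /oplap !rmorphM !rmorphN !rmorphD !rmorphN /=.
  by rewrite !rmorph_nat; ring.
have sEE := csmooth_opE i1 i2 j1 j2 sE; have sEF := csmooth_opE i1 i2 j1 j2 sF.
have sFE := csmooth_opF i1 i2 j1 j2 sE; have sFF := csmooth_opF i1 i2 j1 j2 sF.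
rewrite momentD; [|by do ?[exact: csmoothZ | apply: csmoothD | apply: csmoothZ]..].
rewrite momentD; [|by do ?[exact: csmoothZ | apply: csmoothD | apply: csmoothZ]..].
rewrite !momentZ; do ?[exact: csmoothD | exact: sm].
rewrite (momentD s sEE sFF) (momentD s sFE sEF).
rewrite (moment_opE s i1 i2 j1 j2 sE) (moment_opE s i1 i2 j1 j2 sF).
rewrite (moment_opF s i1 i2 j1 j2 sE) (moment_opF s i1 i2 j1 j2 sF).
have EE : (fun i1 i2 j1 j2 => moment s (fun p =>
    opE (fun i1 i2 j1 j2 => mono i1 i2 j1 j2 p) i1 i2 j1 j2)) = opE (mom s).
  by do 4![apply/funext => ?]; exact: moment_opE.
have FF : (fun i1 i2 j1 j2 => moment s (fun p =>
    opF (fun i1 i2 j1 j2 => mono i1 i2 j1 j2 p) i1 i2 j1 j2)) = opF (mom s).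
  by do 4![apply/funext => ?]; exact: moment_opF.
by rewrite EE FF /oplap -/(mom s i1 i2 j1 j2); ring.
Qed.

Lemma U_det p : U1 p * V2 p - U2 p * V1 p = 1.
Proof.
apply/eqP; rewrite eq_complex /=; apply/andP; split; apply/eqP; last by ring.
by rewrite -(sphere p); ring.
Qed.

Lemma mom_det s i1 i2 j1 j2 :
  mom s i1.+1 i2 j1 j2.+1 - mom s i1 i2.+1 j1.+1 j2 = mom s i1 i2 j1 j2.
Proof.
have sm := csmooth_mono; rewrite -mulN1r /mom -momentZ // -momentD //; last exact: csmoothZ.
congr moment; apply/funext => p; rewrite -[RHS]mul1r -(U_det p) /mono !exprS rmorphN1; ring.
Qed.

Lemma moment_scale0 u : csmooth u -> (forall s, moment s u = 0) ->
  forall z s, moment s (fun p => z * u p) = 0.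
Proof.
move=> su u0 z s.
pose g t := if t then - 1 else 1 : R.
rewrite /moment (_ : (fun p => _) = fun p => Re z * (f p * part s (u p)) +
    (g s * Im z) * (f p * part (~~ s) (u p))); last first.
  by apply/funext => p; case: s; rewrite /part /g ?ReM ?ImM /=; ring.
have b1 t r : bounded_fct (fun p => r * (f p * part t (u p))).
  by apply: bounded_fctZ; exact: bounded_moment.
rewrite meanD ?meanZ; [|exact: bounded_moment|exact: bounded_moment|exact: b1|exact: b1].
by rewrite -[mean _]/(moment s u) -[X in _ + _ * X]/(moment (~~ s) u) !u0 !mulr0 addr0.
Qed.

(** The peak function is affine in the entries of p, and multiplying by such a
   function preserves the vanishing of all moments. *)
Lemma moments_peak : (forall s i1 i2 j1 j2, mom s i1 i2 j1 j2 = 0) ->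
  forall p0 n, mean (fun p => f p * peak p0 p ^+ n) = 0.
Proof.
move=> m0 p0 n.
pose k1 : C := (qr p0 / 4) -i* (qi p0 / 4).
pose k2 : C := (qj p0 / 4) -i* (qk p0 / 4).
pose k3 : C := (- (qj p0 / 4)) -i* (qk p0 / 4).
pose k4 : C := (qr p0 / 4) +i* (qi p0 / 4).
pose k0 : C := (1 / 2 : R)%:C.
pose q p : C := k0 + k1 * U1 p + k2 * U2 p + k3 * V1 p + k4 * V2 p.
have qE p : q p = (peak p0 p)%:C.
  apply/eqP; rewrite eq_complex /q /k0 /k1 /k2 /k3 /k4 /peak /=.
  by apply/andP; split; apply/eqP; field.
have sq : csmooth q.
  apply: csmooth_ext qE _; split; first exact: smooth_peak.
  exact: smooth_cst.
have sm k i1 i2 j1 j2 : csmooth (fun p => mono i1 i2 j1 j2 p * q p ^+ k).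
  by apply: csmoothM; [exact: csmooth_mono|exact: csmoothX].
have van k : forall s i1 i2 j1 j2, moment s (fun p => mono i1 i2 j1 j2 p * q p ^+ k) = 0.
  elim: k => [|k IH] s i1 i2 j1 j2.
    by rewrite -(m0 s i1 i2 j1 j2) /mom; congr moment; apply/funext => p; rewrite mulr1.
  rewrite (_ : (fun p => _) = fun p =>
    k0 * (mono i1 i2 j1 j2 p * q p ^+ k) + k1 * (mono i1.+1 i2 j1 j2 p * q p ^+ k) +
    k2 * (mono i1 i2.+1 j1 j2 p * q p ^+ k) + k3 * (mono i1 i2 j1.+1 j2 p * q p ^+ k) +
    k4 * (mono i1 i2 j1 j2.+1 p * q p ^+ k)); last first.
    by apply/funext => p; rewrite exprS {1}/q /mono !exprS; ring.
  have sz z i i' j j' : csmooth (fun p => z * (mono i i' j j' p * q p ^+ k)).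
    exact: csmoothZ.
  rewrite !momentD //; do ?[by do ?[exact: sz | apply: csmoothD]].
  by rewrite !moment_scale0 // !addr0.
rewrite -(van n true 0%N 0%N 0%N 0%N) /moment; congr mean; apply/funext => p.
by rewrite /mono !expr0 !mul1r qE /part -rmorphXn.
Qed.

Lemma eigenfunction_eq0 : (forall s i1 i2 j1 j2, mom s i1 i2 j1 j2 = 0) ->
  forall p, f p = 0.
Proof. by move=> m0; apply: (peak_orthogonal sf) => p0 n; exact: moments_peak. Qed.

End Moments.

End ComplexFunctions.
(** * The first eigenvalue *)

Section FirstEigenvalue.
Variables (R : realType) (a b c : R).
Hypotheses (ba : b <= a) (cb : c <= b) (c0 : 0 < c).
Implicit Types f : SU2 R -> R.

Let b0 : 0 < b. Proof. exact: lt_le_trans c0 cb. Qed.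
Let a0 : 0 < a. Proof. exact: lt_le_trans b0 ba. Qed.

Definition low_moments f (n : nat) :=
  forall s i1 i2 j1 j2, (i1 + i2 + j1 + j2 = n)%N -> mom f s i1 i2 j1 j2 = 0.

Lemma low_moments0 mu f : eigenspace a b c mu f -> mu != 0 -> low_moments f 0.
Proof.
move=> ef mu0 s i1 i2 j1 j2 h.
have [-> -> -> ->] : [/\ i1 = 0, i2 = 0, j1 = 0 & j2 = 0]%N by split; lia.
have := mom_rec a0 b0 c0 ef s 0 0 0 0; rewrite oplap_degree0 => /esym/eqP.
by rewrite mulf_eq0 (negbTE mu0) /= => /eqP.
Qed.

Lemma low_moments1 mu f : eigenspace a b c mu f -> mu != a ^+ 2 + b ^+ 2 + c ^+ 2 ->
  low_moments f 1.
Proof.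
move=> ef mun s i1 i2 j1 j2 h.
have /eqP := mom_rec a0 b0 c0 ef s i1 i2 j1 j2.
rewrite oplap_degree1 // -subr_eq0 -mulrBl mulf_eq0 subr_eq0 eq_sym (negbTE mun).
by move/eqP.
Qed.

(** Real and imaginary parts of the product of the entries of the first row, and
   the difference of their squared absolute values: the weight 0 functions of
   degree 2. *)
Definition Y0 (p : SU2 R) := qr p * qj p - qi p * qk p.
Definition Y1 (p : SU2 R) := qr p * qk p + qi p * qj p.
Definition Y2 (p : SU2 R) := qr p ^+ 2 + qi p ^+ 2 - (qj p ^+ 2 + qk p ^+ 2).


Lemma monoE : [/\ mono 1 0 0 0 = @U1 R, mono 0 1 0 0 = @U2 R, mono 0 0 1 0 = @V1 R &
  mono 0 0 0 1 = @V2 R].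
Proof. by split; apply/funext => p; rewrite /mono !expr0 expr1 ?mulr1 ?mul1r. Qed.

Lemma mean_mulN f g : smooth f -> smooth g -> mean (fun p => f p * g p) = 0 ->
  mean (fun p => f p * - g p) = 0.
Proof.
move=> sf sg g0; rewrite -[RHS]oppr0 -g0 -meanN; last by apply: smooth_bdd; exact: smoothM.
by congr mean; apply/funext => p; rewrite mulrN.
Qed.

Lemma low_moments1_ortho f : smooth f ->
  mean (fun p => f p * qr p) = 0 -> mean (fun p => f p * qi p) = 0 ->
  mean (fun p => f p * qj p) = 0 -> mean (fun p => f p * qk p) = 0 -> low_moments f 1.
Proof.
move=> sf m0 m1 m2 m3 s i1 i2 j1 j2 h.
have n1 := mean_mulN sf (@smooth_qi R) m1; have n2 := mean_mulN sf (@smooth_qj R) m2.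
have [e1 e2 e3 e4] := monoE; rewrite /mom /moment.
by case: (degree1_cases h) => -[-> -> -> ->]; rewrite ?e1 ?e2 ?e3 ?e4; case: s.
Qed.

Lemma smooth_Y0 : smooth Y0. Proof. by rewrite /Y0; smooth_tac. Qed.
Lemma smooth_Y2 : smooth Y2. Proof. by rewrite /Y2; smooth_tac. Qed.

Lemma part_mono_Y p :
  [/\ part true (mono 1 1 0 0 p) = Y0 p, part false (mono 1 1 0 0 p) = Y1 p,
      part true (mono 0 0 1 1 p) = - Y0 p & part false (mono 0 0 1 1 p) = Y1 p].
Proof.
by rewrite /part /mono !expr0 !expr1 /Y0 /Y1; split; rewrite ?ReM ?ImM /=; ring.
Qed.

Lemma part_mono_Y2 p :
  [/\ part true (mono 1 0 0 1 p) = 2^-1 * (1 + Y2 p), part false (mono 1 0 0 1 p) = 0,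
      part true (mono 0 1 1 0 p) = 2^-1 * (Y2 p - 1) & part false (mono 0 1 1 0 p) = 0].
Proof.
have S := sphere p; rewrite /part /mono !expr0 !expr1 /Y2.
by split; rewrite ?ReM ?ImM /=; lra.
Qed.

(** The products of an entry of the first column and one of the second are
   combinations of Y0, Y1, Y2 and, because det p = 1, of the constant 1. *)
Lemma low_moments2_ortho f : smooth f -> low_moments f 0 ->
  mean (fun p => f p * Y0 p) = 0 -> mean (fun p => f p * Y1 p) = 0 ->
  mean (fun p => f p * Y2 p) = 0 ->
  forall s i1 i2 j1 j2, (i1 + j1 = 1)%N -> (i2 + j2 = 1)%N -> mom f s i1 i2 j1 j2 = 0.
Proof.
move=> sf l0 m0 m1 m2 s i1 i2 j1 j2 h1 h2.
have n0 := mean_mulN sf smooth_Y0 m0.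
have z0 : mean (fun p => f p * 0) = 0.
  rewrite -[RHS](mul0r (mean f)) -meanZ; last exact: smooth_bdd.
  by congr mean; apply/funext => p; ring.
have one : mean f = 0.
  rewrite -[RHS](l0 true 0 0 0 0)%N // /mom /moment; congr mean; apply/funext => p.
  by rewrite /mono !expr0 !mulr1.
have bf : bounded_fct f by exact: smooth_bdd.
have bY : bounded_fct (fun p => f p * Y2 p).
  by apply: smooth_bdd; apply: smoothM => //; exact: smooth_Y2.
have y2p : mean (fun p => f p * (2^-1 * (1 + Y2 p))) = 0.
  rewrite (_ : (fun p => _) = fun p => 2^-1 * (f p + f p * Y2 p)); last first.
    by apply/funext => p; ring.
  by rewrite meanZ ?meanD ?one ?m2 ?addr0 ?mulr0 //; exact: bounded_fctD.
have y2m : mean (fun p => f p * (2^-1 * (Y2 p - 1))) = 0.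
  rewrite (_ : (fun p => _) = fun p => 2^-1 * (f p * Y2 p - f p)); last first.
    by apply/funext => p; ring.
  rewrite meanZ ?meanB ?one ?m2 ?subr0 ?mulr0 //.
  by apply: bounded_fctD => //; exact: bounded_fctN.
have P p := part_mono_Y p; have Q p := part_mono_Y2 p.
have E g : (forall p, part s (mono i1 i2 j1 j2 p) = g p) -> mean (fun p => f p * g p) = 0 ->
    mom f s i1 i2 j1 j2 = 0.
  by move=> hg <-; congr mean; apply/funext => p; rewrite hg.
have C1 (i j : nat) : (i + j = 1)%N -> (i = 0 /\ j = 1 \/ i = 1 /\ j = 0)%N.
  by case: i => [|[|?]]; case: j => [|[|?]] //= _; [left|right].
case: (C1 _ _ h1) (C1 _ _ h2) E => -[-> ->] [] [-> ->] E.
- by case: s E => E; [apply: E n0|apply: E m1] => p; case: (P p).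
- by case: s E => E; [apply: E y2m|apply: E z0] => p; case: (Q p).
- by case: s E => E; [apply: E y2p|apply: E z0] => p; case: (Q p).
by case: s E => E; [apply: E m0|apply: E m1] => p; case: (P p).
Qed.

(** In degree 2 the bound of gershgorin_step is 4 (b^2 + c^2), with the extra term
   4 (a^2 - b^2) for the monomials of nonzero weight; only those of weight 0 have
   to be assumed to vanish when mu = 4 (b^2 + c^2). *)
Lemma eigenfunction_vanish mu f : eigenspace a b c mu f -> mu != 0 ->
  mu <= 4 * (b ^+ 2 + c ^+ 2) -> low_moments f 1 ->
  mu < 4 * (b ^+ 2 + c ^+ 2) \/ b < a /\
    (forall s i1 i2 j1 j2, (i1 + j1 = 1)%N -> (i2 + j2 = 1)%N -> mom f s i1 i2 j1 j2 = 0) ->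
  forall p, f p = 0.
Proof.
move=> ef mu0 mu4 l1 l2; have l0 := low_moments0 ef mu0.
have sf : smooth f by case: ef.
apply: (eigenfunction_eq0 ef) => s.
have rc := mom_rec a0 b0 c0 ef s; have dt := mom_det ef s.
have low n i1 i2 j1 j2 : (n <= 1)%N -> (i1 + i2 + j1 + j2 = n)%N -> mom f s i1 i2 j1 j2 = 0.
  by case: n => [|[|//]] _; [exact: l0|exact: l1].
apply: (moments_vanish ba cb c0 rc dt mu4) => i1 i2 j1 j2 h.
have [h1|h1] := leqP (i1 + i2 + j1 + j2) 1; first exact: low h1 erefl.
apply: (gershgorin_step (n := 2) ba cb c0 rc dt); last by lia.
  by move=> k1 k2 k3 k4 h2; apply: (low 0%N) => //; lia.
move=> k1 k2 k3 k4 h2.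
have k24 : (k1 + k3 = 1)%N -> (k2 + k4 = 1)%N by clear -h2; lia.
have kne : (k1 + k3 = k2 + k4)%N -> (k1 + k3 = 1)%N by clear -h2; lia.
have sq : 0 <= ((k1 + k3)%:R - (k2 + k4)%:R) ^+ 2 :> R by exact: sqr_ge0.
have ab : b ^+ 2 <= a ^+ 2 by rewrite ler_pXn2r // nnegrE ltW.
have nn : 0 <= (a ^+ 2 - b ^+ 2) * ((k1 + k3)%:R - (k2 + k4)%:R) ^+ 2 :> R.
  by rewrite mulr_ge0 // subr_ge0.
have [mlt|[ab' w0]] := l2; first by right; move: nn mlt; lra.
have [k13|k13] := eqVneq (k1 + k3)%N 1%N; first by left; apply: w0 => //; exact: k24.
right; have : 0 < (a ^+ 2 - b ^+ 2) * ((k1 + k3)%:R - (k2 + k4)%:R) ^+ 2 :> R.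
  rewrite mulr_gt0 // ?subr_gt0 ?ltr_pXn2r ?nnegrE ?(ltW a0) ?(ltW b0) //.
  rewrite lt_neqAle sq andbT eq_sym expf_neq0 // subr_eq0 eqr_nat.
  by apply: contra k13 => /eqP /kne ->.
by move: mu4; lra.
Qed.

(** ** The eigenfunctions *)

Lemma part_eigenspace mu (u : SU2 R -> R[i]) s : csmooth u ->
  (forall p, clap a b c u p = mu%:C * u p) ->
  eigenspace a b c mu (fun p => part s (u p)).
Proof.
move=> su eu; apply/(eigenspaceP a0 b0 c0); split; first exact: smooth_part.
move=> p; have := eu p; rewrite /clap.
case: s; rewrite /part => E; [have := congr1 (@Re R) E|have := congr1 (@Im R) E];
  by rewrite ?ReM ?ImM /=; move=> ->; ring.
Qed.

Lemma clapD (u v : SU2 R -> R[i]) p : csmooth u -> csmooth v ->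
  clap a b c (fun q => u q + v q) p = clap a b c u p + clap a b c v p.
Proof.
move=> [u1 u2] [v1 v2]; rewrite /clap.
rewrite (_ : (fun q => Re (u q + v q)) = fun q => Re (u q) + Re (v q)); last first.
  by apply/funext => q; rewrite ReD.
rewrite (_ : (fun q => Im (u q + v q)) = fun q => Im (u q) + Im (v q)); last first.
  by apply/funext => q; rewrite ImD.
by rewrite !lap_add.
Qed.

Let mu1 := a ^+ 2 + b ^+ 2 + c ^+ 2.
Let mu2 := 4 * (b ^+ 2 + c ^+ 2).

Lemma eigen_degree1 s i1 i2 j1 j2 : (i1 + i2 + j1 + j2 = 1)%N ->
  eigenspace a b c mu1 (fun p => part s (mono i1 i2 j1 j2 p)).
Proof.
move=> h; apply: part_eigenspace; first exact: csmooth_mono.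
by move=> p; rewrite clap_mono oplap_degree1 // /mu1 !rmorphD.
Qed.

Lemma eigen_X : [/\ eigenspace a b c mu1 (@qr R), eigenspace a b c mu1 (@qi R),
  eigenspace a b c mu1 (@qj R) & eigenspace a b c mu1 (@qk R)].
Proof.
have [e1 e2 _ _] := monoE.
have U := @eigen_degree1 _ 1 0 0 0 erefl; have V := @eigen_degree1 _ 0 1 0 0 erefl.
rewrite e1 in U; rewrite e2 in V.
by split; [exact: (U true)|exact: (U false)|exact: (V true)|exact: (V false)].
Qed.

Lemma mu2E : mu2%:C = 4 * ((b ^+ 2)%:C + (c ^+ 2)%:C).
Proof.
by apply/eqP; rewrite /mu2 eq_complex /=; apply/andP; split; apply/eqP; ring.
Qed.

Lemma eigen_Y : [/\ eigenspace a b c mu2 Y0, eigenspace a b c mu2 Y1 &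
  eigenspace a b c mu2 Y2].
Proof.
have sm := @csmooth_mono R.
have e1 s : eigenspace a b c mu2 (fun p => part s (mono 1 1 0 0 p)).
  apply: part_eigenspace => // p; rewrite clap_mono mu2E /oplap /opE /opF /=; ring.
have e2 : eigenspace a b c mu2 (fun p => part true (mono 1 0 0 1 p + mono 0 1 1 0 p)).
  apply: part_eigenspace => [|p]; first exact: csmoothD.
  rewrite clapD // !clap_mono mu2E /oplap /opE /opF /=; ring.
split.
- by have := e1 true; congr eigenspace; apply/funext => p; case: (part_mono_Y p).
- by have := e1 false; congr eigenspace; apply/funext => p; case: (part_mono_Y p).
have := e2; congr eigenspace; apply/funext => p; rewrite /part ReD.
by have [+ _ + _] := part_mono_Y2 p; rewrite /part => -> ->; field.
Qed.

Lemma pointP (x0 x1 x2 x3 : R) : x0 ^+ 2 + x1 ^+ 2 + x2 ^+ 2 + x3 ^+ 2 = 1 ->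
  exists p : SU2 R, [/\ qr p = x0, qi p = x1, qj p = x2 & qk p = x3].
Proof.
by move=> h; exists (mkq h); rewrite /qr /qi /qj /qk /= !mxE.
Qed.

Definition eX (k : 'I_4) : SU2 R -> R := nth (fun=> 0) [:: @qr R; @qi R; @qj R; @qk R] k.
Definition eY (k : 'I_3) : SU2 R -> R := nth (fun=> 0) [:: Y0; Y1; Y2] k.
Definition eXY (k : 'I_7) : SU2 R -> R :=
  nth (fun=> 0) [:: @qr R; @qi R; @qj R; @qk R; Y0; Y1; Y2] k.

(** Evaluate at the units, at - 1, and at two points where Y0 and Y1 do not both
   vanish. *)
Lemma span_X_Y (x0 x1 x2 x3 y0 y1 y2 : R) :
  (forall p, x0 * qr p + x1 * qi p + x2 * qj p + x3 * qk p +
    y0 * Y0 p + y1 * Y1 p + y2 * Y2 p = 0) ->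
  [/\ x0 = 0, x1 = 0, x2 = 0 & x3 = 0] /\ [/\ y0 = 0, y1 = 0 & y2 = 0].
Proof.
move=> h.
have at_pt u0 u1 u2 u3 : u0 ^+ 2 + u1 ^+ 2 + u2 ^+ 2 + u3 ^+ 2 = 1 ->
    x0 * u0 + x1 * u1 + x2 * u2 + x3 * u3 + y0 * (u0 * u2 - u1 * u3) +
    y1 * (u0 * u3 + u1 * u2) + y2 * (u0 ^+ 2 + u1 ^+ 2 - (u2 ^+ 2 + u3 ^+ 2)) = 0.
  by move=> /pointP[p [<- <- <- <-]]; exact: h.
have h0 : x0 + y2 = 0 by have := at_pt 1 0 0 0; lra.
have h0' : - x0 + y2 = 0 by have := at_pt (-1) 0 0 0; lra.
have h1 : x1 + y2 = 0 by have := at_pt 0 1 0 0; lra.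
have h2 : x2 - y2 = 0 by have := at_pt 0 0 1 0; lra.
have h3 : x3 - y2 = 0 by have := at_pt 0 0 0 1; lra.
have h4 := at_pt (3 / 5) 0 (4 / 5) 0; have h5 := at_pt (3 / 5) 0 0 (4 / 5).
have q : (3 / 5 : R) ^+ 2 + 0 ^+ 2 + (4 / 5) ^+ 2 + 0 ^+ 2 = 1 by field.
have q' : (3 / 5 : R) ^+ 2 + 0 ^+ 2 + 0 ^+ 2 + (4 / 5) ^+ 2 = 1 by field.
move: (h4 q) (h5 q') => {}h4 {}h5.
have y20 : y2 = 0 by lra.
have [z0 z1 z2 z3] : [/\ x0 = 0, x1 = 0, x2 = 0 & x3 = 0] by split; lra.
move: h4 h5; rewrite z0 z1 z2 z3 y20 => h4 h5.
by split; split => //; lra.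
Qed.

Lemma sum_eX (x : 'I_4 -> R) p : \sum_(k < 4) x k * eX k p =
  x 0 * qr p + x 1 * qi p + x 2%:R * qj p + x 3%:R * qk p.
Proof.
by rewrite !big_ord_recl big_ord0 addr0 !addrA; congr (_ * _ + _ * _ + _ * _ + _ * _);
  congr x; apply/val_inj.
Qed.

Lemma sum_eY (x : 'I_3 -> R) p : \sum_(k < 3) x k * eY k p =
  x 0 * Y0 p + x 1 * Y1 p + x 2%:R * Y2 p.
Proof.
by rewrite !big_ord_recl big_ord0 addr0 !addrA; congr (_ * _ + _ * _ + _ * _);
  congr x; apply/val_inj.
Qed.

Lemma sum_eXY (x : 'I_7 -> R) p : \sum_(k < 7) x k * eXY k p =
  x 0 * qr p + x 1 * qi p + x 2%:R * qj p + x 3%:R * qk p +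
  x 4%:R * Y0 p + x 5%:R * Y1 p + x 6%:R * Y2 p.
Proof.
rewrite !big_ord_recl big_ord0 addr0 !addrA.
by congr (_ * _ + _ * _ + _ * _ + _ * _ + _ * _ + _ * _ + _ * _);
  congr x; apply/val_inj.
Qed.

Let mu1_gt0 : 0 < mu1. Proof. by rewrite /mu1 !addr_gt0 ?exprn_gt0. Qed.
Let mu2_gt0 : 0 < mu2. Proof. by rewrite /mu2 mulr_gt0 ?addr_gt0 ?exprn_gt0. Qed.

Lemma first_eigenvalue_le nu : is_eigenvalue a b c nu -> nu != 0 -> Num.min mu1 mu2 <= nu.
Proof.
move=> [f ef [p fp]] nu0; rewrite leNgt; apply/negP; rewrite lt_min => /andP[n1 n2].
have : f p = 0.
  apply: (eigenfunction_vanish ef nu0 (ltW n2)); last by left.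
  by apply: low_moments1 ef _; rewrite lt_eqF.
by move/eqP; rewrite (negbTE fp).
Qed.

Lemma mu1_eigenvalue : is_eigenvalue a b c mu1.
Proof.
have [e _ _ _] := eigen_X; exists (@qr R) => //.
have [p [p0 _ _ _]] := @pointP 1 0 0 0 ltac:(ring).
by exists p; rewrite p0 oner_eq0.
Qed.

Lemma mu2_eigenvalue : is_eigenvalue a b c mu2.
Proof.
have [_ _ e] := eigen_Y; exists Y2 => //.
have [p [p0 p1 p2 p3]] := @pointP 1 0 0 0 ltac:(ring).
by exists p; rewrite /Y2 p0 p1 p2 p3 expr1n !expr0n /= !addr0 subr0 oner_eq0.
Qed.

Lemma mu1_multiplicity : mu1 < mu2 -> has_multiplicity a b c mu1 4.
Proof.
move=> m12; have [e0 e1 e2 e3] := eigen_X.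
apply: (basis_multiplicity a0 b0 c0 (e := eX)).
- by case=> [[|[|[|[|//]]]] ?].
- move=> x h; have := @span_X_Y (x 0) (x 1) (x 2%:R) (x 3%:R) 0 0 0.
  case=> [p|[x0 x1 x2 x3] _]; first by rewrite !mul0r !addr0 -sum_eX; exact: h.
  by case=> [[|[|[|[|//]]]] ?]; [rewrite -[RHS]x0|rewrite -[RHS]x1|rewrite -[RHS]x2|
    rewrite -[RHS]x3]; congr x; apply/val_inj.
move=> f ef ortho; have sf : smooth f by case: ef.
apply: (eigenfunction_vanish ef (lt0r_neq0 mu1_gt0) (ltW m12)); last by left.
apply: low_moments1_ortho => //.
- exact: (ortho 0).
- exact: (ortho 1).
- exact: (ortho 2%:R).
- exact: (ortho 3%:R).
Qed.

Let b_lt_a : mu2 <= mu1 -> b < a.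
Proof.
move=> h; rewrite -(@ltr_pXn2r _ 2) ?nnegrE ?(ltW a0) ?(ltW b0) //.
have : 0 < b ^+ 2 by rewrite exprn_gt0.
have : 0 < c ^+ 2 by rewrite exprn_gt0.
by move: h; rewrite /mu1 /mu2; lra.
Qed.

Lemma mu2_multiplicity : mu2 < mu1 -> has_multiplicity a b c mu2 3.
Proof.
move=> m12; have [e0 e1 e2] := eigen_Y.
apply: (basis_multiplicity a0 b0 c0 (e := eY)).
- by case=> [[|[|[|//]]] ?].
- move=> x h; have := @span_X_Y 0 0 0 0 (x 0) (x 1) (x 2%:R).
  case=> [p|_ [x0 x1 x2]]; first by rewrite !mul0r !add0r -sum_eY; exact: h.
  by case=> [[|[|[|//]]] ?]; [rewrite -[RHS]x0|rewrite -[RHS]x1|rewrite -[RHS]x2];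
    congr x; apply/val_inj.
move=> f ef ortho; have sf : smooth f by case: ef.
have mu20 := lt0r_neq0 mu2_gt0.
apply: (eigenfunction_vanish ef mu20 (lexx _)).
  by apply: low_moments1 ef _; rewrite lt_eqF.
right; split; first by apply: b_lt_a; exact: ltW.
apply: low_moments2_ortho => //; first exact: low_moments0 ef mu20.
- exact: (ortho 0).
- exact: (ortho 1).
- exact: (ortho 2%:R).
Qed.

Lemma resonant_multiplicity : mu1 = mu2 -> has_multiplicity a b c mu1 7.
Proof.
move=> m12; have [e0 e1 e2 e3] := eigen_X; have [y0 y1 y2] := eigen_Y.
apply: (basis_multiplicity a0 b0 c0 (e := eXY)).
- by rewrite -m12 in y0 y1 y2; case=> [[|[|[|[|[|[|[|//]]]]]]] ?].
- move=> x h; have := @span_X_Y (x 0) (x 1) (x 2%:R) (x 3%:R) (x 4%:R) (x 5%:R) (x 6%:R).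
  case=> [p|[x0 x1 x2 x3] [x4 x5 x6]]; first by rewrite -sum_eXY; exact: h.
  by case=> [[|[|[|[|[|[|[|//]]]]]]] ?]; [rewrite -[RHS]x0|rewrite -[RHS]x1|
    rewrite -[RHS]x2|rewrite -[RHS]x3|rewrite -[RHS]x4|rewrite -[RHS]x5|rewrite -[RHS]x6];
    congr x; apply/val_inj.
move=> f ef ortho; have sf : smooth f by case: ef.
have mu10 := lt0r_neq0 mu1_gt0.
apply: (eigenfunction_vanish ef mu10); first by rewrite m12.
  apply: low_moments1_ortho => //.
  - exact: (ortho 0).
  - exact: (ortho 1).
  - exact: (ortho 2%:R).
  - exact: (ortho 3%:R).
right; split; first by apply: b_lt_a; rewrite m12.
apply: low_moments2_ortho => //; first exact: low_moments0 ef mu10.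
- exact: (ortho 4%:R).
- exact: (ortho 5%:R).
- exact: (ortho 6%:R).
Qed.

Lemma min_is_lambda1 : is_lambda1 a b c (Num.min mu1 mu2).
Proof.
split; last exact: first_eigenvalue_le.
  by case: leP => _; [exact: mu1_eigenvalue|exact: mu2_eigenvalue].
by case: leP => _; rewrite gt_eqF.
Qed.

End FirstEigenvalue.

Theorem theorem1p1 (R : realType) (a b c : R) :
  b <= a -> c <= b -> 0 < c ->
  let l1 := Num.min (a ^+ 2 + b ^+ 2 + c ^+ 2) (4 * (b ^+ 2 + c ^+ 2)) in
  is_lambda1 a b c l1 /\
  [/\ a ^+ 2 + b ^+ 2 + c ^+ 2 < 4 * (b ^+ 2 + c ^+ 2) ->
        has_multiplicity a b c l1 4,
      a ^+ 2 + b ^+ 2 + c ^+ 2 = 4 * (b ^+ 2 + c ^+ 2) ->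
        has_multiplicity a b c l1 7 &
      a ^+ 2 + b ^+ 2 + c ^+ 2 > 4 * (b ^+ 2 + c ^+ 2) ->
        has_multiplicity a b c l1 3].
Proof.
move=> ba cb c0 l1; split; first exact: min_is_lambda1.
split=> h; rewrite /l1.
- by rewrite min_l ?(ltW h) //; exact: mu1_multiplicity.
- by rewrite min_l ?h //; have := resonant_multiplicity ba cb c0 h; rewrite h.
- by rewrite min_r ?(ltW h) //; exact: mu2_multiplicity.
Qed.
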